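(* Let $\mathcal{D}$ be a $\Bbbk$-linear triangulated category with a t-structure $(\mathcal{D}^{\le 0},\mathcal{D}^{\ge 0})$ with heart $\mathcal{A}$. Let $\epsilon=(E_1,\ldots,E_n)$ be an exceptional sequence in $\mathcal{D}$ (not necessarily full) with left dual $(F_n,\ldots,F_1)$, and put $\mathcal{C}:=\langle E_1,\ldots,E_n\rangle$. (1) If $E_i\in\mathcal{D}^{\le 0}$ and $F_i\in\mathcal{D}^{\ge 0}$ for all $i$, then the t-structure on $\mathcal{D}$ restricts to the t-structure on $\mathcal{C}$ glued along the exceptional sequence $(E_1,\ldots,E_n)$. The heart of this t-structure is $\mathcal{A}\cap\mathcal{C}$. (2) If $E_i,F_i\in\mathcal{A}$ for all $i$, then $\mathcal{A}\cap\mathcal{C}$ has a structure of a highest weight category with standard objects $\{E_i\}$, costandard objects $\{F_i\}$ and the order on irreducible objects induced by $\epsilon$.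
   Context: $\Bbbk$ is an algebraically closed field; all categories and functors are $\Bbbk$-linear. For objects $Y,Z$ of a triangulated category $\mathcal{D}$, $\operatorname{Hom}^{\bullet}_{\mathcal{D}}(Y,Z)=\bigoplus_{l\in\mathbb{Z}}\operatorname{Hom}_{\mathcal{D}}(Y,Z[l])$. A t-structure on $\mathcal{D}$ restricts to a full triangulated subcategory $\mathcal{C}$ if $(\mathcal{D}^{\le 0}\cap\mathcal{C},\mathcal{D}^{\ge 0}\cap\mathcal{C})$ is a t-structure on $\mathcal{C}$. Exceptional sequences. A sequence $(E_1,\ldots,E_n)$ of objects of $\mathcal{D}$ is exceptional if $\operatorname{Hom}^{\bullet}(E_i,E_i)=\Bbbk$ (in degree $0$), $\operatorname{Hom}^{\bullet}(E_j,E_i)=0$ for $j>i$, and all $\operatorname{Hom}^{\bullet}(E_i,E_j)$ are of finite total dimension. $\langle E_1,\ldots,E_s\rangle$ is the full triangulated subcategory generated by $E_1,\dots,E_s$. The left mutation $L_EF$ of an exceptional pair $(E,F)$ is defined by the canonical triangle $\operatorname{Hom}^{\bullet}(E,F)\otimes E\to F\to L_EF\to$. The left dual sequence $(F_n,\ldots,F_1)$ is given by $F_1=E_1$, $F_i=L_{E_1}\cdots L_{E_{i-1}}E_i$; inside $\langle E_1,\dots,E_n\rangle$ it is uniquely characterised by $\operatorname{Hom}_{\mathcal{D}}(E_i,F_j[l])=\Bbbk$ if $i=j,\ l=0$, and $0$ otherwise. Glued t-structure. Put $\mathcal{C}_s=\langle E_1,\ldots,E_s\rangle$. There is a recollement of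 $\mathcal{C}_s$ with closed part $i_{s*}:\mathcal{C}_{s-1}\hookrightarrow\mathcal{C}_s$ (adjoints $i_s^*\dashv i_{s*}\dashv i_s^!$) and open part $j_s^*:\mathcal{C}_s\to\mathcal{C}_s/\mathcal{C}_{s-1}\cong\mathcal{D}^b(\Bbbk)$ (adjoints $j_{s!}\dashv j_s^*\dashv j_{s*}$), with $j_{s!}(\Bbbk)=E_s$, $j_{s*}(\Bbbk)=F_s$. The t-structure glued along $(E_1,\ldots,E_n)$ on $\mathcal{C}=\mathcal{C}_n$ is defined inductively, starting from $\mathcal{C}_0=0$, by $\mathcal{C}_s^{\le 0}=\{D: i_s^*D\in\mathcal{C}_{s-1}^{\le 0},\ j_s^*D\in\mathcal{D}^b(\Bbbk)^{\le 0}\}$ and $\mathcal{C}_s^{\ge 0}=\{D: i_s^!D\in\mathcal{C}_{s-1}^{\ge 0},\ j_s^*D\in\mathcal{D}^b(\Bbbk)^{\ge 0}\}$, where $\mathcal{D}^b(\Bbbk)$ has the standard t-structure. Highest weight categories. A $\Bbbk$-linear abelian category is Deligne finite if it is $\operatorname{Hom}$- and $\operatorname{Ext}^1$-finite, has finitely many irreducible objects up to isomorphism, every object has a finite filtration with irreducible graded factors, and it has a projective generator. Let $\Lambda$ be a partial order on the set of isomorphism classes of irreducible objects; write $L(\lambda)$, $P(\lambda)$, $I(\lambda)$ for the irreducible object labelled by $\lambda$, its projective cover and injective hull. The order is assumed adapted: for any $M$ with top $L(\lambda_1)$ and socle $L(\lambda_2)$, with $\lambda_1,\lambda_2$ incomparable,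 there is $\mu\succeq\lambda_1,\lambda_2$ such that $L(\mu)$ is a graded factor of a filtration of $M$. A Deligne finite category with such $\Lambda$ is a highest weight category if there are standard objects $\Delta(\lambda)$, $\lambda\in\Lambda$, with: (st1) an epimorphism $\Delta(\lambda)\to L(\lambda)$ whose kernel is filtered with graded factors $L(\mu)$, $\mu\prec\lambda$; (st2) an epimorphism $P(\lambda)\to\Delta(\lambda)$ whose kernel is filtered with graded factors $\Delta(\mu)$, $\mu\succ\lambda$. Then there are costandard objects $\nabla(\lambda)$ with: (cost1) a monomorphism $L(\lambda)\to\nabla(\lambda)$ whose cokernel is filtered by $L(\mu)$, $\mu\prec\lambda$; (cost2) a monomorphism $\nabla(\lambda)\to I(\lambda)$ whose cokernel is filtered by $\nabla(\mu)$, $\mu\succ\lambda$. The order induced by $\epsilon$ with standard objects $\{E_i\}$ and costandard objects $\{F_i\}$ means: the irreducible objects are labelled $L(1),\ldots,L(n)$, ordered by $1<\cdots<n$, with $\Delta(i)=E_i$, $\nabla(i)=F_i$. *)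

(* Defs.v *)
From HB Require Import structures.
From Stdlib Require List.
From mathcomp Require Import all_boot all_order all_algebra.

Set Implicit Arguments.
Unset Strict Implicit.
Unset Printing Implicit Defensive.

Import GRing.Theory.
Local Open Scope ring_scope.

(** * Linear algebra *)

Definition is_trivial (K : fieldType) (V : lmodType K) : Prop :=
  forall v : V, v = 0.

Definition fin_dim (K : fieldType) (V : lmodType K) : Prop :=
  exists (n : nat) (e : 'I_n -> V),
    forall v : V, exists c : 'I_n -> K, v = \sum_i c i *: e i.

(** * [K]-linear categories *)

Record klincat (K : fieldType) := KLinCat {
  kobj :> Type;
  hom : kobj -> kobj -> lmodType K;
  idm : forall X, hom X X;
  comp : forall X Y Z, hom Y Z -> hom X Y -> hom X Z;
  compA : forall X Y Z W (h : hom Z W) (g : hom Y Z) (f : hom X Y),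
    comp h (comp g f) = comp (comp h g) f;
  comp1m : forall X Y (f : hom X Y), comp (idm Y) f = f;
  compm1 : forall X Y (f : hom X Y), comp f (idm X) = f;
  comp_linearl : forall X Y Z (f : hom X Y),
    linear (fun g : hom Y Z => comp g f);
  comp_linearr : forall X Y Z (g : hom Y Z),
    linear (fun f : hom X Y => comp g f)
}.

Arguments hom {K k} X Y.
Arguments idm {K k} X.
Arguments comp {K k X Y Z} g f.

Notation "g \oc f" := (comp g f) (at level 50, left associativity).

Section Categories.

Variables (K : fieldType) (A : klincat K).
Implicit Types X Y Z W : A.

Definition is_iso X Y (f : hom X Y) : Prop :=
  exists g : hom Y X, g \oc f = idm X /\ f \oc g = idm Y.

Definition isomorphic X Y : Prop := exists f : hom X Y, is_iso f.

Definition zero_object X : Prop :=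
  forall Y, is_trivial (hom X Y) /\ is_trivial (hom Y X).

Definition is_direct_sum m (X : 'I_m -> A) H
    (i : forall a, hom (X a) H) (p : forall a, hom H (X a)) : Prop :=
  [/\ forall a, p a \oc i a = idm (X a),
      forall a b, a <> b -> p b \oc i a = 0
    & \sum_a (i a \oc p a) = idm H].

(* The case [m = 0] gives a zero object. *)
Definition additive_cat : Prop :=
  forall m (X : 'I_m -> A), exists H i p, @is_direct_sum m X H i p.

Definition mono X Y (f : hom X Y) : Prop :=
  forall Z (g h : hom Z X), f \oc g = f \oc h -> g = h.

Definition epi X Y (f : hom X Y) : Prop :=
  forall Z (g h : hom Y Z), g \oc f = h \oc f -> g = h.

Definition is_kernel X Y N (f : hom X Y) (k : hom N X) : Prop :=
  f \oc k = 0 /\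
  forall Z (g : hom Z X), f \oc g = 0 -> exists! u : hom Z N, k \oc u = g.

Definition is_cokernel X Y C (f : hom X Y) (c : hom Y C) : Prop :=
  c \oc f = 0 /\
  forall Z (g : hom Y Z), g \oc f = 0 -> exists! u : hom C Z, u \oc c = g.

Record abelian_cat : Prop := AbelianCat {
  abelian_additive : additive_cat;
  abelian_kernel : forall X Y (f : hom X Y),
    exists N (k : hom N X), is_kernel f k;
  abelian_cokernel : forall X Y (f : hom X Y),
    exists C (c : hom Y C), is_cokernel f c;
  abelian_mono : forall X Y (f : hom X Y), mono f ->
    exists Z (g : hom Y Z), is_kernel g f;
  abelian_epi : forall X Y (f : hom X Y), epi f ->
    exists Z (g : hom Z X), is_cokernel g f
}.

Definition short_exact X Y Z (f : hom X Y) (g : hom Y Z) : Prop :=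
  is_kernel g f /\ is_cokernel f g.

(** ** Yoneda [Ext^1] *)

Record extension X Y := Extension {
  ext_mid : A;
  ext_in : hom Y ext_mid;
  ext_out : hom ext_mid X;
  ext_exact : short_exact ext_in ext_out
}.

(* [zeta] represents the Baer linear combination [\sum_a c a *: xi a]: with [W]
   the fibre product over [X] of the middle terms of the [xi a], whose kernel
   onto [X] is the direct sum of [n] copies of [Y], there is a morphism from [W]
   to the middle term of [zeta] which lies over [X] and restricts to
   [y |-> \sum_a c a *: y a] on that kernel. *)
Definition ext_lincomb X Y n (xi : 'I_n -> extension X Y) (c : 'I_n -> K)
    (zeta : extension X Y) : Prop :=
  exists W (p : forall a, hom W (ext_mid (xi a))) (q : hom W X)
      (w : hom W (ext_mid zeta)),
    [/\ forall a, ext_out (xi a) \oc p a = q,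
        forall T (t : forall a, hom T (ext_mid (xi a))) (r : hom T X),
          (forall a, ext_out (xi a) \oc t a = r) ->
          exists! u : hom T W, (forall a, p a \oc u = t a) /\ q \oc u = r,
        ext_out zeta \oc w = q
      & forall T (y : 'I_n -> hom T Y) (u : hom T W),
          (forall a, p a \oc u = ext_in (xi a) \oc y a) -> q \oc u = 0 ->
          w \oc u = ext_in zeta \oc (\sum_a c a *: y a)].

Definition ext1_fin_dim X Y : Prop :=
  exists n (xi : 'I_n -> extension X Y), forall zeta : extension X Y,
    exists c : 'I_n -> K, ext_lincomb xi c zeta.

(** ** Deligne finite categories *)

Definition irreducible_obj X : Prop :=
  ~ zero_object X /\
  forall Y (f : hom Y X), mono f -> zero_object Y \/ is_iso f.

(* [filtration s M]: [M] has a finite filtration whose graded factors, listed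
   from the top one down, are the objects of [s]. *)
Inductive filtration : seq A -> A -> Prop :=
| filtration_nil M : zero_object M -> filtration [::] M
| filtration_cons s N M Z (f : hom N M) (g : hom M Z) :
    short_exact f g -> filtration s N -> filtration (Z :: s) M.

Definition filtered_by (P : A -> Prop) M : Prop :=
  exists2 s : seq A, filtration s M & List.Forall P s.

Definition graded_factor Z M : Prop :=
  exists2 s : seq A, filtration s M & List.In Z s.

Definition projective_obj P : Prop :=
  forall X Y (g : hom X Y), epi g ->
  forall f : hom P Y, exists h : hom P X, g \oc h = f.

Definition injective_obj J : Prop :=
  forall X Y (g : hom X Y), mono g ->
  forall f : hom X J, exists h : hom Y J, h \oc g = f.

Definition generator P : Prop :=
  forall X Y (f g : hom X Y), (forall p : hom P X, f \oc p = g \oc p) -> f = g.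

Definition projective_cover P X (p : hom P X) : Prop :=
  [/\ projective_obj P, epi p
    & forall Z (u : hom Z P), epi (p \oc u) -> epi u].

Definition injective_hull J X (i : hom X J) : Prop :=
  [/\ injective_obj J, mono i
    & forall Z (u : hom J Z), mono (u \oc i) -> mono u].

Record deligne_finite : Prop := DeligneFinite {
  df_abelian : abelian_cat;
  df_hom : forall X Y, fin_dim (hom X Y);
  df_ext1 : forall X Y, ext1_fin_dim X Y;
  df_irreducible : exists m (S : 'I_m -> A),
    forall X, irreducible_obj X -> exists i, isomorphic X (S i);
  df_length : forall X, filtered_by irreducible_obj X;
  df_generator : exists P, projective_obj P /\ generator P
}.

(** ** Highest weight categories *)

(* The radical is the largest subobject annihilated by all epimorphisms onto
   irreducible objects, that is the intersection of the maximal subobjects. *)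
Definition is_radical M R (r : hom R M) : Prop :=
  [/\ mono r,
      forall X (g : hom M X), irreducible_obj X -> epi g -> g \oc r = 0
    & forall Z (h : hom Z M),
        (forall X (g : hom M X), irreducible_obj X -> epi g -> g \oc h = 0) ->
        exists u : hom Z R, r \oc u = h].

Definition has_top M T : Prop :=
  exists R (r : hom R M) (p : hom M T), is_radical r /\ is_cokernel r p.

(* The socle is the smallest subobject containing all irreducible ones. *)
Definition has_socle M T : Prop :=
  exists s : hom T M,
    [/\ mono s,
        forall X (g : hom X M), irreducible_obj X -> mono g ->
          exists u : hom X T, s \oc u = g
      & forall Z (h : hom Z M), mono h ->
          (forall X (g : hom X M), irreducible_obj X -> mono g ->
             exists u : hom X Z, h \oc u = g) ->
          exists u : hom T Z, h \oc u = s].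

Section HighestWeight.

Variables (I : finType) (le : rel I) (L Delta Nabla : I -> A).

Definition slt i j : Prop := le i j /\ i <> j.

Definition irreducible_labelling : Prop :=
  [/\ forall i, irreducible_obj (L i),
      forall i j, isomorphic (L i) (L j) -> i = j
    & forall X, irreducible_obj X -> exists i, isomorphic X (L i)].

Definition adapted_order : Prop :=
  forall M i1 i2, has_top M (L i1) -> has_socle M (L i2) ->
    ~~ le i1 i2 -> ~~ le i2 i1 ->
    exists j, [/\ le i1 j, le i2 j & graded_factor (L j) M].

Record highest_weight : Prop := HighestWeight {
  hw_finite : deligne_finite;
  hw_labelling : irreducible_labelling;
  hw_order : [/\ reflexive le, antisymmetric le & transitive le];
  hw_adapted : adapted_order;
  hw_st1 : forall i, exists N (k : hom N (Delta i)) (p : hom (Delta i) (L i)),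
    short_exact k p /\
    filtered_by (fun Z => exists2 j, slt j i & Z = L j) N;
  hw_st2 : forall i, exists P (c : hom P (L i)) N (k : hom N P)
      (p : hom P (Delta i)),
    [/\ projective_cover c, short_exact k p
      & filtered_by (fun Z => exists2 j, slt i j & Z = Delta j) N];
  hw_cost1 : forall i, exists N (m : hom (L i) (Nabla i)) (c : hom (Nabla i) N),
    short_exact m c /\
    filtered_by (fun Z => exists2 j, slt j i & Z = L j) N;
  hw_cost2 : forall i, exists J (h : hom (L i) J) N (m : hom (Nabla i) J)
      (c : hom J N),
    [/\ injective_hull h, short_exact m c
      & filtered_by (fun Z => exists2 j, slt i j & Z = Nabla j) N]
}.

End HighestWeight.

End Categories.

Definition full_subcat (K : fieldType) (A : klincat K) (P : A -> Prop) :
    klincat K :=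
  {| kobj := {X : A | P X};
     hom := fun X Y => hom (sval X) (sval Y);
     idm := fun X => idm (sval X);
     comp := fun X Y Z => @comp K A (sval X) (sval Y) (sval Z);
     compA := fun X Y Z W => @compA K A (sval X) (sval Y) (sval Z) (sval W);
     comp1m := fun X Y => @comp1m K A (sval X) (sval Y);
     compm1 := fun X Y => @compm1 K A (sval X) (sval Y);
     comp_linearl := fun X Y Z =>
       @comp_linearl K A (sval X) (sval Y) (sval Z);
     comp_linearr := fun X Y Z =>
       @comp_linearr K A (sval X) (sval Y) (sval Z) |}.

(** * Triangulated categories *)

Record klinfun (K : fieldType) (A B : klincat K) := KLinFun {
  fobj :> A -> B;
  fmap : forall X Y, hom X Y -> hom (fobj X) (fobj Y);
  fmap_linear : forall X Y, linear (@fmap X Y);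
  fmap_id : forall X, fmap (idm X) = idm (fobj X);
  fmap_comp : forall X Y Z (g : hom Y Z) (f : hom X Y),
    fmap (g \oc f) = fmap g \oc fmap f
}.

Definition id_iso_comp (K : fieldType) (A B : klincat K)
    (F : klinfun A B) (G : klinfun B A) : Prop :=
  exists eta : forall X : A, hom X (G (F X)),
    (forall X, is_iso (eta X)) /\
    (forall X Y (f : hom X Y), eta Y \oc f = fmap G (fmap F f) \oc eta X).

Record tricat (K : fieldType) := TriCat {
  tcat :> klincat K;
  tcat_additive : additive_cat tcat;
  sh1 : klinfun tcat tcat;
  shm1 : klinfun tcat tcat;
  sh1K : id_iso_comp sh1 shm1;
  shm1K : id_iso_comp shm1 sh1;
  triangle : forall X Y Z : tcat, hom X Y -> hom Y Z -> hom Z (sh1 X) -> Prop;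
  triangle_id : forall X Z : tcat, zero_object Z ->
    triangle (idm X) (0 : hom X Z) 0;
  triangle_iso : forall (X Y Z X' Y' Z' : tcat)
    (f : hom X Y) (g : hom Y Z) (h : hom Z (sh1 X))
    (f' : hom X' Y') (g' : hom Y' Z') (h' : hom Z' (sh1 X'))
    (a : hom X X') (b : hom Y Y') (c : hom Z Z'),
    is_iso a -> is_iso b -> is_iso c ->
    b \oc f = f' \oc a -> c \oc g = g' \oc b -> fmap sh1 a \oc h = h' \oc c ->
    triangle f g h -> triangle f' g' h';
  triangle_cone : forall (X Y : tcat) (f : hom X Y),
    exists Z (g : hom Y Z) (h : hom Z (sh1 X)), triangle f g h;
  triangle_rot : forall (X Y Z : tcat)
    (f : hom X Y) (g : hom Y Z) (h : hom Z (sh1 X)),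
    triangle f g h <-> triangle g h (- fmap sh1 f);
  triangle_fill : forall (X Y Z X' Y' Z' : tcat)
    (f : hom X Y) (g : hom Y Z) (h : hom Z (sh1 X))
    (f' : hom X' Y') (g' : hom Y' Z') (h' : hom Z' (sh1 X'))
    (a : hom X X') (b : hom Y Y'),
    triangle f g h -> triangle f' g' h' -> b \oc f = f' \oc a ->
    exists c : hom Z Z', c \oc g = g' \oc b /\ fmap sh1 a \oc h = h' \oc c;
  triangle_octa : forall (X Y Z Q1 Q2 Q3 : tcat) (f : hom X Y) (g : hom Y Z)
    (p1 : hom Y Q1) (d1 : hom Q1 (sh1 X))
    (p2 : hom Z Q2) (d2 : hom Q2 (sh1 X))
    (p3 : hom Z Q3) (d3 : hom Q3 (sh1 Y)),
    triangle f p1 d1 -> triangle (g \oc f) p2 d2 -> triangle g p3 d3 ->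
    exists (u : hom Q1 Q2) (v : hom Q2 Q3),
      triangle u v (fmap sh1 p1 \oc d3) /\
      [/\ u \oc p1 = p2 \oc g, d2 \oc u = d1, v \oc p2 = p3
        & d3 \oc v = fmap sh1 f \oc d2]
}.

Section Triangulated.

Variables (K : fieldType) (D : tricat K).
Implicit Types X Y Z : D.

Definition shift (l : int) X : D :=
  match l with
  | Posz k => iter k (sh1 D) X
  | Negz k => iter k.+1 (shm1 D) X
  end.

Fixpoint iter_fmap (G : klinfun D D) k X Y (f : hom X Y) :
    hom (iter k G X) (iter k G Y) :=
  match k with
  | 0 => f
  | k'.+1 => fmap G (iter_fmap G k' f)
  end.

Definition shift_map (l : int) X Y (f : hom X Y) :
    hom (shift l X) (shift l Y) :=
  match l with
  | Posz k => iter_fmap (sh1 D) k f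
  | Negz k => iter_fmap (shm1 D) k.+1 f
  end.

Definition Hombul X Y : int -> lmodType K := fun l => hom X (shift l Y).

(** ** t-structures and triangulated subcategories *)

Record tri_subcat (C : D -> Prop) : Prop := TriSubcat {
  tri_subcat0 : forall X, zero_object X -> C X;
  tri_subcat_iso : forall X Y, isomorphic X Y -> C X -> C Y;
  tri_subcat_sh1 : forall X, C X -> C (sh1 D X);
  tri_subcat_shm1 : forall X, C X -> C (shm1 D X);
  tri_subcat_cone : forall X Y Z (f : hom X Y) (g : hom Y Z)
    (h : hom Z (sh1 D X)), triangle f g h -> C X -> C Y -> C Z
}.

Definition generated (S : D -> Prop) X : Prop :=
  forall C : D -> Prop, tri_subcat C -> (forall Y, S Y -> C Y) -> C X.

(* A t-structure on the full triangulated subcategory [C] of [D], given by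
   classes of objects of [D]; "Y in C^{>= 1}" reads [ge (sh1 D Y)]. *)
Record t_structure_on (C le ge : D -> Prop) : Prop := TStructureOn {
  ts_le_sub : forall X, le X -> C X;
  ts_ge_sub : forall X, ge X -> C X;
  ts_le_iso : forall X Y, isomorphic X Y -> le X -> le Y;
  ts_ge_iso : forall X Y, isomorphic X Y -> ge X -> ge Y;
  ts_le_shift : forall X, le X -> le (sh1 D X);
  ts_ge_shift : forall X, ge X -> ge (shm1 D X);
  ts_orth : forall X Y, C Y -> le X -> ge (sh1 D Y) -> is_trivial (hom X Y);
  ts_trunc : forall X, C X -> exists A B (f : hom A X) (g : hom X B)
    (h : hom B (sh1 D A)), [/\ C B, le A, ge (sh1 D B) & triangle f g h]
}.

Definition t_structure (le ge : D -> Prop) : Prop :=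
  t_structure_on (fun _ => True) le ge.

Definition meet_class (P Q : D -> Prop) X : Prop := P X /\ Q X.

Definition restricts_to (C le ge : D -> Prop) : Prop :=
  t_structure_on C (meet_class le C) (meet_class ge C).

Definition heart (le ge : D -> Prop) : D -> Prop := meet_class le ge.

(** ** Exceptional sequences and mutations *)

Definition total_fin_dim (V : int -> lmodType K) : Prop :=
  (forall l, fin_dim (V l)) /\
  exists N : nat, forall l : int, (N < absz l)%N -> is_trivial (V l).

Record exceptional n (E : 'I_n -> D) : Prop := Exceptional {
  exc_end : forall i, idm (E i) <> 0 /\
    forall f : hom (E i) (E i), exists c : K, f = c *: idm (E i);
  exc_self : forall i (l : int), l <> 0 -> is_trivial (Hombul (E i) (E i) l);
  exc_orth : forall i j : 'I_n, (i < j)%N ->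
    forall l, is_trivial (Hombul (E j) (E i) l);
  exc_fin : forall i j, total_fin_dim (Hombul (E i) (E j))
}.

(* [H] is [V (x) E], the direct sum over [l] of [V^l (x) E[-l]], for a graded
   vector space [V]. It is characterised by the adjunction
   [Hom(V (x) E, Y) = Hom_gr(V, Hom^bullet(E, Y))], with unit [i]. *)
Definition is_tensor (V : int -> lmodType K) E H
    (i : forall l, V l -> Hombul E H l) : Prop :=
  (forall l, linear (i l)) /\
  forall Y (phi : forall l, V l -> Hombul E Y l), (forall l, linear (phi l)) ->
    exists! u : hom H Y, forall l v, shift_map l u \oc i l v = phi l v.

(* [ev] is the evaluation [Hom^bullet(E, F) (x) E -> F]. *)
Definition is_left_mutation E F M : Prop :=
  exists H (i : forall l, Hombul E F l -> Hombul E H l)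
      (ev : hom H F) (g : hom F M) (h : hom M (sh1 D H)),
    [/\ is_tensor i, forall l f, shift_map l ev \oc i l f = f
      & triangle ev g h].

(* [F i] is the dual object [L_{E_0} ... L_{E_{i-1}} E_i]. *)
Definition left_dual n (E F : 'I_n -> D) : Prop :=
  forall i : 'I_n, exists M : nat -> D,
    [/\ M i = E i,
        forall j : 'I_n, (j < i)%N -> is_left_mutation (E j) (M j.+1) (M j)
      & M 0%N = F i].

(** ** The glued t-structure *)

(* [A] is the value at [X] of the left adjoint of the inclusion of [C]. *)
Definition reflection (C : D -> Prop) X A : Prop :=
  C A /\ exists eta : hom X A, forall B, C B ->
    forall f : hom X B, exists! g : hom A B, g \oc eta = f.

(* [A] is the value at [X] of the right adjoint of the inclusion of [C]. *)
Definition coreflection (C : D -> Prop) X A : Prop :=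
  C A /\ exists eps : hom A X, forall B, C B ->
    forall f : hom B X, exists! g : hom B A, eps \oc g = f.

(* An object of [D^b(K)] is represented by its graded cohomology. *)
Definition std_le0 (V : int -> lmodType K) : Prop :=
  forall l : int, (0 < l)%R -> is_trivial (V l).

Definition std_ge0 (V : int -> lmodType K) : Prop :=
  forall l : int, (l < 0)%R -> is_trivial (V l).

Section Glued.

Variables (n : nat) (E : 'I_n -> D).

(* [exc_span s] is the subcategory generated by the first [s] objects. *)
Definition exc_span (s : nat) : D -> Prop :=
  generated (fun X => exists2 i : 'I_n, (i < s)%N & X = E i).

(* The quotient functor [j^*] to [D^b(K)]: by the adjunction in [is_tensor],
   [Hom^bullet(E i, -)] is the right adjoint of [j_! = - (x) E i], the exact
   functor sending [K] to [E i]. *)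
Definition open_pullback (i : 'I_n) X : int -> lmodType K := Hombul (E i) X.

Fixpoint glued_le (s : nat) X : Prop :=
  match s with
  | 0 => zero_object X
  | s'.+1 => [/\ exc_span s'.+1 X,
      exists2 A, reflection (exc_span s') X A & glued_le s' A
    & forall i : 'I_n, i = s' :> nat -> std_le0 (open_pullback i X)]
  end.

Fixpoint glued_ge (s : nat) X : Prop :=
  match s with
  | 0 => zero_object X
  | s'.+1 => [/\ exc_span s'.+1 X,
      exists2 A, coreflection (exc_span s') X A & glued_ge s' A
    & forall i : 'I_n, i = s' :> nat -> std_ge0 (open_pullback i X)]
  end.

End Glued.

End Triangulated.

(* Main.v *)
(** Write [C_s] for the span of [E_1, ..., E_s]. Everything rests on the calculus
    of extension closures [P * Q] of classes of objects. Since
    [C_s = C_(s-1) * <F_s>], the shifts of [F_s] can be sorted by degree, and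
    [F_s] is an extension of an object of [C_(s-1)] by [E_s], induction on [s]
    decomposes [C_s] as [U * V[-1]], where [U] is the extension closure of the
    [E_i[k]], [k >= 0], and [V] that of the [F_i[-k]], [k >= 0]. If the [E_i] lie
    in [D^{<=0}] and the [F_i] in [D^{>=0}] then so do [U] and [V], whence
    [U = D^{<=0} /\ C] and [V = D^{>=0} /\ C]; the same decompositions identify
    [U] and [V] with the two halves of the glued t-structure.

    In the heart, [E_s] is projective relative to [C_s] and the objects of the
    heart of [C_s] killed by [Hom(E_s, -)] lie in [C_(s-1)]. So the image [L_s] of
    [E_s -> F_s] is simple, and objects have finite length by induction on
    [dim Hom(E_s, -)]. The projective cover of [L_i] is obtained from [E_i] by
    successive extensions by [E_s], [s = i + 1, ..., n], each with a nonzero class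
    in [Hom(P, E_s[1])], until this space vanishes: [Hom(P, E_j[l])] is then zero
    for all [l > 0], and nonzero classes never create a new simple quotient.
    Injective hulls follow by passing to the opposite category, which exchanges
    the two sequences. *)
From Stdlib Require Import Classical ClassicalEpsilon.
From mathcomp Require Import all_boot all_order all_algebra zify.
Require Import Defs.

Set Implicit Arguments.
Unset Strict Implicit.
Unset Printing Implicit Defensive.

Import Order.TTheory GRing.Theory Num.Theory.
Local Open Scope ring_scope.

(** Cones are not functorial, and a shift followed by its inverse is only isomorphic to the
    identity. So no truncation functor is built: the proof works with classes of objects closed
    under isomorphism, and an object is shown to vanish by factoring its identity through zero
    groups of morphisms. A triangle with its outer terms in the wrong order is handled in one of two
    ways: its connecting map is zero and the triangle splits, or that map is an isomorphism and the
    middle term vanishes. Once mutations are eliminated, only data symmetric under exchange of the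
    sequences in the opposite category remain: the vanishing of Hom(E_i, F_j[l]) and triangles E_i
    -> F_i -> W with W in C_(i-1). The same W governs the projective covers. If F_s lies in U, so
    does W; hence a P in C_(s-1) without positive Ext to E_1, ..., E_(s-1) has none to W, and Hom(P,
    E_s[l]) = 0 for l > 1. Only l = 1 remains to be killed. A nonzero class adds no quotient L_s: a
    map from the new object to L_s that is nonzero on E_s would split the extension. *)

Section LinearAlgebra.

(** * Finite-dimensional linear algebra *)

Variable K : fieldType.
Implicit Types U V W : lmodType K.

(** An upper bound on the dimension. It serves as an induction measure: the inductions only need a
    bound that drops when a nonzero vector is killed. *)
Definition spanned V n : Prop :=
  exists e : 'I_n -> V, forall v, exists c : 'I_n -> K, v = \sum_i c i *: e i.

Lemma linear_sum_scale V W (f : V -> W) (fL : linear f) n (c : 'I_n -> K) (e : 'I_n -> V) :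
  f (\sum_i c i *: e i) = \sum_i c i *: f (e i).
Proof.
have f0 : f 0 = 0.
  by have := fL (-1) 0 0; rewrite scaler0 addr0 scaleN1r addNr.
apply: (big_rec2 (fun x y => f x = y)) => // i y1 y2 _ <-.
exact: fL.
Qed.

Lemma linear_subZ V W (f : V -> W) (fL : linear f) (a : K) u v :
  f (u - a *: v) = f u - a *: f v.
Proof. by rewrite addrC -scaleNr fL addrC scaleNr. Qed.

(* One spanning vector with a nonzero coefficient is exchanged against [v]. *)
Lemma spanned_quotient V W (f : V -> W) n v : linear f ->
  (forall w, exists u, w = f u) -> spanned V n -> v <> 0 -> f v = 0 ->
  exists2 m, n = m.+1 & spanned W m.
Proof.
move=> fL fS [e eP] v0 fv0; case: (eP v) => c vE.
case: n => [|m] in e eP c vE *; first by case: v0; rewrite vE big_ord0.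
have [/existsP[k ck] | c0] := boolP [exists k, c k != 0]; last first.
  case: v0; rewrite vE big1 // => i _; move/existsPn/(_ i): c0.
  by rewrite negbK => /eqP ->; rewrite scale0r.
exists m => //; exists (fun j => f (e (lift k j))) => w.
case: (fS w) => u ->; case: (eP u) => d uE.
exists (fun j => d (lift k j) - d k / c k * c (lift k j)).
transitivity (f (u - (d k / c k) *: v)).
  by rewrite linear_subZ // fv0 scaler0 subr0.
rewrite {1}uE {1}vE linear_subZ // !(linear_sum_scale fL).
rewrite scaler_sumr -sumrB (bigD1_ord k) //= scalerA mulfVK // subrr add0r.
by apply: eq_bigr => j _; rewrite scalerA scalerBl.
Qed.

Lemma fin_dim_image V W (f : V -> W) : linear f ->
  (forall w, exists u, w = f u) -> fin_dim V -> fin_dim W.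
Proof.
move=> fL fS [n [e eP]]; exists n, (f \o e) => w.
case: (fS w) => u ->; case: (eP u) => c {1}->.
by exists c; rewrite (linear_sum_scale fL).
Qed.

(** Induction on [n]: the elements of [S] in the span of the last vectors are covered by the
    induction hypothesis, and one more element with nonzero first coordinate, if there is any,
    completes them. *)
Lemma fin_dim_subspace W (S : W -> Prop) n (e : 'I_n -> W) :
  (forall a u v, S u -> S v -> S (u - a *: v)) ->
  (forall w, S w -> exists c : 'I_n -> K, w = \sum_i c i *: e i) ->
  exists m (s : 'I_m -> W), (forall i, S (s i)) /\
    forall w, S w -> exists c : 'I_m -> K, w = \sum_i c i *: s i.
Proof.
elim: n S e => [|n IHn] S e SB Se.
  exists 0%N, (fun _ => 0); split=> [[] //|w /Se[c ->]].
  by exists (fun _ => 0); rewrite !big_ord0.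
pose T w := S w /\ exists c : 'I_n -> K, w = \sum_i c i *: e (lift ord0 i).
have [m [s [sT sP]]] : exists m (s : 'I_m -> W), (forall i, T (s i)) /\
    forall w, T w -> exists c : 'I_m -> K, w = \sum_i c i *: s i.
  apply: (IHn T (fun i => e (lift ord0 i))); last by move=> w [].
  move=> a u v [Su [c uE]] [Sv [d vE]]; split; first exact: SB.
  exists (fun i => c i - a * d i); rewrite uE vE scaler_sumr -sumrB.
  by apply: eq_bigr => i _; rewrite scalerBl scalerA.
have [[v [Sv [c [vE c0]]]] | none] := classic (exists v, S v /\
    exists c : 'I_n.+1 -> K, v = \sum_i c i *: e i /\ c ord0 != 0); last first.
  exists m, s; split=> [i|w Sw]; first by case: (sT i).
  apply: sP; split=> //; case: (Se w Sw) => c wE.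
  exists (fun i => c (lift ord0 i)); rewrite wE big_ord_recl.
  have [->|c0] := eqVneq (c ord0) 0; first by rewrite scale0r add0r.
  by case: none; exists w; split=> //; exists c.
exists m.+1, (fun i => if unlift ord0 i is Some j then s j else v).
split=> [i|w Sw]; first by case: unliftP => [j|] _ //; case: (sT j).
case: (Se w Sw) => d wE.
case: (sP (w - (d ord0 / c ord0) *: v)) => [|b bE].
  split; first exact: SB.
  exists (fun i => d (lift ord0 i) - d ord0 / c ord0 * c (lift ord0 i)).
  rewrite {1}wE {1}vE scaler_sumr -sumrB big_ord_recl scalerA mulfVK // subrr add0r.
  by apply: eq_bigr => j _; rewrite scalerA scalerBl.
exists (fun i => if unlift ord0 i is Some j then b j else d ord0 / c ord0).
rewrite big_ord_recl unlift_none (_ : w = (d ord0 / c ord0) *: v + (w - (d ord0 / c ord0) *: v)); last first.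
  by rewrite addrC subrK.
by congr (_ + _); rewrite bE; apply: eq_bigr => j _; rewrite liftK.
Qed.

Lemma fin_dim_exact U V W (f : U -> V) (g : V -> W) : linear f -> linear g ->
  (forall v, g v = 0 -> exists u, v = f u) ->
  fin_dim U -> fin_dim W -> fin_dim V.
Proof.
move=> fL gL ex [p [d dP]] [n [e eP]].
have [m [s [sS sP]]] := @fin_dim_subspace W (fun w => exists v, w = g v) n e
  (fun a u v '(ex_intro x xE) '(ex_intro y yE) =>
     ex_intro _ (x - a *: y) (etrans (congr2 (fun r t => r - a *: t) xE yE)
       (esym (linear_subZ gL a x y)))) (fun w _ => eP w).
have [t tE] : exists t : 'I_m -> V, forall i, s i = g (t i).
  exists (fun i => proj1_sig (constructive_indefinite_description _ (sS i))) => i.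
  by case: constructive_indefinite_description.
exists (p + m)%N, (fun i => match split i with inl a => f (d a) | inr b => t b end).
move=> v; case: (sP (g v)); first by exists v.
move=> b bE; case: (ex (v - \sum_i b i *: t i)).
  rewrite -[\sum_i _]scale1r (linear_subZ gL) (linear_sum_scale gL) scale1r bE.
  by apply/subr0_eq/eqP; rewrite subr0 subr_eq0; apply/eqP/eq_bigr => i _; rewrite tE.
move=> u uE; case: (dP u) => a aE.
exists (fun i => match split i with inl a' => a a' | inr b' => b b' end).
rewrite big_split_ord /= -[LHS](subrK (\sum_i b i *: t i)) uE aE (linear_sum_scale fL).
congr (_ + _); apply: eq_bigr => i _.
  by rewrite (unsplitK (inl i)).
by rewrite (unsplitK (inr i)).
Qed.

(** A linear relation allows a vector to be dropped, so induction on the length reaches a free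
    family. The coordinate forms [x] will be fed into the universal property of [is_tensor] to
    produce projections. *)
Lemma fin_dim_dual_basis V : fin_dim V ->
  exists n (e : 'I_n -> V) (x : 'I_n -> V -> K),
    [/\ forall i a u v, x i (a *: u + v) = a * x i u + x i v,
        forall i j, x i (e j) = (i == j)%:R
      & forall v, v = \sum_i x i v *: e i].
Proof.
case=> n; elim: n => [|n IHn] [e eP].
  exists 0%N, e, (fun _ _ => 0); split=> [[] //|[] //|v].
  by case: (eP v) => c ->; rewrite !big_ord0.
have [[c [c0 [k ck]]] | free] := classic (exists c : 'I_n.+1 -> K,
    0 = \sum_i c i *: e i /\ exists k, c k != 0).
  apply: IHn; exists (fun j => e (lift k j)) => v; case: (eP v) => d vE.
  exists (fun j => d (lift k j) - d k / c k * c (lift k j)).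
  transitivity (v - (d k / c k) *: \sum_i c i *: e i); first by rewrite -c0 scaler0 subr0.
  rewrite {1}vE scaler_sumr -sumrB.
  rewrite (bigD1_ord k) //= scalerA mulfVK // subrr add0r.
  by apply: eq_bigr => j _; rewrite scalerA scalerBl.
have uniq c d : \sum_i c i *: e i = \sum_i d i *: e i -> c =1 d.
  move=> cd i; apply/eqP; rewrite -subr_eq0; apply/negPn/negP => cdi.
  case: free; exists (fun i => c i - d i); split; last by exists i.
  by under eq_bigr do rewrite scalerBl; rewrite sumrB cd subrr.
pose y v := proj1_sig (constructive_indefinite_description _ (eP v)).
have yP v : v = \sum_i y v i *: e i.
  by rewrite /y; case: constructive_indefinite_description.
exists n.+1, e, (fun i v => y v i); split=> // [i a u v|i j].
  apply: (uniq (y _) (fun i => a * y u i + y v i)); rewrite -yP.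
  under eq_bigr do rewrite scalerDl -scalerA.
  by rewrite big_split /= -scaler_sumr -!yP.
apply: (uniq (y _) (fun i => (i == j)%:R)); rewrite -yP (bigD1 j) //= eqxx scale1r.
by rewrite big1 ?addr0 // => k /negPf ->; rewrite scale0r.
Qed.

End LinearAlgebra.

(** * Composition, isomorphisms and zero objects in a linear category *)

Section CategoryBasics.

Variables (K : fieldType) (A : klincat K).
Implicit Types X Y Z W : A.

Lemma comp0l X Y Z (f : hom X Y) : (0 : hom Y Z) \oc f = 0.
Proof.
have := comp_linearl (Z := Z) f (-1) 0 0.
by rewrite scaler0 addr0 scaleN1r addNr.
Qed.

Lemma comp0r X Y Z (g : hom Y Z) : g \oc (0 : hom X Y) = 0.
Proof.
have := comp_linearr (X := X) g (-1) 0 0.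
by rewrite scaler0 addr0 scaleN1r addNr.
Qed.

Lemma compZl X Y Z a (g : hom Y Z) (f : hom X Y) : (a *: g) \oc f = a *: (g \oc f).
Proof. by have := comp_linearl f a g 0; rewrite comp0l !addr0. Qed.

Lemma compZr X Y Z a (g : hom Y Z) (f : hom X Y) : g \oc (a *: f) = a *: (g \oc f).
Proof. by have := comp_linearr g a f 0; rewrite comp0r !addr0. Qed.

Lemma compDl X Y Z (g h : hom Y Z) (f : hom X Y) : (g + h) \oc f = (g \oc f) + (h \oc f).
Proof. by have := comp_linearl f 1 g h; rewrite !scale1r. Qed.

Lemma compDr X Y Z (g : hom Y Z) (f h : hom X Y) : g \oc (f + h) = (g \oc f) + (g \oc h).
Proof. by have := comp_linearr g 1 f h; rewrite !scale1r. Qed.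

Lemma compNl X Y Z (g : hom Y Z) (f : hom X Y) : (- g) \oc f = - (g \oc f).
Proof. by rewrite -scaleN1r compZl scaleN1r. Qed.

Lemma compNr X Y Z (g : hom Y Z) (f : hom X Y) : g \oc (- f) = - (g \oc f).
Proof. by rewrite -scaleN1r compZr scaleN1r. Qed.

Lemma compBl X Y Z (g h : hom Y Z) (f : hom X Y) : (g - h) \oc f = (g \oc f) - (h \oc f).
Proof. by rewrite compDl compNl. Qed.

Lemma compBr X Y Z (g : hom Y Z) (f h : hom X Y) : g \oc (f - h) = (g \oc f) - (g \oc h).
Proof. by rewrite compDr compNr. Qed.

Lemma comp_suml X Y Z (I : Type) (r : seq I) (P : pred I) (g : I -> hom Y Z) (f : hom X Y) :
  (\sum_(i <- r | P i) g i) \oc f = \sum_(i <- r | P i) (g i \oc f).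
Proof. by apply: (big_morph (fun g => g \oc f)) => [x y|]; [exact: compDl | exact: comp0l]. Qed.

Lemma comp_sumr X Y Z (I : Type) (r : seq I) (P : pred I) (g : hom Y Z) (f : I -> hom X Y) :
  g \oc (\sum_(i <- r | P i) f i) = \sum_(i <- r | P i) (g \oc f i).
Proof. by apply: (big_morph (fun f => g \oc f)) => [x y|]; [exact: compDr | exact: comp0r]. Qed.

Lemma is_iso_id X : is_iso (idm X).
Proof. by exists (idm X); rewrite comp1m. Qed.

Lemma is_iso_comp X Y Z (g : hom Y Z) (f : hom X Y) : is_iso g -> is_iso f -> is_iso (g \oc f).
Proof.
case=> g' [g'g gg'] [f' [f'f ff']]; exists (f' \oc g'); split.
  by rewrite -compA (compA g') g'g comp1m.
by rewrite -compA (compA f) ff' comp1m.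
Qed.

Lemma square_flip X Y X' Y' (a : hom X X') (a' : hom X' X) (b : hom Y Y') (b' : hom Y' Y)
    (f : hom X Y) (f' : hom X' Y') :
  a \oc a' = idm X' -> b' \oc b = idm Y -> b \oc f = f' \oc a -> b' \oc f' = f \oc a'.
Proof.
move=> aa' b'b e; rewrite -[in LHS](compm1 f') -aa' (compA f') -e -compA compA b'b.
by rewrite comp1m.
Qed.

Lemma isomorphic_refl X : isomorphic X X.
Proof. by exists (idm X); exact: is_iso_id. Qed.

Lemma isomorphic_sym X Y : isomorphic X Y -> isomorphic Y X.
Proof. by case=> f [g [gf fg]]; exists g, f. Qed.

Lemma isomorphic_trans X Y Z : isomorphic X Y -> isomorphic Y Z -> isomorphic X Z.
Proof. by case=> f fI [g gI]; exists (g \oc f); exact: is_iso_comp. Qed.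

Lemma zero_objectP X : zero_object X <-> idm X = 0.
Proof.
split=> [X0|e Y]; first by case: (X0 X) => H _; exact: H.
by split=> f; [rewrite -[f]compm1 e comp0r | rewrite -[f]comp1m e comp0l].
Qed.

Lemma zero_object_iso X Y : isomorphic X Y -> zero_object X -> zero_object Y.
Proof.
case=> f [g [_ fg]] /zero_objectP X0; apply/zero_objectP.
by rewrite -fg -[f]compm1 X0 comp0r comp0l.
Qed.

Lemma zero_objects_isomorphic X Y : zero_object X -> zero_object Y -> isomorphic X Y.
Proof.
move=> X0 Y0; exists 0, 0; split; first by case: (X0 X) => H _; rewrite [LHS]H [RHS]H.
by case: (Y0 Y) => H _; rewrite [LHS]H [RHS]H.
Qed.

Lemma is_trivial_isol X X' Y : isomorphic X X' -> is_trivial (hom X Y) -> is_trivial (hom X' Y).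
Proof. by case=> f [g [gf fg]] H t; rewrite -(compm1 t) -fg compA (H (t \oc f)) comp0l. Qed.

Lemma is_trivial_isor X Y Y' : isomorphic Y Y' -> is_trivial (hom X Y) -> is_trivial (hom X Y').
Proof. by case=> f [g [gf fg]] H t; rewrite -(comp1m t) -fg -compA (H (g \oc t)) comp0r. Qed.

End CategoryBasics.

(** * A self-dual fragment of the axioms of triangulated categories *)

(* [ex f g] says that [f] and [g] are the first two maps of a distinguished
   triangle. Forgetting the third map makes the axioms symmetric under
   [opposite], so that each statement below also yields its dual. *)
Record dtri (K : fieldType) := DTri {
  dcat :> klincat K;
  up : klinfun dcat dcat;
  dn : klinfun dcat dcat;
  ex : forall X Y Z : dcat, hom X Y -> hom Y Z -> Prop;
  dtri_zero : exists Z : dcat, zero_object Z;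
  up_inj : forall (X Y : dcat) (f : hom X Y), fmap up f = 0 -> f = 0;
  dn_inj : forall (X Y : dcat) (f : hom X Y), fmap dn f = 0 -> f = 0;
  up_full : forall (X Y : dcat) (g : hom (up X) (up Y)), exists f, g = fmap up f;
  dn_full : forall (X Y : dcat) (g : hom (dn X) (dn Y)), exists f, g = fmap dn f;
  updn : forall X : dcat, isomorphic (up (dn X)) X;
  dnup : forall X : dcat, isomorphic (dn (up X)) X;
  ex_zero : forall (X Y Z : dcat) (f : hom X Y) (g : hom Y Z), ex f g -> g \oc f = 0;
  ex_liftl : forall (X Y Z T : dcat) (f : hom X Y) (g : hom Y Z) (t : hom T Y),
    ex f g -> g \oc t = 0 -> exists u, f \oc u = t;
  ex_liftr : forall (X Y Z T : dcat) (f : hom X Y) (g : hom Y Z) (t : hom Y T),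
    ex f g -> t \oc f = 0 -> exists u, u \oc g = t;
  ex_rot : forall (X Y Z : dcat) (f : hom X Y) (g : hom Y Z), ex f g ->
    exists h, ex g h /\ ex h (fmap up f);
  ex_rot' : forall (X Y Z : dcat) (f : hom X Y) (g : hom Y Z), ex f g ->
    exists h, ex h f /\ ex (fmap dn g) h;
  ex_cone : forall (X Y : dcat) (f : hom X Y), exists Z (g : hom Y Z), ex f g;
  ex_cocone : forall (Y Z : dcat) (g : hom Y Z), exists X (f : hom X Y), ex f g;
  ex_iso : forall (X Y Z X' Y' Z' : dcat) (f : hom X Y) (g : hom Y Z)
    (f' : hom X' Y') (g' : hom Y' Z') (a : hom X X') (b : hom Y Y') (c : hom Z Z'),
    is_iso a -> is_iso b -> is_iso c -> b \oc f = f' \oc a -> c \oc g = g' \oc b ->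
    ex f g -> ex f' g';
  ex_id0 : forall X Z : dcat, zero_object Z -> ex (idm X) (0 : hom X Z);
  ex_0id : forall X Z : dcat, zero_object Z -> ex (0 : hom Z X) (idm X);
  ex_octa : forall (X Y Z Q1 Q2 Q3 : dcat) (f : hom X Y) (g : hom Y Z)
    (p1 : hom Y Q1) (p2 : hom Z Q2) (p3 : hom Z Q3),
    ex f p1 -> ex (g \oc f) p2 -> ex g p3 ->
    exists u v, [/\ ex u v, u \oc p1 = p2 \oc g & v \oc p2 = p3];
  ex_octa' : forall (X Y Z N1 N2 N3 : dcat) (f : hom X Y) (g : hom Y Z)
    (k1 : hom N1 X) (k2 : hom N2 X) (k3 : hom N3 Y),
    ex k1 f -> ex k2 (g \oc f) -> ex k3 g ->
    exists u v, [/\ ex u v, k2 \oc u = k1 & k3 \oc v = f \oc k2]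
}.

(** * The opposite category *)

Section Opposite.

Variable K : fieldType.

Definition op_cat (A : klincat K) : klincat K :=
  {| kobj := A;
     hom := fun X Y => @hom K A Y X;
     idm := fun X => @idm K A X;
     comp := fun X Y Z (g : @hom K A Z Y) (f : @hom K A Y X) => f \oc g;
     compA := fun X Y Z W h g f => esym (compA f g h);
     comp1m := fun X Y f => compm1 f;
     compm1 := fun X Y f => comp1m f;
     comp_linearl := fun X Y Z f => comp_linearr (X := Z) f;
     comp_linearr := fun X Y Z g => comp_linearl (Z := X) g |}.

Definition op_fun (A : klincat K) (F : klinfun A A) : klinfun (op_cat A) (op_cat A) :=
  @KLinFun K (op_cat A) (op_cat A) F (fun X Y f => fmap F f)
    (fun X Y => @fmap_linear K A A F Y X) (fun X => fmap_id F X)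
    (fun X Y Z g f => fmap_comp F f g).

Lemma isomorphic_op (A : klincat K) (X Y : A) :
  @isomorphic K (op_cat A) X Y <-> isomorphic X Y.
Proof.
by split; case=> f [g [gf fg]]; exists g, f.
Qed.

Lemma zero_object_op (A : klincat K) (X : A) :
  @zero_object K (op_cat A) X <-> zero_object X.
Proof. by split=> X0 Y; case: (X0 Y). Qed.

Lemma is_iso_op (A : klincat K) (X Y : A) (f : hom X Y) :
  @is_iso K (op_cat A) Y X f <-> is_iso f.
Proof. by split; case=> g [gf fg]; exists g. Qed.

(** Kept transparent: later dualisations rely on conversion, for instance on [up] of the opposite
    being [dn]. *)
Definition opposite (T : dtri K) : dtri K.
Proof.
refine (@DTri K (op_cat T) (op_fun (dn T)) (op_fun (up T))
  (fun X Y Z f g => @ex K T Z Y X g f) _ _ _ _ _ _ _ _ _ _ _ _ _ _ _ _ _ _ _).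
- by case: (dtri_zero T) => Z /zero_object_op ?; exists Z.
- by move=> X Y f; exact: dn_inj.
- by move=> X Y f; exact: up_inj.
- by move=> X Y g; exact: dn_full.
- by move=> X Y g; exact: up_full.
- by move=> X; apply/isomorphic_op; exact: dnup.
- by move=> X; apply/isomorphic_op; exact: updn.
- by move=> X Y Z f g; exact: ex_zero.
- by move=> X Y Z W f g t; exact: ex_liftr.
- by move=> X Y Z W f g t; exact: ex_liftl.
- by move=> X Y Z f g; exact: ex_rot'.
- by move=> X Y Z f g; exact: ex_rot.
- by move=> X Y f; case: (ex_cocone (f : @hom K T Y X)) => Z [g]; exists Z, g.
- by move=> X Y f; case: (ex_cone (f : @hom K T Y X)) => Z [g]; exists Z, g.
- move=> X Y Z X' Y' Z' f g f' g' a b c [a' [a1 a2]] [b' [b1 b2]] [c' [c1 c2]] e1 e2.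
  rewrite /= in e1 e2 a1 a2 b1 b2 c1 c2 *.
  apply: (@ex_iso K T _ _ _ _ _ _ _ _ _ _ c' b' a').
  + by exists c.
  + by exists b.
  + by exists a.
  + exact: (square_flip c1 b2 (esym e2)).
  + exact: (square_flip b1 a2 (esym e1)).
- by move=> X Z /zero_object_op; exact: ex_0id.
- by move=> X Z /zero_object_op; exact: ex_id0.
- move=> X Y Z Q1 Q2 Q3 f g p1 p2 p3 e1 e2 e3.
  by case: (ex_octa' e3 e2 e1) => u [v [? ? ?]]; exists v, u.
- move=> X Y Z Q1 Q2 Q3 f g p1 p2 p3 e1 e2 e3.
  by case: (ex_octa e3 e2 e1) => u [v [? ? ?]]; exists v, u.
Defined.

End Opposite.

(** * Linear functors and equivalences *)

Section Functors.

Variables (K : fieldType) (A B : klincat K) (F : klinfun A B).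

Lemma fmapZ X Y a (f : hom X Y) : fmap F (a *: f) = a *: fmap F f.
Proof.
have F0 : fmap F (0 : hom X Y) = 0.
  by have := @fmap_linear _ _ _ F X Y (-1) 0 0; rewrite scaler0 addr0 scaleN1r addNr.
by have := @fmap_linear _ _ _ F X Y a f 0; rewrite F0 !addr0.
Qed.

Lemma fmap0 X Y : fmap F (0 : hom X Y) = 0.
Proof. by rewrite -(scale0r 0) fmapZ scale0r. Qed.

Lemma fmapN X Y (f : hom X Y) : fmap F (- f) = - fmap F f.
Proof. by rewrite -scaleN1r fmapZ scaleN1r. Qed.

Lemma fmapD X Y (f g : hom X Y) : fmap F (f + g) = fmap F f + fmap F g.
Proof. by have := @fmap_linear _ _ _ F X Y 1 f g; rewrite !scale1r. Qed.

Lemma fmap_iso X Y (f : hom X Y) : is_iso f -> is_iso (fmap F f).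
Proof. by case=> g [gf fg]; exists (fmap F g); rewrite -!fmap_comp gf fg !fmap_id. Qed.

Lemma fmap_isomorphic X Y : isomorphic X Y -> isomorphic (F X) (F Y).
Proof. by case=> f fI; exists (fmap F f); exact: fmap_iso. Qed.

End Functors.

Section Equivalences.

Variables (K : fieldType) (A B : klincat K) (F : klinfun A B) (G : klinfun B A).

Lemma id_iso_faithful : id_iso_comp F G ->
  forall X Y (f : hom X Y), fmap F f = 0 -> f = 0.
Proof.
case=> eta [etaI etaN] X Y f f0; case: (etaI Y) => e [e1 _].
by rewrite -(comp1m f) -e1 -compA etaN f0 fmap0 comp0l comp0r.
Qed.

Lemma id_iso_full : id_iso_comp F G ->
  (forall X Y (f : hom X Y), fmap G f = 0 -> f = 0) ->
  forall X Y (g : hom (F X) (F Y)), exists f, g = fmap F f.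
Proof.
case=> eta [etaI etaN] Ginj X Y g.
case: (etaI X) => e [e1 e2]; case: (etaI Y) => e' [e1' e2'].
exists (e' \oc fmap G g \oc eta X); apply/subr0_eq/Ginj.
rewrite fmapD fmapN; apply/eqP; rewrite subr_eq0; apply/eqP.
rewrite -[RHS]compm1 -e2 (compA _ (eta X)) -etaN !compA e2' comp1m.
by rewrite -compA e2 compm1.
Qed.

End Equivalences.

(** * From triangulated categories to the self-dual fragment *)

Section Triangles.

Variables (K : fieldType) (D : tricat K).
Implicit Types X Y Z T : D.

Lemma exists_zero_object : exists Z : D, zero_object Z.
Proof.
case: (@tcat_additive _ D 0 (fun i => match i with Ordinal _ h => match notF h with end end)).
move=> H [i [p [_ _ h]]]; exists H; apply/zero_objectP.
by rewrite -h big_ord0.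
Qed.

Lemma sh1_inj X Y (f : hom X Y) : fmap (sh1 D) f = 0 -> f = 0.
Proof. exact: (id_iso_faithful (sh1K D)). Qed.

Lemma shm1_inj X Y (f : hom X Y) : fmap (shm1 D) f = 0 -> f = 0.
Proof. exact: (id_iso_faithful (shm1K D)). Qed.

Lemma sh1_full X Y (g : hom (sh1 D X) (sh1 D Y)) : exists f, g = fmap (sh1 D) f.
Proof. exact: (id_iso_full (sh1K D) shm1_inj). Qed.

Lemma shm1_full X Y (g : hom (shm1 D X) (shm1 D Y)) : exists f, g = fmap (shm1 D) f.
Proof. exact: (id_iso_full (shm1K D) sh1_inj). Qed.

Lemma sh1_injB X Y (f g : hom X Y) : fmap (sh1 D) f = fmap (sh1 D) g -> f = g.
Proof. by move=> e; apply/subr0_eq/sh1_inj; rewrite fmapD fmapN e subrr. Qed.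

Lemma sh1_iso X Y (f : hom X Y) : is_iso (fmap (sh1 D) f) -> is_iso f.
Proof.
case=> g; case: (sh1_full g) => h -> [e1 e2]; exists h.
by split; apply: sh1_injB; rewrite fmap_comp fmap_id.
Qed.

Lemma is_isoN X Y (f : hom X Y) : is_iso f -> is_iso (- f).
Proof.
by case=> g [gf fg]; exists (- g); rewrite !compNl !compNr !opprK.
Qed.

Lemma triangle_comp0 X Y Z (f : hom X Y) (g : hom Y Z) h : triangle f g h -> g \oc f = 0.
Proof.
move=> t; case: exists_zero_object => O O0.
have [c [cE _]] := triangle_fill (a := idm X) (b := f) (triangle_id X O0) t erefl.
by rewrite -cE comp0r.
Qed.

Lemma triangle_liftl X Y Z T (f : hom X Y) (g : hom Y Z) h (t : hom T Y) :
  triangle f g h -> g \oc t = 0 -> exists u, f \oc u = t.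
Proof.
move=> t1 gt; case: exists_zero_object => O O0.
have t2 := proj1 (triangle_rot _ _ _) (triangle_id T O0).
have [|c [_ cE]] := triangle_fill (a := t) (b := 0) t2 (proj1 (triangle_rot _ _ _) t1).
  by rewrite comp0l gt.
case: (sh1_full c) cE => u -> cE; exists u; apply: sh1_injB; move: cE.
by rewrite fmap_id compNr compm1 compNl fmap_comp => /oppr_inj ->.
Qed.

Lemma triangle_liftr X Y Z T (f : hom X Y) (g : hom Y Z) h (t : hom Y T) :
  triangle f g h -> t \oc f = 0 -> exists u, u \oc g = t.
Proof.
move=> t1 tf; case: exists_zero_object => O O0.
have t2 : triangle (0 : hom O T) (idm T) (0 : hom T (sh1 D O)).
  apply/triangle_rot; rewrite fmap0 oppr0; apply: triangle_id.
  by apply/zero_objectP; rewrite -fmap_id (proj1 (zero_objectP O) O0) fmap0.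
have [|c [cE _]] := triangle_fill (a := 0) (b := t) t1 t2.
  by rewrite comp0l tf.
by exists c; rewrite cE comp1m.
Qed.

Lemma triangle_cones_iso X Y Z Z' (f : hom X Y) (g : hom Y Z) h (g' : hom Y Z') h' :
  triangle f g h -> triangle f g' h' ->
  exists2 c : hom Z Z', is_iso c & c \oc g = g'.
Proof.
move=> t t'; case: exists_zero_object => O O0.
(* In the octahedron on [idm Y \oc f] the third cone is that of an identity, hence zero, so the
   comparison map [u] of the two cones has zero cone. *)
have t1 : triangle (idm Y \oc f) g' h' by rewrite comp1m.
have [u [v [tuv [ug _ _ _]]]] := triangle_octa t t1 (triangle_id Y O0).
exists u; last by rewrite ug compm1.
have [w uw] : exists w, u \oc w = idm Z'.
  apply: (triangle_liftl tuv); rewrite compm1.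
  by case: (O0 Z') => _; exact.
exists w; split=> //.
have [x xu] : exists x, x \oc - fmap (sh1 D) u = idm (sh1 D Z).
  apply: (triangle_liftr (proj1 (triangle_rot _ _ _) (proj1 (triangle_rot _ _ _) tuv))).
  by rewrite comp1m; case: (O0 (sh1 D Z)) => H _; exact: H.
have [y xE] := sh1_full x; move: xu; rewrite xE compNr -compNl -fmapN -fmap_comp -fmap_id => /sh1_injB yu.
by rewrite -[LHS]comp1m -yu -compA (compA u) uw comp1m.
Qed.

Definition exact_pair X Y Z (f : hom X Y) (g : hom Y Z) : Prop :=
  exists h, triangle f g h.

Lemma exact_pair_iso (X Y Z X' Y' Z' : D) (f : hom X Y) (g : hom Y Z)
    (f' : hom X' Y') (g' : hom Y' Z') (a : hom X X') (b : hom Y Y') (c : hom Z Z') :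
  is_iso a -> is_iso b -> is_iso c -> b \oc f = f' \oc a -> c \oc g = g' \oc b ->
  exact_pair f g -> exact_pair f' g'.
Proof.
move=> aI bI cI e1 e2 [h t]; case: (cI) => c' [c1 c2].
exists (fmap (sh1 D) a \oc h \oc c').
apply: (triangle_iso aI bI cI e1 e2 _ t).
by rewrite -!compA c1 compm1.
Qed.

(** The signs created by rotation are absorbed by the automorphism -1. *)
Lemma exact_pairNr X Y Z (f : hom X Y) (g : hom Y Z) : exact_pair f (- g) -> exact_pair f g.
Proof.
apply: exact_pair_iso (is_iso_id X) (is_iso_id Y) (is_isoN (is_iso_id Z)) _ _.
  by rewrite comp1m compm1.
by rewrite compNl compNr opprK comp1m compm1.
Qed.

Lemma exact_pair_rot X Y Z (f : hom X Y) (g : hom Y Z) : exact_pair f g ->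
  exists h, exact_pair g h /\ exact_pair h (fmap (sh1 D) f).
Proof.
case=> h /triangle_rot t; exists h; split; first by exists (- fmap (sh1 D) f).
by apply: exact_pairNr; exists (- fmap (sh1 D) g); exact: (proj1 (triangle_rot _ _ _) t).
Qed.

Lemma exact_pair_rot' X Y Z (f : hom X Y) (g : hom Y Z) : exact_pair f g ->
  exists h, exact_pair h f /\ exact_pair (fmap (shm1 D) g) h.
Proof.
case=> h t; case: (shm1K D) => eps [epsI epsN].
case: (epsI Z) => e [e1 e2]; case: (epsI Y) => d [d1 d2].
(* The source of [h] is replaced by the isomorphic [sh1 (shm1 Z)], so that the third map becomes a
   shifted one and the rotation axiom can be read backwards. *)
have [k kE] := sh1_full (h \oc e).
have t1 : triangle f (eps Z \oc g) (h \oc e).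
  apply: triangle_iso (is_iso_id X) (is_iso_id Y) (epsI Z) _ _ _ t.
  - by rewrite comp1m compm1.
  - by rewrite compm1.
  - by rewrite fmap_id comp1m -compA e1 compm1.
have t2 : triangle (- k) f (eps Z \oc g).
  by apply: (proj2 (triangle_rot _ _ _)); rewrite fmapN opprK -kE.
exists (- k); split; first by exists (eps Z \oc g).
exists (- (eps Y \oc f)); apply: (proj2 (triangle_rot _ _ _)).
apply: triangle_iso (is_iso_id _) (is_iso_id X) (is_isoN (epsI Y)) _ _ _ t2.
- by rewrite comp1m compm1.
- by rewrite compNl compm1.
- by rewrite fmap_id comp1m compNl compNr opprK epsN.
Qed.

(** The shifted cone of [f] and the given pair are two cones of [fmap (sh1 D) f]; the isomorphism
    between them desuspends by fullness. *)
Lemma exact_pair_sh1 X Y Z (f : hom X Y) (g : hom Y Z) :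
  exact_pair (fmap (sh1 D) f) (fmap (sh1 D) g) -> exact_pair f g.
Proof.
case=> h t; case: (triangle_cone f) => Q [q [d tq]].
have t1 : triangle (fmap (sh1 D) f) (fmap (sh1 D) q) (- fmap (sh1 D) d).
  have t2 : triangle (- fmap (sh1 D) f) (- fmap (sh1 D) q) (- fmap (sh1 D) d).
    (* Three rotations shift the triangle and negate all three maps. *)
    by do 3 apply: (proj1 (triangle_rot _ _ _)).
  apply: triangle_iso (is_iso_id _) (is_isoN (is_iso_id _)) (is_iso_id _) _ _ _ t2.
  - by rewrite compNl compNr opprK comp1m compm1.
  - by rewrite compNr comp1m compNr compm1.
  - by rewrite fmap_id comp1m compm1.
have [c cI cE] := triangle_cones_iso t1 t.
have [b bE] := sh1_full c; rewrite bE in cI cE.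
apply: (exact_pair_iso (is_iso_id X) (is_iso_id Y) (sh1_iso cI)).
- by rewrite comp1m compm1.
- by rewrite compm1; apply: sh1_injB; rewrite fmap_comp; exact: cE.
- by exists d.
Qed.

(** The octahedral axiom for fibres: rotation turns the three fibres into shifted cones, and the
    triangle obtained from them is then desuspended. *)
Lemma exact_pair_octa' (X Y Z N1 N2 N3 : D) (f : hom X Y) (g : hom Y Z)
    (k1 : hom N1 X) (k2 : hom N2 X) (k3 : hom N3 Y) :
  exact_pair k1 f -> exact_pair k2 (g \oc f) -> exact_pair k3 g ->
  exists u v, [/\ exact_pair u v, k2 \oc u = k1 & k3 \oc v = f \oc k2].
Proof.
move=> [d1 /triangle_rot t1] [d2 /triangle_rot t2] [d3 /triangle_rot t3].
have [u [v [tuv [_ e2 _ e4]]]] := triangle_octa t1 t2 t3.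
have [u' uE] := sh1_full u; have [v' vE] := sh1_full v; rewrite uE vE in tuv e2 e4.
exists u', v'; split.
- by apply: exact_pair_sh1; eexists; exact: tuv.
- by apply: sh1_injB; move: e2; rewrite compNl fmap_comp => /oppr_inj.
- by apply: sh1_injB; move: e4; rewrite compNl compNr !fmap_comp => /oppr_inj.
Qed.

Definition dtri_of : dtri K.
Proof.
refine (@DTri K D (sh1 D) (shm1 D) exact_pair exists_zero_object sh1_inj shm1_inj
  sh1_full shm1_full _ _ _ _ _ exact_pair_rot exact_pair_rot' _ _ exact_pair_iso
  _ _ _ exact_pair_octa').
- move=> X; case: (shm1K D) => eps [epsI _].
  by apply: isomorphic_sym; exists (eps X).
- move=> X; case: (sh1K D) => eta [etaI _].
  by apply: isomorphic_sym; exists (eta X).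
- by move=> X Y Z f g [h]; exact: triangle_comp0.
- by move=> X Y Z T f g t [h]; exact: triangle_liftl.
- by move=> X Y Z T f g t [h]; exact: triangle_liftr.
- by move=> X Y f; case: (triangle_cone f) => Z [g [h t]]; exists Z, g, h.
- move=> Y Z g; case: (triangle_cone g) => W [p [h t]].
  have [q [qg _]] := exact_pair_rot' (ex_intro _ h t : exact_pair g p).
  by exists (shm1 D W), q.
- by move=> X Z Z0; exists 0; exact: triangle_id.
- move=> X Z Z0.
  have [h [h1 h2]] := exact_pair_rot' (ex_intro _ 0 (triangle_id X Z0) : exact_pair (idm X) (0 : hom X Z)).
  have SZ0 : zero_object (shm1 D Z).
    by apply/zero_objectP; rewrite -fmap_id (proj1 (zero_objectP Z) Z0) fmap0.
  apply: (exact_pair_iso (a := 0) _ (is_iso_id X) (is_iso_id X) _ _ h1).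
  + case: (zero_objects_isomorphic SZ0 Z0) => i iI.
    by case: (SZ0 Z) => H _; rewrite -(H i).
  + by case: (SZ0 X) => H _; rewrite [LHS]H comp0r.
  + by [].
- move=> X Y Z Q1 Q2 Q3 f g p1 p2 p3 [d1 t1] [d2 t2] [d3 t3].
  have [u [v [tuv [e1 e2 e3 e4]]]] := triangle_octa t1 t2 t3.
  by exists u, v; split=> //; eexists; exact: tuv.
Defined.

End Triangles.

(** * Extension closures *)

Lemma ex_repl (K : fieldType) (T : dtri K) (X Y Z Y' : T) : isomorphic Y Y' ->
  forall (f : hom X Y) (g : hom Y Z), ex f g -> exists (f' : hom X Y') (g' : hom Y' Z), ex f' g'.
Proof.
case=> b [b' [e1 e2]] f g fg; exists (b \oc f), (g \oc b').
apply: (ex_iso (a := idm X) (b := b) (c := idm Z) _ _ _ _ _ fg); try exact: is_iso_id.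
- by exists b'.
- by rewrite compm1.
- by rewrite comp1m -compA e1 compm1.
Qed.

Lemma zero_object_hom (K : fieldType) (A : klincat K) (X Y : A) (f : hom X Y) :
  zero_object X \/ zero_object Y -> f = 0.
Proof. by case=> [/(_ Y)[H _] | /(_ X)[_ H]]; exact: H. Qed.

Lemma zero_object_fmap (K : fieldType) (A B : klincat K) (F : klinfun A B) (X : A) :
  zero_object X -> zero_object (F X).
Proof. by move=> /zero_objectP X0; apply/zero_objectP; rewrite -fmap_id X0 fmap0. Qed.

Lemma ex_zerol (K : fieldType) (T : dtri K) (X Y Z : T) (f : hom X Y) (g : hom Y Z) :
  ex f g -> zero_object X -> is_iso g.
Proof.
move=> fg X0; have [u uE] : exists u, u \oc g = idm Y.
  by apply: (ex_liftr fg); rewrite (zero_object_hom f) ?comp0r //; left.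
exists u; split=> //.
have [h [gh _]] := ex_rot fg.
have [v vE] : exists v, g \oc v = idm Z.
  apply: (ex_liftl gh); rewrite compm1; apply: zero_object_hom; right.
  exact: zero_object_fmap.
by rewrite -[u]compm1 -vE (compA u) uE comp1m vE.
Qed.

Lemma ex_zeror (K : fieldType) (T : dtri K) (X Y Z : T) (f : hom X Y) (g : hom Y Z) :
  ex f g -> zero_object Z -> is_iso f.
Proof.
move=> fg /zero_object_op Z0; apply/is_iso_op.
exact: (@ex_zerol K (opposite T) Z Y X g f).
Qed.

Lemma ex_up (K : fieldType) (T : dtri K) (X Y Z : T) (f : hom X Y) (g : hom Y Z) : ex f g ->
  exists g' : hom (up T Y) (up T Z), ex (fmap (up T) f) g'.
Proof. by move=> /ex_rot[h [_ /ex_rot[g' []]]]; exists g'. Qed.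

Lemma ex_dn (K : fieldType) (T : dtri K) (X Y Z : T) (f : hom X Y) (g : hom Y Z) : ex f g ->
  exists f' : hom (dn T X) (dn T Y), ex f' (fmap (dn T) g).
Proof. by move=> /ex_rot'[h [_ /ex_rot'[g' []]]]; exists g'. Qed.

Lemma trivial_up (K : fieldType) (T : dtri K) (X Y : T) :
  is_trivial (hom (up T X) (up T Y)) <-> is_trivial (hom X Y).
Proof.
split=> H f; first by apply: up_inj; exact: H.
by case: (up_full f) => g ->; rewrite (H g) fmap0.
Qed.

Lemma trivial_dn (K : fieldType) (T : dtri K) (X Y : T) :
  is_trivial (hom (dn T X) (dn T Y)) <-> is_trivial (hom X Y).
Proof.
split=> H f; first by apply: dn_inj; exact: H.
by case: (dn_full f) => g ->; rewrite (H g) fmap0.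
Qed.

Section StarCalculus.

Variables (K : fieldType) (T : dtri K).
Implicit Types (X Y Z W : T) (P Q R : T -> Prop).

Lemma trivial_exr W X Y Z (f : hom X Y) (g : hom Y Z) : ex f g ->
  is_trivial (hom W X) -> is_trivial (hom W Z) -> is_trivial (hom W Y).
Proof.
move=> fg HX HZ t; case: (ex_liftl (t := t) fg); first exact: HZ.
by move=> u <-; rewrite (HX u) comp0r.
Qed.

Lemma trivial_exl W X Y Z (f : hom X Y) (g : hom Y Z) : ex f g ->
  is_trivial (hom X W) -> is_trivial (hom Z W) -> is_trivial (hom Y W).
Proof.
move=> fg HX HZ t; case: (ex_liftr (t := t) fg); first exact: HX.
by move=> u <-; rewrite (HZ u) comp0l.
Qed.

Definition star P Q X : Prop :=
  exists A B (f : hom A X) (g : hom X B), [/\ P A, Q B & ex f g].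

Definition iso_closed P : Prop := forall X Y, isomorphic X Y -> P X -> P Y.

Definition ext_closed P : Prop :=
  (forall X, zero_object X -> P X) /\
  forall X Y Z (f : hom X Y) (g : hom Y Z), ex f g -> P X -> P Z -> P Y.

Lemma ext_closed_iso P : ext_closed P -> iso_closed P.
Proof.
case=> P0 Pex X Y [f fI] PX; case: (dtri_zero T) => O O0.
apply: (Pex X Y O f 0) => //; last exact: P0.
apply: (ex_iso (a := idm X) (b := f) (c := idm O) _ _ _ _ _ (ex_id0 X O0)) => //; try exact: is_iso_id.
by rewrite comp0l comp0r.
Qed.

Lemma star_sub P Q P' Q' X : (forall Y, P Y -> P' Y) -> (forall Y, Q Y -> Q' Y) ->
  star P Q X -> star P' Q' X.
Proof.
by move=> PP' QQ' [A [B [f [g [PA QB fg]]]]]; exists A, B, f, g; split; auto.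
Qed.

(** The star operation is associative, with one inclusion from each form of the octahedral axiom. *)
Lemma starAr P Q R X : star (star P Q) R X -> star P (star Q R) X.
Proof.
case=> M [C [f [g [[A [B [a [b [PA QB ab]]]]] RC fg]]]].
have [N [p ap]] := ex_cone (f \oc a).
have [u [v [uv _ _]]] := ex_octa ab ap fg.
by exists A, N, (f \oc a), p; split=> //; exists B, C, u, v.
Qed.

Lemma starAl P Q R X : star P (star Q R) X -> star (star P Q) R X.
Proof.
case=> A [N [f [g [PA [B [C [b [c [QB RC bc]]]]] fg]]]].
have [M [p pc]] := ex_cocone (c \oc g).
have [u [v [uv _ _]]] := ex_octa' fg pc bc.
by exists M, C, p, (c \oc g); split=> //; exists A, B, u, v.
Qed.

Lemma star_inl P Q X : ext_closed Q -> P X -> star P Q X.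
Proof.
case=> Q0 _ PX; case: (dtri_zero T) => O O0.
by exists X, O, (idm X), 0; split; [|exact: Q0|exact: ex_id0].
Qed.

Lemma star_inr P Q X : ext_closed P -> Q X -> star P Q X.
Proof.
case=> P0 _ QX; case: (dtri_zero T) => O O0.
by exists O, X, 0, (idm X); split; [exact: P0| |exact: ex_0id].
Qed.

Lemma star_ext P X : ext_closed P -> star P P X -> P X.
Proof. by case=> _ Pex [A [B [f [g [PA PB fg]]]]]; exact: Pex fg PA PB. Qed.

(** Factors are attached one at a time at the quotient end, which gives an induction on the number
    of factors; closure under arbitrary extensions is then a theorem. *)
Inductive ecl P : T -> Prop :=
| ecl_zero X : zero_object X -> ecl P X
| ecl_ex N M Z (f : hom N M) (g : hom M Z) : ex f g -> ecl P N -> P Z -> ecl P M.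

Lemma ecl_min P Q : ext_closed Q -> (forall X, P X -> Q X) -> forall X, ecl P X -> Q X.
Proof.
move=> [Q0 Qex] PQ X; elim=> [|N M Z f g fg _ QN PZ]; first exact: Q0.
by apply: Qex fg QN _; exact: PQ.
Qed.

Lemma ecl_iso P : iso_closed (ecl P).
Proof.
move=> X Y XY EX; case: EX XY => [{}X X0 | N {}X C a b ab EN PC] XY.
  by apply: ecl_zero; apply: zero_object_iso X0.
by have [a' [b' ab']] := ex_repl XY ab; apply: ecl_ex ab' EN PC.
Qed.

Lemma ecl_ext_closed P : ext_closed (ecl P).
Proof.
split=> [|X Y Z f g fg EX EZ]; first exact: ecl_zero.
elim: EZ Y f g fg => [{}Z Z0 | N M C a b ab EN IH PC] Y f g fg.
  by apply: ecl_iso EX; exists f; exact: ex_zeror fg Z0.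
have [W [p pc]] := ex_cocone (b \oc g).
have [u [v [uv _ _]]] := ex_octa' fg pc ab.
exact: (ecl_ex pc (IH _ _ _ uv) PC).
Qed.

Lemma ecl_incl P X : P X -> ecl P X.
Proof.
move=> PX; case: (dtri_zero T) => O O0.
by apply: (ecl_ex (ex_0id X O0)) => //; exact: ecl_zero.
Qed.

Lemma ecl_sub P Q X : (forall Y, P Y -> Q Y) -> ecl P X -> ecl Q X.
Proof. move=> PQ; apply: ecl_min (ecl_ext_closed Q) _ _ => Y /PQ; exact: ecl_incl. Qed.

Lemma ecl_orth P Q : (forall X Y, P X -> Q Y -> is_trivial (hom X Y)) ->
  forall X Y, ecl P X -> ecl Q Y -> is_trivial (hom X Y).
Proof.
move=> H X Y EX EY; move: Y EY; apply: ecl_min => [|Y QY].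
  split=> [Y Y0 t|A B C f g fg]; first by apply: zero_object_hom; right.
  exact: trivial_exr fg.
move: X EX; apply: ecl_min => [|X PX]; last exact: H.
split=> [X X0 t|A B C f g fg]; first by apply: zero_object_hom; left.
exact: trivial_exl fg.
Qed.

(** A bubble sort: exchanging two adjacent generators suffices. [step1] moves one factor from [Q]
    past all those from [P], and an induction moves the others. The alternative [zero_object Y]
    covers two generators that cancel. *)
Lemma star_swap P Q :
  (forall A B Y (f : hom A Y) (g : hom Y B), P A -> Q B -> ex f g ->
     zero_object Y \/ star Q P Y) ->
  forall X, star (ecl P) (ecl Q) X -> star (ecl Q) (ecl P) X.
Proof.
move=> sw; have eP := ecl_ext_closed P; have eQ := ecl_ext_closed Q.
have step1 A B X (f : hom A X) (g : hom X B) : ex f g -> ecl P A -> Q B ->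
    star (ecl Q) (ecl P) X.
  move=> fg EA; elim: EA B X f g fg => [{}A A0 | N M Z a b ab EN IH PZ] {}B {}X f g fg QB.
    apply: star_inl => //; apply: eQ.2 fg _ _; first exact: ecl_zero.
    exact: ecl_incl.
  have [N' [Y [u [v [NN' [Z' [B' [a' [b' [ZZ' BB' ZB]]]]] uv]]]]] :
      star (eq N) (star (eq Z) (eq B)) X.
    by apply: starAr; exists M, B, f, g; split=> //; exists N, Z, a, b.
  subst N' Z' B'; case: (sw _ _ _ _ _ PZ QB ZB) => [Y0 | QPY].
    by apply: star_inr => //; apply: eP.2 uv EN _; exact: ecl_zero.
  have [W [C [c [d [[N' [D' [m [k [NN' QD mk]]]]] PC cd]]]]] :
      star (star (eq N) Q) P X by apply: starAl; exists N, Y, u, v.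
  subst N'; have : star (star (ecl Q) (ecl P)) P X.
    by exists W, C, c, d; split=> //; exact: IH mk QD.
  move=> /starAr; apply: star_sub => // V VP; apply: (star_ext eP).
  by apply: star_sub VP => // ?; exact: ecl_incl.
move=> X [A [B [f [g [EA EB fg]]]]].
elim: EB X f g fg => [{}B B0 | N M Z a b ab EN IH QZ] X f g fg.
  by apply: star_inr => //; apply: eP.2 fg EA _; exact: ecl_zero.
have : star (star (eq A) (eq N)) (eq Z) X.
  by apply: starAl; exists A, M, f, g; split=> //; exists N, Z, a, b.
have IH' W : star (eq A) (eq N) W -> star (ecl Q) (ecl P) W.
  by case=> A' [N' [c [d [AA' NN' cd]]]]; subst A' N'; exact: IH cd.
move=> /(star_sub IH' (fun _ => id)) /starAr XE.
have : star (ecl Q) (star (ecl Q) (ecl P)) X.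
  apply: star_sub XE => // W [P' [Z' [c [d [EP' ZZ' cd]]]]].
  by subst Z'; exact: step1 cd EP' QZ.
by move=> /starAl; apply: star_sub => // V; exact: star_ext.
Qed.

(** With [P] and [Q] closed under extensions, (Q * P) * (Q * P) = Q * (P * Q) * P is contained in Q
    * Q * P * P, hence in Q * P. *)
Lemma star_swap_ext_closed P Q :
  (forall X, star (ecl P) (ecl Q) X -> star (ecl Q) (ecl P) X) ->
  ext_closed (star (ecl Q) (ecl P)).
Proof.
move=> sw; have eP := ecl_ext_closed P; have eQ := ecl_ext_closed Q.
split=> [X X0 | X Y Z f g fg SX SZ]; first by apply: star_inl => //; exact: ecl_zero.
have : star (star (ecl Q) (ecl P)) (star (ecl Q) (ecl P)) Y by exists X, Z, f, g.
move=> /starAr XE.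
have {}XE : star (ecl Q) (star (star (ecl Q) (ecl P)) (ecl P)) Y.
  apply: star_sub XE => // W /starAl; apply: star_sub => // V; exact: sw.
have {}XE : star (ecl Q) (star (ecl Q) (star (ecl P) (ecl P))) Y.
  by apply: star_sub XE => // W; exact: starAr.
have {}XE : star (star (ecl Q) (ecl Q)) (star (ecl P) (ecl P)) Y by exact: starAl.
by apply: star_sub XE => W; exact: star_ext.
Qed.

(** When the connecting map vanishes, [Y] is a direct sum and the triangle can be read in the other
    order. The hypothesis ranges over all candidates [h] because [ex] does not record a connecting
    map. *)
Lemma ex_split X Y Z (f : hom X Y) (g : hom Y Z) : ex f g ->
  (forall h, ex g h -> ex h (fmap (up T) f) -> h = 0) ->
  exists (s : hom Z Y) (r : hom Y X), ex s r.
Proof.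
move=> fg h0; have [h [gh hf]] := ex_rot fg; have {}h0 := h0 h gh hf.
have [s gs] : exists s, g \oc s = idm Z.
  by apply: (ex_liftl gh); rewrite h0 comp0l.
have fmono V (t : hom V X) : f \oc t = 0 -> t = 0.
  move=> ft; have [|u uE] := ex_liftl (t := fmap (up T) t) hf.
    by rewrite -fmap_comp ft fmap0.
  by apply: up_inj; rewrite -uE h0 comp0l.
have [r fr] : exists r, f \oc r = idm Y - (s \oc g).
  by apply: (ex_liftl fg); rewrite compBr compm1 compA gs comp1m subrr.
have rs : r \oc s = 0.
  by apply: fmono; rewrite compA fr compBl comp1m -compA gs compm1 subrr.
have rf : r \oc f = idm X.
  apply/subr0_eq/fmono; rewrite compBr compA fr compBl -compA (ex_zero fg) comp0r.
  by rewrite comp1m compm1 subr0 subrr.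
(* The retraction [r] factors through the cone of [s] as [r'], which is an isomorphism with inverse
   [p \oc f]. *)
have [W [p sp]] := ex_cone s.
have [r' r'p] := ex_liftr sp rs.
have pepi V (t : hom W V) : t \oc p = 0 -> t = 0.
  have [q [pq qs]] := ex_rot sp; move=> /(ex_liftr pq)[u <-].
  have q0 : q = 0.
    rewrite -[q]comp1m -fmap_id -gs fmap_comp -compA (ex_zero qs).
    by rewrite comp0r.
  by rewrite q0 comp0r.
exists s, r; apply: (ex_iso (a := idm Z) (b := idm Y) (c := r') _ _ _ _ _ sp).
- exact: is_iso_id.
- exact: is_iso_id.
- exists (p \oc f); split; last by rewrite compA r'p rf.
  apply/subr0_eq/pepi; rewrite compBl comp1m -compA r'p -compA fr compBr compm1.
  by rewrite compA (ex_zero sp) comp0l subr0 subrr.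
- by rewrite comp1m compm1.
- by rewrite r'p compm1.
Qed.

End StarCalculus.

Lemma ecl_op (K : fieldType) (T : dtri K) (P : T -> Prop) X :
  @ecl K (opposite T) P X <-> ecl P X.
Proof.
split.
  apply: (@ecl_min K (opposite T) P (ecl P)) => [|Y]; last exact: ecl_incl.
  split=> [Y /zero_object_op|A B C f g fg EA EC]; first exact: ecl_zero.
  exact: (ecl_ext_closed P).2 fg EC EA.
apply: ecl_min => [|Y PY]; last exact: (@ecl_incl K (opposite T)).
split=> [Y Y0|A B C f g fg EA EC].
  by apply: (@ecl_zero K (opposite T)); exact: (proj2 (zero_object_op Y)).
exact: (@ecl_ext_closed K (opposite T) P).2 _ _ _ g f fg EC EA.
Qed.

(** * Shifts *)

(** Convertible to [shift] when [T] is [dtri_of D]. *)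
Definition dshift (K : fieldType) (T : dtri K) (l : int) (X : T) : T :=
  match l with
  | Posz k => iter k (up T) X
  | Negz k => iter k.+1 (dn T) X
  end.

Lemma dshift_op (K : fieldType) (T : dtri K) l (X : T) :
  @dshift K (opposite T) l X = dshift (- l) X.
Proof. by case: l => [[|k]|k]. Qed.

Section Shift.

Variables (K : fieldType) (T : dtri K).
Implicit Types (X Y Z W : T) (P Q : T -> Prop) (k l : int) (a b : int -> bool).

Lemma up_dshift l X : isomorphic (up T (dshift l X)) (dshift (l + 1) X).
Proof.
case: l => [k|[|k]].
- by rewrite -PoszD addn1; exact: isomorphic_refl.
- exact: updn.
- have -> : Negz k.+1 + 1 = Negz k :> int by rewrite !NegzE -addn1 PoszD opprD subrK.
  exact: updn.
Qed.

Lemma dn_dshift l X : isomorphic (dn T (dshift l X)) (dshift (l - 1) X).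
Proof.
case: l => [[|k]|k].
- exact: isomorphic_refl.
- have -> : Posz k.+1 - 1 = Posz k :> int by rewrite -addn1 PoszD addrK.
  exact: dnup.
- have -> : Negz k - 1 = Negz k.+1 :> int by rewrite !NegzE [in RHS]intS opprD addrC.
  exact: isomorphic_refl.
Qed.

Lemma dshiftD k l X : isomorphic (dshift k (dshift l X)) (dshift (k + l) X).
Proof.
elim/int_rect: k => [|k IHk|k IHk]; first by rewrite add0r; exact: isomorphic_refl.
  rewrite intS (addrC 1) -addrA (addrC 1) addrA.
  apply: isomorphic_trans (up_dshift _ _).
  exact: isomorphic_trans (isomorphic_sym (up_dshift _ _)) (fmap_isomorphic _ IHk).
rewrite intS opprD (addrC (- 1)) -addrA (addrC (- 1)) addrA.
apply: isomorphic_trans (dn_dshift _ _).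
exact: isomorphic_trans (isomorphic_sym (dn_dshift _ _)) (fmap_isomorphic _ IHk).
Qed.

Lemma trivial_dshift k X Y :
  is_trivial (hom (dshift k X) (dshift k Y)) <-> is_trivial (hom X Y).
Proof.
case: k => k; rewrite /dshift; last move: k.+1 => {}k; elim: k => //= k IHk.
  by rewrite -IHk; exact: trivial_up.
by rewrite -IHk; exact: trivial_dn.
Qed.

Lemma trivial_dshift2 k l X Y :
  is_trivial (hom (dshift k X) (dshift l Y)) <-> is_trivial (hom X (dshift (l - k) Y)).
Proof.
rewrite -(trivial_dshift k X); have := dshiftD k (l - k) Y.
rewrite addrCA subrr addr0 => i; split; last exact: is_trivial_isor.
exact: is_trivial_isor (isomorphic_sym i).
Qed.

Lemma dshift_zero k X : zero_object X -> zero_object (dshift k X).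
Proof.
move=> X0; case: k => k; rewrite /dshift; last move: k.+1 => {}k; elim: k => //= k IHk.
  exact: zero_object_fmap.
exact: zero_object_fmap.
Qed.

Lemma ex_dshift k X Y Z (f : hom X Y) (g : hom Y Z) : ex f g ->
  exists (f' : hom (dshift k X) (dshift k Y)) (g' : hom (dshift k Y) (dshift k Z)), ex f' g'.
Proof.
move=> fg; case: k => k; rewrite /dshift; last move: k.+1 => {}k; elim: k => /=; try by exists f, g.
  move=> k [f' [g' /ex_up[g'' h]]]; eexists; eexists; exact: h.
move=> k [f' [g' /ex_dn[g'' h]]]; eexists; eexists; exact: h.
Qed.

(** Generators are taken up to isomorphism because shifts compose only up to isomorphism. With
    [predT] this is the triangulated subcategory generated by [P]; half-lines of degrees give the
    halves of a t-structure. *)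
Definition gen P a : T -> Prop :=
  ecl (fun Z => exists X l, [/\ P X, a l & isomorphic (dshift l X) Z]).

Lemma gen_dshift P a X l : P X -> a l -> gen P a (dshift l X).
Proof. by move=> PX al; apply: ecl_incl; exists X, l; split=> //; exact: isomorphic_refl. Qed.

Lemma gen_obj P a X : P X -> a 0 -> gen P a X.
Proof. exact: (@gen_dshift P a X 0). Qed.

Lemma gen_ext_closed P a : ext_closed (gen P a).
Proof. exact: ecl_ext_closed. Qed.

Lemma gen_iso P a : iso_closed (gen P a).
Proof. exact: ecl_iso. Qed.

Lemma gen_zero P a X : zero_object X -> gen P a X.
Proof. exact: ecl_zero. Qed.

Lemma gen_sub P Q a b : (forall X, P X -> Q X) -> (forall l, a l -> b l) ->
  forall X, gen P a X -> gen Q b X.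
Proof.
by move=> PQ ab X; apply: ecl_sub => Y [Z [l [PZ al i]]]; exists Z, l; split; auto.
Qed.

Lemma gen_min P a Q : ext_closed Q -> (forall X l, P X -> a l -> Q (dshift l X)) ->
  forall X, gen P a X -> Q X.
Proof.
move=> Qex H; apply: ecl_min => // X [Y [l [PY al i]]].
by apply: (ext_closed_iso Qex i); exact: H.
Qed.

Lemma gen_up P a b : (forall l, a l -> b (l + 1)) -> forall X, gen P a X -> gen P b (up T X).
Proof.
move=> ab; apply: gen_min => [|X l PX al].
  split=> [X X0|X Y Z f g /ex_up[g' fg']]; first by apply: gen_zero; exact: zero_object_fmap.
  exact: (gen_ext_closed P b).2 fg'.
by apply: (gen_iso (isomorphic_sym (up_dshift l X))); apply: gen_dshift => //; exact: ab.
Qed.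

Lemma gen_dn P a b : (forall l, a l -> b (l - 1)) -> forall X, gen P a X -> gen P b (dn T X).
Proof.
move=> ab; apply: gen_min => [|X l PX al].
  split=> [X X0|X Y Z f g /ex_dn[g' fg']]; first by apply: gen_zero; exact: zero_object_fmap.
  exact: (gen_ext_closed P b).2 fg'.
by apply: (gen_iso (isomorphic_sym (dn_dshift l X))); apply: gen_dshift => //; exact: ab.
Qed.

Lemma gen_shift P a b k : (forall l, a l -> b (k + l)) ->
  forall X, gen P a X -> gen P b (dshift k X).
Proof.
move=> ab; apply: gen_min => [|X l PX al].
  split=> [X X0|X Y Z f g fg]; first by apply: gen_zero; exact: dshift_zero.
  by case: (ex_dshift k fg) => f' [g' fg']; exact: (gen_ext_closed P b).2 fg'.
apply: (gen_iso (isomorphic_sym (dshiftD k l X))); apply: gen_dshift => //; exact: ab.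
Qed.

Lemma gen_orth P a Q b :
  (forall X Y k l, P X -> Q Y -> a k -> b l -> is_trivial (hom X (dshift (l - k) Y))) ->
  forall X Y, gen P a X -> gen Q b Y -> is_trivial (hom X Y).
Proof.
move=> H; apply: ecl_orth => X Y [X' [k [PX ak iX]]] [Y' [l [QY bl iY]]].
apply: (is_trivial_isol iX); apply: (is_trivial_isor iY).
by apply/trivial_dshift2; exact: H.
Qed.

End Shift.

Lemma gen_op (K : fieldType) (T : dtri K) (P : T -> Prop) a X :
  @gen K (opposite T) P a X <-> gen P (fun l => a (- l)) X.
Proof.
split=> [/(proj1 (ecl_op _ _)) EX | EX].
  apply: ecl_sub EX => Y [Z [l [PZ al i]]]; exists Z, (- l); rewrite opprK; split=> //.
  by rewrite -dshift_op; exact/isomorphic_op.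
apply: (proj2 (ecl_op _ _)); apply: ecl_sub EX => Y [Z [l [PZ al i]]].
by exists Z, (- l); split=> //; rewrite dshift_op opprK; exact/isomorphic_op.
Qed.

(** * Dual pairs of exceptional sequences *)

Section Orthogonality.

Variables (K : fieldType) (T : dtri K).
Implicit Types (X Y Z W : T) (P Q : T -> Prop) (k l m : int) (a b : int -> bool).

Lemma ex_zero_left X Y Z (f : hom X Y) (g : hom Y Z) : ex f g ->
  is_trivial (hom X Y) -> is_trivial (hom X (dn T Z)) -> zero_object X.
Proof.
move=> fg XY XZ; have [h [hf _]] := ex_rot' fg; apply/zero_objectP.
have [|u <-] := ex_liftl (t := idm X) hf; first exact: XY.
by rewrite (XZ u) comp0r.
Qed.

Lemma ex_zero_right X Y Z (f : hom X Y) (g : hom Y Z) : ex f g ->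
  is_trivial (hom Y Z) -> is_trivial (hom (up T X) Z) -> zero_object Z.
Proof.
move=> fg YZ XZ; have [h [gh _]] := ex_rot fg; apply/zero_objectP.
have [|u <-] := ex_liftr (t := idm Z) gh; first exact: YZ.
by rewrite (XZ u) comp0l.
Qed.

Definition gen_orthogonal P Q : Prop :=
  forall X Y l, P X -> Q Y -> is_trivial (hom X (dshift l Y)).

Lemma gen_orthogonalP P a Q b : gen_orthogonal P Q ->
  forall X Y, gen P a X -> gen Q b Y -> is_trivial (hom X Y).
Proof. by move=> PQ; apply: gen_orth => X Y k l PX QY _ _; exact: PQ. Qed.

(** A triangle from a [Q]-generator to a [P]-generator has its connecting map in a vanishing group,
    so it splits and can be reversed. *)
Lemma orthogonal_ext_closed P Q a b : gen_orthogonal P Q ->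
  ext_closed (star (gen P a) (gen Q b)).
Proof.
move=> PQ; apply: star_swap_ext_closed; apply: star_swap.
move=> A B Y f g [Y' [l [QY' bl iY]]] [X' [k [PX' ak iX]]] fg; right.
have [|s [r sr]] := ex_split fg.
  move=> h _ _; move: h; apply: (is_trivial_isol iX); apply: (is_trivial_isor (fmap_isomorphic _ iY)).
  apply: (is_trivial_isor (isomorphic_sym (up_dshift l Y'))).
  by apply/trivial_dshift2; exact: PQ.
exists B, A, s, r; split=> //; first by exists X', k.
by exists Y', l.
Qed.

Lemma gen_orthogonal_star P Q R a : gen_orthogonal P Q ->
  (forall X, R X -> P X \/ Q X) ->
  forall X, gen R a X -> star (gen P a) (gen Q a) X.
Proof.
move=> PQ RPQ; apply: gen_min; first exact: orthogonal_ext_closed.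
move=> X l /RPQ[PX | QX] al.
  by apply: star_inl; [exact: gen_ext_closed | exact: gen_dshift].
by apply: star_inr; [exact: gen_ext_closed | exact: gen_dshift].
Qed.

Definition scalar_end X : Prop :=
  idm X <> 0 /\ forall t : hom X X, exists c : K, t = c *: idm X.

Lemma scalar_end_iso X Y : isomorphic X Y -> scalar_end X -> scalar_end Y.
Proof.
case=> f [g [gf fg]] [X0 HX]; split=> [Y0 | t].
  by apply: X0; rewrite -gf -[f]comp1m Y0 comp0l comp0r.
have [c cE] := HX (g \oc t \oc f); exists c.
have -> : t = (f \oc (g \oc t \oc f)) \oc g.
  by rewrite !compA fg comp1m -compA fg compm1.
by rewrite cE compZr compm1 compZl fg.
Qed.

Lemma scalar_end_dshift k X : scalar_end X -> scalar_end (dshift k X).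
Proof.
move=> HX; case: k => k; rewrite /dshift; last move: k.+1 => {}k; elim: k => //= k [H0 H1].
  split=> [i0 | t]; first by apply/H0/up_inj; rewrite fmap_id.
  have [s ->] := up_full t; have [c ->] := H1 s.
  by exists c; rewrite fmapZ fmap_id.
split=> [i0 | t]; first by apply/H0/dn_inj; rewrite fmap_id.
have [s ->] := dn_full t; have [c ->] := H1 s.
by exists c; rewrite fmapZ fmap_id.
Qed.

Lemma scalar_end_map X Y Z (f : hom Y Z) : scalar_end X -> isomorphic X Y -> isomorphic X Z ->
  f = 0 \/ is_iso f.
Proof.
move=> [_ HX] [y yI] [z zI]; case: (yI) => y' [y1 y2]; case: (zI) => z' [z1 z2].
have [c cE] := HX (z' \oc f \oc y).
have fE : f = c *: (z \oc y').
  by rewrite -[LHS]comp1m -z2 -[f]compm1 -y2 -!compA (compA f) (compA z') (compA z') cE compZl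
    comp1m compZr.
have [c0|c0] := eqVneq c 0; first by left; rewrite fE c0 scale0r.
right; exists (c^-1 *: (y \oc z')); rewrite fE !compZl !compZr !scalerA.
rewrite mulVf // mulfV // !scale1r -!compA (compA z') z1 comp1m y2.
by rewrite (compA y') y1 comp1m z2.
Qed.

(* Extensions of [E[k]] by [E[l]] either split or, when [l = k - 1], are
   contractible, so that the shifts of [E] can be sorted. *)
Lemma exceptional_truncation E m : scalar_end E ->
  (forall l, l != 0 -> is_trivial (hom E (dshift l E))) ->
  forall X, gen (eq E) predT X ->
    star (gen (eq E) (fun l => m <= l)) (gen (eq E) (fun l => l < m)) X.
Proof.
move=> sE oE; apply: gen_min => [|X l <- _]; last first.
  have [ml | lm] := leP m l.
    by apply: star_inl; [exact: gen_ext_closed | exact: gen_dshift].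
  by apply: star_inr; [exact: gen_ext_closed | exact: gen_dshift].
apply: star_swap_ext_closed; apply: star_swap.
move=> A B Y f g [A' [l [<- lm iA]]] [B' [k [<- mk iB]]] fg.
have BA : isomorphic (dshift (l + 1) E) (up T A).
  exact: isomorphic_trans (isomorphic_sym (up_dshift l E)) (fmap_isomorphic _ iA).
have [ek | nk] := eqVneq (l + 1) k; last first.
  right; have [|s [r sr]] := ex_split fg.
    move=> h _ _; move: h; apply: (is_trivial_isol iB); apply: (is_trivial_isor BA).
    by apply/trivial_dshift2; apply: oE; rewrite subr_eq0.
  by exists B, A, s, r; split=> //; [exists E, k | exists E, l].
rewrite ek in BA.
have [h0 | h0] := classic (forall h, ex g h -> ex h (fmap (up T) f) -> h = 0).
  by right; have [s [r sr]] := ex_split fg h0; exists B, A, s, r; split=> //;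
    [exists E, k | exists E, l].
left; apply/zero_objectP; apply: NNPP => Y0; case: h0 => h gh hf.
have [// | [h' [h1 h2]]] := scalar_end_map h (scalar_end_dshift k sE) iB BA.
case: Y0; have g0 : g = 0 by rewrite -[g]comp1m -h1 -compA (ex_zero gh) comp0r.
have f0 : f = 0 by apply: up_inj; rewrite -[LHS]compm1 -h2 compA (ex_zero hf) comp0l.
have [|u <-] := ex_liftl (t := idm Y) fg; first by rewrite g0 comp0l.
by rewrite f0 comp0l.
Qed.

End Orthogonality.

Definition below (K : fieldType) (T : dtri K) (e : nat -> T) (s : nat) (X : T) : Prop :=
  exists2 i, (i < s)%N & e i = X.

(* The families are indexed by [nat] to allow recursion on the length of the
   sequence; their values at indices [>= n] are irrelevant. *)
Record dual_pair (K : fieldType) (T : dtri K) (n : nat) (e f : nat -> T) : Prop := DualPair {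
  dp_fin : forall X Y : T, gen (below e n) predT X -> gen (below e n) predT Y ->
    fin_dim (hom X Y);
  dp_ef : forall i j (l : int), (i < n)%N -> (j < n)%N -> (i != j) || (l != 0) ->
    is_trivial (hom (e i) (dshift l (f j)));
  dp_ee : forall i j (l : int), (i < n)%N -> (j < n)%N -> (j < i)%N || (i == j) && (l != 0) ->
    is_trivial (hom (e i) (dshift l (e j)));
  dp_end : forall i, (i < n)%N -> scalar_end (e i);
  dp_map : forall i, (i < n)%N -> exists (c : hom (e i) (f i)) W (p : hom (f i) W),
    ex c p /\ gen (below e i) predT W
}.

Section DualPair.

Variables (K : fieldType) (T : dtri K) (n : nat) (e f : nat -> T).
Hypothesis dp : dual_pair n e f.
Implicit Types (X Y Z W : T) (i j s t : nat) (k l m : int).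

Definition span_lt s : T -> Prop := gen (below e s) predT.

Lemma below_leq s s' : (s <= s')%N -> forall X, below e s X -> below e s' X.
Proof. by move=> ss' X [i ls <-]; exists i => //; exact: leq_trans ls ss'. Qed.

Lemma span_lt_leq s s' X : (s <= s')%N -> span_lt s X -> span_lt s' X.
Proof. by move=> ss'; apply: gen_sub => // Y; exact: below_leq. Qed.

Lemma span_lt_zero X : span_lt 0 X -> zero_object X.
Proof.
apply: gen_min => [|Y l [] //]; split=> // X' Y Z g h gh X0 Z0; apply/zero_objectP.
have [|u <-] := ex_liftr (t := idm Y) gh; first by apply: zero_object_hom; left.
by rewrite (zero_object_hom u) ?comp0l //; left.
Qed.

Lemma span_lt_dshift s l X : span_lt s X -> span_lt s (dshift l X).
Proof. exact: gen_shift. Qed.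

Lemma span_lt_e i s : (i < s)%N -> span_lt s (e i).
Proof. by move=> ls; apply: gen_obj => //; exists i. Qed.

Lemma e_orthogonal_e i : (i < n)%N -> gen_orthogonal (eq (e i)) (below e i).
Proof.
move=> lin X Y l <- [j lj <-]; apply: (dp_ee dp) => //; first exact: ltn_trans lin.
by rewrite lj.
Qed.

Lemma hom_e_span i X : (i < n)%N -> span_lt i X -> is_trivial (hom (e i) X).
Proof.
move=> lin; apply: (gen_orthogonalP (e_orthogonal_e lin)).
exact: (@gen_obj _ _ _ predT).
Qed.

Lemma span_lt_f i s : (i < n)%N -> (i < s)%N -> span_lt s (f i).
Proof.
move=> lin ls; have [c [W [p [cp CW]]]] := dp_map dp lin.
apply: (gen_ext_closed _ _).2 cp _ _; first exact: span_lt_e.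
by apply: span_lt_leq CW; exact: ltnW.
Qed.

(** Rotating the triangle of [dp_map] makes [e i] an extension of [f i] and of a desuspended object
    from the span of earlier [e j]; strong induction applies. *)
Lemma span_lt_fE s X : (s <= n)%N -> gen (below f s) predT X <-> span_lt s X.
Proof.
move=> sn; split.
  apply: gen_min => [|Y l [i ls <-] _]; first exact: gen_ext_closed.
  by apply/span_lt_dshift/span_lt_f => //; exact: leq_trans ls sn.
have ef i : (i < n)%N -> gen (below f i.+1) predT (e i).
  elim/ltn_ind: i => i IHi lin; have [c [W [p [cp CW]]]] := dp_map dp lin.
  have [h [hc _]] := ex_rot' cp; apply: (gen_ext_closed _ _).2 hc _ _; last first.
    by apply: gen_obj => //; exists i.
  apply: (@gen_dn _ _ _ predT) => //; apply: gen_min CW; first exact: gen_ext_closed.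
  move=> Y l [j lj <-] _; apply: (@gen_shift _ _ _ predT) => //.
  apply: gen_sub (IHi j lj (ltn_trans lj lin)) => // Z [k lk <-].
  by exists k => //; exact: leq_trans lk (leqW lj).
apply: gen_min => [|Y l [i ls <-] _]; first exact: gen_ext_closed.
apply: (@gen_shift _ _ _ predT) => //; apply: gen_sub (ef i (leq_trans ls sn)) => // Z [k lk <-].
by exists k => //; exact: leq_trans lk ls.
Qed.

Lemma e_orthogonal_f j : (j < n)%N -> gen_orthogonal (below e j) (eq (f j)).
Proof.
move=> lj X Y l [i li <-] <-; apply: (dp_ef dp) => //; first exact: ltn_trans lj.
by rewrite (ltn_eqF li).
Qed.

Lemma hom_span_f j X : (j < n)%N -> span_lt j X -> is_trivial (hom X (f j)).
Proof.
move=> ljn CX; apply: (gen_orthogonalP (e_orthogonal_f ljn) CX).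
exact: (@gen_obj _ _ _ predT).
Qed.

Lemma hom_span_f_dshift j X l : (j < n)%N -> span_lt j X -> is_trivial (hom X (dshift l (f j))).
Proof.
move=> ljn CX; apply: (gen_orthogonalP (e_orthogonal_f ljn) CX).
exact: (@gen_dshift _ _ _ predT).
Qed.

Lemma hom_e_span_dshift i X l : (i < n)%N -> span_lt i X -> is_trivial (hom (e i) (dshift l X)).
Proof. by move=> lin CX; apply: hom_e_span => //; exact: span_lt_dshift. Qed.

Lemma f_orthogonal_f i j l : (i < n)%N -> (j < n)%N -> (i < j)%N || (i == j) && (l != 0) ->
  is_trivial (hom (f i) (dshift l (f j))).
Proof.
move=> lin ljn /orP[lij | /andP[/eqP <- l0]].
  by apply: hom_span_f_dshift => //; exact: span_lt_f.
have [c [W [p [cp CW]]]] := dp_map dp lin; apply: trivial_exl cp _ _.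
  by apply: (dp_ef dp) => //; rewrite l0 orbT.
exact: hom_span_f_dshift.
Qed.

Lemma dual_map_spanning i (c : hom (e i) (f i)) W (p : hom (f i) W) :
  (i < n)%N -> ex c p -> span_lt i W -> forall t : hom (e i) (f i), exists a : K, t = a *: c.
Proof.
move=> lin cp CW t; have [|u <-] := ex_liftl (t := t) cp; first exact: hom_e_span.
have [_ H] := dp_end dp lin; have [a ->] := H u.
by exists a; rewrite compZr compm1.
Qed.

Lemma dual_map_neq0 i (c : hom (e i) (f i)) W (p : hom (f i) W) :
  (i < n)%N -> ex c p -> span_lt i W -> c <> 0.
Proof.
move=> lin cp CW c0; have [h [hc _]] := ex_rot' cp; have [H _] := dp_end dp lin; apply: H.
have [|u <-] := ex_liftl (t := idm (e i)) hc; first by rewrite c0 comp0l.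
rewrite (_ : u = 0) ?comp0r //; move: u; apply: hom_e_span => //.
exact: (@gen_dn _ _ _ predT).
Qed.

Lemma scalar_end_f i : (i < n)%N -> scalar_end (f i).
Proof.
move=> lin; have [c [W [p [cp CW]]]] := dp_map dp lin; split=> [f0 | t].
  by apply: (dual_map_neq0 lin cp CW); rewrite -[c]comp1m f0 comp0l.
have [a aE] := dual_map_spanning lin cp CW (t \oc c); exists a; apply/subr0_eq.
have [|u <-] := ex_liftr (t := t - a *: idm (f i)) cp.
  by rewrite compBl aE compZl comp1m subrr.
by rewrite (hom_span_f lin CW u) comp0l.
Qed.

End DualPair.

(** Rotating [e i -> f i -> W] back to [dn W -> e i -> f i] gives the triangle of the opposite pair.
    Finiteness passes over because [dp_fin] speaks of the whole span, which both families
    generate. *)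
Lemma dual_pair_op (K : fieldType) (T : dtri K) n (e f : nat -> T) :
  dual_pair n e f -> @dual_pair K (opposite T) n f e.
Proof.
move=> dp; have CE s X : (s <= n)%N ->
    @gen K (opposite T) (below f s) predT X <-> gen (below e s) predT X.
  move=> sn; split=> [/(proj1 (gen_op _ _ _)) H | H].
    by apply: (proj1 (span_lt_fE dp X sn)); apply: gen_sub H.
  by apply: (proj2 (gen_op _ _ _)); apply: gen_sub (proj2 (span_lt_fE dp X sn) H).
have homE (X Y : T) l : is_trivial (@hom K (opposite T) X (@dshift K (opposite T) l Y)) <->
    is_trivial (hom Y (dshift l X)).
  have := @trivial_dshift2 K T (- l) 0 Y X; rewrite sub0r opprK dshift_op.
  exact: id.
split.
- by move=> X Y /(CE _ _ (leqnn n)) CX /(CE _ _ (leqnn n)) CY; exact: (dp_fin dp CY CX).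
- by move=> i j l lin ljn H; apply/homE; apply: (dp_ef dp); rewrite // eq_sym.
- by move=> i j l lin ljn H; apply/homE; apply: (f_orthogonal_f dp); rewrite // eq_sym.
- by move=> i lin; have := scalar_end_f dp lin.
- move=> i lin; have [c [W [p [cp CW]]]] := dp_map dp lin.
  have [h [hc _]] := ex_rot' cp; exists c, (dn T W), h; split=> //.
  by apply/(CE i); [exact: ltnW | exact: (@gen_dn _ _ _ predT)].
Qed.

(** * Truncation inside the spans *)

Section Truncation.

Variables (K : fieldType) (T : dtri K) (n : nat) (e f : nat -> T).
Hypothesis dp : dual_pair n e f.
Implicit Types (X Y Z W : T) (i j s t : nat) (k l m : int).

(* [aisle s 0] and [coaisle s 0] are the classes [U] and [V] for [C_s]; note that
   [coaisle s m] is [V[m]], an upper bound on the shifts. *)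
Definition aisle s m : T -> Prop := gen (below e s) (fun l => m <= l).
Definition coaisle s m : T -> Prop := gen (below f s) (fun l => l <= m).

Lemma aisle_ext_closed s m : ext_closed (aisle s m).
Proof. exact: gen_ext_closed. Qed.

Lemma coaisle_ext_closed s m : ext_closed (coaisle s m).
Proof. exact: gen_ext_closed. Qed.

Lemma aisle_span s m X : aisle s m X -> span_lt e s X.
Proof. exact: gen_sub. Qed.

Lemma coaisle_span s m X : (s <= n)%N -> coaisle s m X -> span_lt e s X.
Proof. by move=> sn H; apply/(span_lt_fE dp _ sn); apply: gen_sub H. Qed.

Lemma aisle_leq s s' m m' X : (s <= s')%N -> m' <= m -> aisle s m X -> aisle s' m' X.
Proof.
move=> ss' mm'; apply: gen_sub => [Y|l]; first exact: below_leq.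
exact: le_trans.
Qed.

Lemma coaisle_leq s s' m m' X : (s <= s')%N -> m <= m' -> coaisle s m X -> coaisle s' m' X.
Proof.
move=> ss' mm'; apply: gen_sub => [Y|l]; first exact: below_leq.
by move=> lm; exact: le_trans lm mm'.
Qed.

Lemma aisle_up s m X : aisle s m X -> aisle s (m + 1) (up T X).
Proof. by apply: gen_up => l; rewrite lerD2r. Qed.

Lemma aisle_dn s m X : aisle s m X -> aisle s (m - 1) (dn T X).
Proof. by apply: gen_dn => l; rewrite lerD2r. Qed.

Lemma coaisle_up s m X : coaisle s m X -> coaisle s (m + 1) (up T X).
Proof. by apply: gen_up => l; rewrite lerD2r. Qed.

Lemma coaisle_dn s m X : coaisle s m X -> coaisle s (m - 1) (dn T X).
Proof. by apply: gen_dn => l; rewrite lerD2r. Qed.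

Lemma aisle_orth s s' m m' X Y : (s <= n)%N -> (s' <= n)%N -> m' < m ->
  aisle s m X -> coaisle s' m' Y -> is_trivial (hom X Y).
Proof.
move=> sn s'n mm'; apply: gen_orth => {}X {}Y k l [i ls <-] [j ls' <-] /= mk lm.
apply: (dp_ef dp); [exact: leq_trans ls sn | exact: leq_trans ls' s'n|].
by rewrite subr_eq0 orbC lt_eqF //; exact: le_lt_trans lm (lt_le_trans mm' mk).
Qed.

Lemma e_star s a X : (s < n)%N -> gen (below e s.+1) a X ->
  star (gen (eq (e s)) a) (gen (below e s) a) X.
Proof.
move=> sn; apply: gen_orthogonal_star => [|Y [i]]; first exact: (e_orthogonal_e dp).
by rewrite ltnS leq_eqVlt => /orP[/eqP -> | ls] <-; [left | right; exists i].
Qed.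

Lemma f_star s a X : (s < n)%N -> gen (below f s.+1) a X ->
  star (gen (below f s) a) (gen (eq (f s)) a) X.
Proof.
move=> sn; apply: gen_orthogonal_star => [Y Z l [i ls <-] <-|Y [i]].
  by apply: (f_orthogonal_f dp); rewrite ?ls //; exact: ltn_trans sn.
by rewrite ltnS leq_eqVlt => /orP[/eqP -> | ls] <-; [right | left; exists i].
Qed.

(** With C the smaller span, X lies in C * Fge * Flt, and Fge is contained in E * C. Orthogonality
    absorbs C * E * C into E * C, and truncating this last C as U * V regroups E * (U * V) * Flt as
    (E * U) * (V * Flt). *)
Lemma truncation s m X : (s <= n)%N -> span_lt e s X ->
  star (aisle s m) (coaisle s (m - 1)) X.
Proof.
elim: s X => [|s IHs] X sn CX.
  apply: star_inl; first exact: coaisle_ext_closed.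
  by apply: gen_zero; exact: span_lt_zero CX.
pose E := gen (eq (e s)) (fun l => m <= l).
pose Fge := gen (eq (f s)) (fun l => m <= l).
pose Flt := gen (eq (f s)) (fun l => l < m).
have [c [W [p [cp CW]]]] := dp_map dp sn.
have ECex : ext_closed (star E (span_lt e s)).
  exact: orthogonal_ext_closed (e_orthogonal_e dp sn).
have FgeE Y : Fge Y -> star E (span_lt e s) Y.
  apply: gen_min => // Z l <- ml; have [c' [p' cp']] := ex_dshift l cp.
  exists (dshift l (e s)), (dshift l W), c', p'; split=> //; first exact: gen_dshift.
  exact: span_lt_dshift.
have XE : star (span_lt e s) (star Fge Flt) X.
  have /(f_star sn) := proj2 (span_lt_fE dp X sn) CX; apply: star_sub => Y.
    by move/(span_lt_fE dp Y (ltnW sn)).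
  apply: (@exceptional_truncation _ _ (f s) m (scalar_end_f dp sn)) => l l0.
  by apply: (f_orthogonal_f dp); rewrite // eqxx l0 orbT.
have {}XE : star (star E (span_lt e s)) Flt X.
  move/starAl: XE; apply: star_sub => // Y YE; apply: (star_ext ECex).
  by apply: star_sub YE => // Z CZ; apply: star_inr => //; exact: gen_ext_closed.
have {}XE : star (star E (star (aisle s m) (coaisle s (m - 1)))) Flt X.
  by apply: star_sub XE => // Y; apply: star_sub => // Z; apply: IHs; exact: ltnW.
have {}XE : star (star E (aisle s m)) (star (coaisle s (m - 1)) Flt) X.
  by apply: starAr; apply: star_sub XE => // Y; exact: starAl.
apply: star_sub XE => Y YE; first apply: (star_ext (aisle_ext_closed s.+1 m)).
  apply: star_sub YE => Z; last exact: aisle_leq.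
  by apply: gen_sub => // V <-; exists s.
apply: (star_ext (coaisle_ext_closed s.+1 (m - 1))).
apply: star_sub YE => Z; first exact: coaisle_leq.
by apply: gen_sub => [V <-|l]; [exists s | rewrite -ltzD1 subrK].
Qed.

(** Truncating inside the smaller span leaves a quotient to which neither [X] nor [up A] has a
    nonzero map; such a quotient is zero. *)
Lemma aisle_restrict s m X : (s <= n)%N -> aisle n m X -> span_lt e s X -> aisle s m X.
Proof.
move=> sn AX CX; have [A [B [u [v [AA AB uv]]]]] := truncation m sn CX.
suff B0 : zero_object B by apply: (aisle_ext_closed s m).2 uv AA _; exact: gen_zero.
have mm : m - 1 < m by rewrite ltrBlDr ltrDl.
apply: ex_zero_right uv _ _; first exact: aisle_orth mm AX AB.
have AA' : aisle s m (up T A) by apply: aisle_leq (aisle_up AA) => //; rewrite lerDl.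
exact: aisle_orth mm AA' AB.
Qed.

Lemma coaisle_restrict s m X : (s <= n)%N -> coaisle n m X -> span_lt e s X -> coaisle s m X.
Proof.
move=> sn AX CX; have [A [B [u [v [AA AB uv]]]]] := truncation (m + 1) sn CX.
rewrite addrK in AB.
suff A0 : zero_object A by apply: (coaisle_ext_closed s m).2 uv _ AB; exact: gen_zero.
have mm : m < m + 1 by rewrite ltrDl.
apply: ex_zero_left uv _ _; first exact: aisle_orth mm AA AX.
have AB' : coaisle s m (dn T B) by apply: coaisle_leq (coaisle_dn AB) => //; rewrite gerBl.
exact: aisle_orth mm AA AB'.
Qed.

(** In [H -> X -> Z] with [H] built from shifts of [e s], the object [H] has no map to [X] by
    hypothesis and none to [dn Z] by exceptionality, so it vanishes. *)
Lemma span_lt_of_orth s X : (s < n)%N -> span_lt e s.+1 X ->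
  (forall l, is_trivial (hom (e s) (dshift l X))) -> span_lt e s X.
Proof.
move=> sn CX eX; have [H [Z [u [v [EH CZ uv]]]]] := e_star sn CX.
suff H0 : zero_object H by apply: (gen_ext_closed _ _).2 uv _ CZ; exact: gen_zero.
have eX' l : is_trivial (hom (dshift l (e s)) X).
  by apply/(trivial_dshift2 l 0 (e s) X); exact: eX.
apply: (ex_zero_left uv).
  apply: (@gen_min _ _ _ _ (fun Y => is_trivial (hom Y X))) EH => [|Y l <- _]; last exact: eX'.
  split=> [Y Y0 t|A B C f' g fg]; first by apply: zero_object_hom; left.
  exact: trivial_exl fg.
apply: (gen_orthogonalP (b := predT) (e_orthogonal_e dp sn) EH).
exact: (@gen_dn _ _ _ predT).
Qed.

End Truncation.

Lemma aisle_op (K : fieldType) (T : dtri K) (f : nat -> T) s m X :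
  @aisle K (opposite T) f s m X <-> coaisle f s (- m) X.
Proof.
by split=> [/(proj1 (gen_op _ _ _)) H | H]; [|apply: (proj2 (gen_op _ _ _))];
  apply: gen_sub H => // l /=; rewrite lerNr.
Qed.

Lemma coaisle_op (K : fieldType) (T : dtri K) (e : nat -> T) s m X :
  @coaisle K (opposite T) e s m X <-> aisle e s (- m) X.
Proof.
by split=> [/(proj1 (gen_op _ _ _)) H | H]; [|apply: (proj2 (gen_op _ _ _))];
  apply: gen_sub H => // l /=; rewrite lerNl.
Qed.

(** * The heart *)

(** Summands are split off one at a time, passing to the cone. The indices form a list in an
    arbitrary [eqType] to serve both direct sums over ['I_m] and tensor objects, whose summands are
    indexed by a degree and a basis index. *)
Lemma retract_ext_closed (K : fieldType) (T : dtri K) (Q : T -> Prop) (J : eqType)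
    (s : seq J) (H : T) (G : J -> T) (a : forall j, hom (G j) H) (b : forall j, hom H (G j)) :
  ext_closed Q -> uniq s -> (forall j, j \in s -> Q (G j)) ->
  (forall j, j \in s -> b j \oc a j = idm (G j)) ->
  (forall i j, i \in s -> j \in s -> i <> j -> b j \oc a i = 0) ->
  \sum_(j <- s) (a j \oc b j) = idm H -> Q H.
Proof.
move=> Qex; elim: s H a b => [|x s IHs] H a b /=.
  by move=> _ _ _ _; rewrite big_nil => H0; apply: Qex.1; apply/zero_objectP.
case/andP=> xs us QG ba1 ba0; rewrite big_cons => sumE.
have [Z [p ap]] := ex_cone (a x).
have xx : x \in x :: s by rewrite mem_head.
have ss j : j \in s -> j \in x :: s by rewrite in_cons orbC => ->.
have xj j : j \in s -> x <> j by move=> js xj; rewrite xj js in xs.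
have pepi W (t : hom Z W) : t \oc p = 0 -> t = 0.
  have [q [pq qa]] := ex_rot ap; move=> /(ex_liftr pq)[u <-].
  rewrite (_ : q = 0) ?comp0r // -[q]comp1m -fmap_id -(ba1 x xx) fmap_comp -compA.
  by rewrite (ex_zero qa) comp0r.
have b'P j : exists c : hom Z (G j), j \in s -> c \oc p = b j.
  have [js | _] := boolP (j \in s); last by exists 0.
  have [|c cE] := ex_liftr (t := b j) ap; last by exists c.
  by apply: ba0 => //; [exact: ss | exact: xj].
pose b' j := proj1_sig (constructive_indefinite_description _ (b'P j)).
have b'E j : j \in s -> b' j \oc p = b j.
  by rewrite /b'; case: constructive_indefinite_description.
apply: (Qex.2 _ _ _ _ _ ap (QG x xx)).
apply: (IHs Z (fun j => p \oc a j) b') => //.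
- by move=> j js; apply: QG; exact: ss.
- by move=> j js; rewrite compA b'E // ba1 // ss.
- by move=> i j si sj ij; rewrite compA b'E // ba0 // ss.
apply/subr0_eq/pepi; rewrite compBl comp1m.
suff -> : (\sum_(j <- s) (p \oc a j \oc b' j)) \oc p = p by rewrite subrr.
rewrite -[RHS]compm1 -sumE compDr compA (ex_zero ap) comp0l add0r comp_suml comp_sumr.
by rewrite !big_seq; apply: eq_bigr => j js; rewrite -compA b'E // compA.
Qed.

Section Heart.

Variables (K : fieldType) (T : dtri K) (n : nat) (e f : nat -> T).
Hypothesis dp : dual_pair n e f.
Implicit Types (X Y Z W : T) (i j s t : nat) (k l m : int).

Definition glued_heart s X : Prop := aisle e s 0 X /\ coaisle f s 0 X.

(** A map killed by [u] comes from [dn Z], which lies strictly below the aisle containing [W]. The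
    two levels are independent because the objects often come from different spans. *)
Lemma heart_mono s s' X Y Z W (u : hom X Y) (v : hom Y Z) (t : hom W X) :
  (s <= n)%N -> (s' <= n)%N -> ex u v -> coaisle f s 0 Z -> aisle e s' 0 W ->
  u \oc t = 0 -> t = 0.
Proof.
move=> sn s'n uv CZ AW ut; have [h [hu _]] := ex_rot' uv.
have [r <-] := ex_liftl hu ut; rewrite (_ : r = 0) ?comp0r //; move: r.
exact: (aisle_orth dp s'n sn _ AW (coaisle_dn CZ)).
Qed.

Lemma heart_epi s s' X Y Z W (u : hom X Y) (v : hom Y Z) (t : hom Z W) :
  (s <= n)%N -> (s' <= n)%N -> ex u v -> aisle e s 0 X -> coaisle f s' 0 W ->
  t \oc v = 0 -> t = 0.
Proof.
move=> sn s'n uv AX CW tv; have [h [vh _]] := ex_rot uv.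
have [r <-] := ex_liftr vh tv; rewrite (_ : r = 0) ?comp0l //; move: r.
exact: (aisle_orth dp sn s'n _ (aisle_up AX) CW).
Qed.

Lemma glued_heart_leq s s' X : (s <= s')%N -> glued_heart s X -> glued_heart s' X.
Proof. by move=> ss' [AX CX]; split; [apply: aisle_leq ss' _ AX | apply: coaisle_leq ss' _ CX]. Qed.

Lemma glued_heart_ext_closed s : ext_closed (glued_heart s).
Proof.
split=> [X X0|X Y Z u v uv [AX CX] [AZ CZ]]; first by split; exact: gen_zero.
by split; [exact: (aisle_ext_closed _ _ _).2 uv AX AZ | exact: (coaisle_ext_closed _ _ _).2 uv CX CZ].
Qed.

Lemma glued_heart_restrict s X : (s <= n)%N -> glued_heart n X -> span_lt e s X ->
  glued_heart s X.
Proof. by move=> sn [? ?] ?; split; [exact: (aisle_restrict dp) | exact: (coaisle_restrict dp)]. Qed.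

(* The cone of [g] is truncated as [A -> cone -> Q]; then [Q] is the cokernel of
   [g], [dn A] its kernel, and the fibre of [Y -> Q] its image. *)
Lemma glued_heart_image s X Y (g : hom X Y) : (s <= n)%N ->
  glued_heart s X -> glued_heart s Y ->
  exists N I Q (k : hom N X) (u : hom X I) (m : hom I Y) (q : hom Y Q),
    [/\ glued_heart s N, glued_heart s I & glued_heart s Q] /\
    [/\ ex k u, ex m q & m \oc u = g].
Proof.
move=> sn [AX CX] [AY CY]; have [Z [z gz]] := ex_cone g.
have [h [zh _]] := ex_rot gz.
have AZ : aisle e s 0 Z.
  apply: (aisle_ext_closed _ _ _).2 zh AY _.
  exact: aisle_leq (leqnn s) _ (aisle_up AX).
have [A [Q [a [q [AA CQ aq]]]]] := truncation dp 1 sn (aisle_span AZ).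
rewrite subrr in CQ; have [h' [qh' _]] := ex_rot aq.
have AQ : aisle e s 0 Q.
  apply: (aisle_ext_closed _ _ _).2 qh' AZ _.
  by apply: aisle_leq (leqnn s) _ (aisle_up AA).
have [I [m mq]] := ex_cocone (q \oc z).
have [u [v [uv mu _]]] := ex_octa' gz mq aq.
have AI : aisle e s 0 I.
  by apply: (aisle_ext_closed _ _ _).2 uv AX _; apply: aisle_leq (leqnn s) _ AA.
have CI : coaisle f s 0 I.
  have [r [rm _]] := ex_rot' mq; apply: (coaisle_ext_closed _ _ _).2 rm _ CY.
  by apply: coaisle_leq (leqnn s) _ (coaisle_dn CQ).
have [k [ku r]] := ex_rot' uv.
exists (dn T A), I, Q, k, u, m, (q \oc z); do !split=> //.
- exact: (aisle_dn AA).
- apply: (coaisle_ext_closed _ _ _).2 r _ CX.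
  by apply: coaisle_leq (leqnn s) _ (coaisle_dn CI).
Qed.

End Heart.

Lemma glued_heart_op (K : fieldType) (T : dtri K) (e f : nat -> T) s X :
  @glued_heart K (opposite T) f e s X <-> glued_heart e f s X.
Proof.
have [a1 a2] := @aisle_op K T f s 0 X; have [b1 b2] := @coaisle_op K T e s 0 X.
by rewrite oppr0 in a1 a2 b1 b2; split=> -[? ?]; split; auto.
Qed.

(** * The heart as an abelian category *)

Section HeartCategory.

Variables (K : fieldType) (T : dtri K) (n : nat) (e f : nat -> T).
Hypothesis dp : dual_pair n e f.
Variable Hp : T -> Prop.
Hypothesis HpE : forall X, Hp X <-> glued_heart e f n X.

Local Notation HC := (@full_subcat K T Hp).
Implicit Types X Y Z W : HC.

Definition heart_ex X Y Z (g : hom X Y) (h : hom Y Z) : Prop :=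
  @ex K T (sval X) (sval Y) (sval Z) g h.

Lemma heart_objP X : glued_heart e f n (sval X).
Proof. by apply/HpE; case: X. Qed.

Lemma heart_zeroE X : zero_object X <-> @zero_object K T (sval X).
Proof. by split=> /zero_objectP X0; apply/zero_objectP. Qed.

Lemma heart_isoE X Y (g : hom X Y) : is_iso g <-> @is_iso K T (sval X) (sval Y) g.
Proof. by []. Qed.

Lemma heart_ex_mono X Y Z W (g : hom X Y) (h : hom Y Z) (t : hom W X) :
  heart_ex g h -> g \oc t = 0 -> t = 0.
Proof.
move=> gh; exact: (heart_mono dp (leqnn n) (leqnn n) gh (heart_objP Z).2 (heart_objP W).1).
Qed.

Lemma heart_ex_epi X Y Z W (g : hom X Y) (h : hom Y Z) (t : hom Z W) :
  heart_ex g h -> t \oc h = 0 -> t = 0.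
Proof.
move=> gh; exact: (heart_epi dp (leqnn n) (leqnn n) gh (heart_objP X).1 (heart_objP W).2).
Qed.

Lemma heart_image X Y (g : hom X Y) :
  exists N I Q (k : hom N X) (u : hom X I) (m : hom I Y) (q : hom Y Q),
    [/\ heart_ex k u, heart_ex m q & m \oc u = g].
Proof.
have [N [I [Q [k [u [m [q [[N' I' Q'] [ku mq <-]]]]]]]]] :=
  glued_heart_image dp (g : @hom K T (sval X) (sval Y)) (leqnn n) (heart_objP X) (heart_objP Y).
exists (exist _ N (proj2 (HpE N) N')), (exist _ I (proj2 (HpE I) I')).
by exists (exist _ Q (proj2 (HpE Q) Q')), k, u, m, q.
Qed.

Lemma heart_ex_monoP X Y Z (g : hom X Y) (h : hom Y Z) : heart_ex g h -> mono g.
Proof.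
move=> gh W s t st; apply/subr0_eq/(heart_ex_mono gh).
by rewrite compBr st subrr.
Qed.

Lemma heart_ex_epiP X Y Z (g : hom X Y) (h : hom Y Z) : heart_ex g h -> epi h.
Proof.
move=> gh W s t st; apply/subr0_eq/(heart_ex_epi gh).
by rewrite compBl st subrr.
Qed.

Lemma heart_ex_kernel X Y Z (g : hom X Y) (h : hom Y Z) : heart_ex g h -> is_kernel h g.
Proof.
move=> gh; split=> [|W t ht]; first exact: ex_zero gh.
have [u uE] := ex_liftl (gh : @ex K T _ _ _ g h) ht; exists u; split=> // v vE.
by apply: (heart_ex_monoP gh); rewrite vE -uE.
Qed.

Lemma heart_ex_cokernel X Y Z (g : hom X Y) (h : hom Y Z) : heart_ex g h -> is_cokernel g h.
Proof.
move=> gh; split=> [|W t ht]; first exact: ex_zero gh.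
have [u uE] := ex_liftr (gh : @ex K T _ _ _ g h) ht; exists u; split=> // v vE.
by apply: (heart_ex_epiP gh); rewrite vE -uE.
Qed.

Lemma heart_epiE Y Z (h : hom Y Z) : epi h -> exists X (g : hom X Y), heart_ex g h.
Proof.
move=> he; have [N [I [Q [k [u [m [q [ku mq mu]]]]]]]] := heart_image h.
have Q0 : zero_object Q.
  apply/zero_objectP/(heart_ex_epi mq); rewrite comp1m.
  by apply: he; rewrite -mu compA (ex_zero mq : q \oc m = 0) !comp0l.
have mI : @is_iso K T (sval I) (sval Z) m := ex_zeror mq (proj1 (heart_zeroE Q) Q0).
exists N, k; apply: (ex_iso (a := idm _) (b := idm _) (c := m) _ _ mI _ _ ku).
- exact: is_iso_id.
- exact: is_iso_id.
- by rewrite comp1m compm1.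
- by rewrite compm1.
Qed.

Lemma heart_monoE X Y (g : hom X Y) : mono g -> exists Z (h : hom Y Z), heart_ex g h.
Proof.
move=> gm; have [N [I [Q [k [u [m [q [ku mq mu]]]]]]]] := heart_image g.
have N0 : zero_object N.
  apply/zero_objectP/(heart_ex_mono ku); rewrite compm1.
  by apply: gm; rewrite -mu -compA (ex_zero ku : u \oc k = 0) !comp0r.
have [v [v1 v2]] : @is_iso K T (sval X) (sval I) u := ex_zerol ku (proj1 (heart_zeroE N) N0).
exists Q, q; apply: (ex_iso (a := v) (b := idm _) (c := idm _) _ _ _ _ _ mq).
- by exists u.
- exact: is_iso_id.
- exact: is_iso_id.
- by rewrite comp1m -mu -[RHS]compA v2 compm1.
- by rewrite comp1m compm1.
Qed.

(** In the nontrivial direction, [h] is an epimorphism and so ends a triangle in the heart; the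
    first map of that triangle is another kernel of [h], hence isomorphic to [g]. *)
Lemma heart_short_exact X Y Z (g : hom X Y) (h : hom Y Z) : short_exact g h <-> heart_ex g h.
Proof.
split=> [[[hg kg] [_ ch]] | gh]; last by split; [exact: heart_ex_kernel | exact: heart_ex_cokernel].
have he : epi h.
  move=> W s t st; have [|u [uE uU]] := ch _ (s \oc h); first by rewrite -compA hg comp0r.
  by rewrite -(uU s) // -(uU t).
have [N [k kh]] := heart_epiE he.
have [a [aE _]] := kg _ k (ex_zero kh); have [_ H] := heart_ex_kernel kh.
have [b [bE _]] := H _ g hg.
have ba : b \oc a = idm N.
  by apply: (heart_ex_monoP kh); rewrite compA bE aE compm1.
have ab : a \oc b = idm X.
  have [u [_ uU]] := kg _ g hg.
  by rewrite -(uU (idm X)) ?compm1 // -(uU (a \oc b)) // compA aE bE.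
apply: (ex_iso (a := a) (b := idm _) (c := idm _) _ _ _ _ _ kh).
- by exists b.
- exact: is_iso_id.
- exact: is_iso_id.
- by rewrite comp1m; exact: (esym aE).
- by rewrite comp1m compm1.
Qed.

Lemma heart_direct_sum m (X : 'I_m -> HC) (H : T)
    (i : forall a, @hom K T (sval (X a)) H) (p : forall a, @hom K T H (sval (X a))) :
  is_direct_sum i p -> Hp H.
Proof.
case=> pi1 pi0 sumE; apply/HpE.
apply: (retract_ext_closed (s := index_enum 'I_m) (glued_heart_ext_closed e f n) _ _ _ _ sumE).
- exact: index_enum_uniq.
- by move=> j _; exact: heart_objP.
- by move=> j _; exact: pi1.
- by move=> j j' _ _; exact: pi0.
Qed.

Lemma heart_additive : additive_cat T -> additive_cat HC.
Proof.
move=> addT m X; have [H [i [p HS]]] := addT m (fun a => sval (X a)).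
exists (exist _ H (heart_direct_sum HS)), i, p; exact: HS.
Qed.

Lemma heart_abelian : additive_cat T -> abelian_cat HC.
Proof.
move=> addT; split; first exact: heart_additive.
- move=> X Y g; have [N [I [Q [k [u [m [q [ku mq <-]]]]]]]] := heart_image g.
  have [uk H] := heart_ex_kernel ku; exists N, k; split; first by rewrite -compA uk comp0r.
  by move=> Z t mut; apply: H; apply: (heart_ex_mono mq); rewrite compA.
- move=> X Y g; have [N [I [Q [k [u [m [q [ku mq <-]]]]]]]] := heart_image g.
  have [qm H] := heart_ex_cokernel mq; exists Q, q; split; first by rewrite compA qm comp0l.
  by move=> Z t tmu; apply: H; apply: (heart_ex_epi ku); rewrite -compA.
- by move=> X Y g /heart_monoE[Z [h gh]]; exists Z, h; exact: heart_ex_kernel.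
- by move=> X Y g /heart_epiE[Z [h gh]]; exists Z, h; exact: heart_ex_cokernel.
Qed.

(** Intermediate objects stay in the heart, which is closed under extensions. The statement runs
    over all [X'] above [X] because an object of the subcategory also carries a proof of
    membership. *)
Lemma filtered_by_of_ecl (R : HC -> Prop) (X : T) :
  ecl (fun Z : T => exists2 Z' : HC, R Z' & sval Z' = Z) X ->
  forall X' : HC, sval X' = X -> filtered_by R X'.
Proof.
elim=> [{}X X0 | N M Z g h gh EN IH [Z' RZ' ZE]] X' XE.
  exists [::]; last by [].
  by apply: filtration_nil; apply/heart_zeroE; rewrite XE.
subst Z M; have hN : Hp N.
  apply/HpE; move: EN; apply: ecl_min; first exact: glued_heart_ext_closed.
  by move=> Y [Y' _ <-]; exact: heart_objP.
have [s fs Rs] := IH (exist _ N hN) erefl; exists (Z' :: s); last by constructor.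
apply: (filtration_cons (f := g : hom (exist _ N hN : HC) X') (g := h) _ fs).
exact/heart_short_exact.
Qed.

End HeartCategory.

(** * Simple objects *)

Section SimpleObjects.

Variables (K : fieldType) (T : dtri K) (n : nat) (e f : nat -> T).
Hypothesis dp : dual_pair n e f.
Implicit Types (X Y Z W : T) (i j s t : nat) (k l m : int).

Lemma aisle_e i : aisle e i.+1 0 (e i).
Proof. by apply: gen_obj => //; exists i. Qed.

Lemma coaisle_f i : coaisle f i.+1 0 (f i).
Proof. by apply: gen_obj => //; exists i. Qed.

(** Among the shifts of the first [s.+1] objects, [e s] maps nontrivially only to itself in degree
    0. Hence [hom (e s)] is right exact on the heart of their span. *)
Lemma hom_e_aisle s X : (s < n)%N -> aisle e s.+1 1 X -> is_trivial (hom (e s) X).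
Proof.
move=> sn; apply: (@gen_orth _ _ (eq (e s)) (fun l => l == 0)); last exact: gen_obj.
move=> Y Z k l <- [j js <-] /eqP -> l1; rewrite subr0; apply: (dp_ee dp) => //.
  exact: leq_ltn_trans sn.
move: js; rewrite ltnS leq_eqVlt => /orP[/eqP -> | -> //].
by rewrite eqxx ltnn /=; apply: contraTneq l1 => ->.
Qed.

(* On this heart [hom (e s)] has no cohomology outside degree 0, so its vanishing
   forces that of all the shifted groups. *)
Lemma glued_heart_killed s X : (s < n)%N -> glued_heart e f s.+1 X ->
  is_trivial (hom (e s) X) -> glued_heart e f s X.
Proof.
move=> sn [AX CX] eX; apply: (glued_heart_restrict dp (ltnW sn)).
  exact: glued_heart_leq sn _.
apply: (span_lt_of_orth dp) => // [|l]; first exact: aisle_span AX.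
have [l0 | l0 | <- //] := ltrgtP 0 l.
  apply: hom_e_aisle => //; apply: gen_shift AX => k k0.
  by rewrite -[1]addr0 lerD // -gtz0_ge1.
have Cl : coaisle f s.+1 l (dshift l X).
  by apply: gen_shift CX => k k0; rewrite gerDl.
exact: (aisle_orth dp sn sn l0 (aisle_e s) Cl).
Qed.

(** A map from [e i] to the kernel induces a scalar endomorphism of [e i]; were the scalar nonzero,
    [k] would be a split epimorphism and [u] would vanish. So [hom (e i)] kills the kernel. *)
Lemma glued_heart_kernel_e i X Y (k : hom X (e i)) (u : hom (e i) Y) : (i < n)%N ->
  ex k u -> glued_heart e f i.+1 X -> coaisle f n 0 Y -> u <> 0 -> glued_heart e f i X.
Proof.
move=> lin ku HX CY u0; apply: glued_heart_killed => // t.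
apply: (heart_mono dp (leqnn n) lin ku) => //; first exact: aisle_e.
have [a kt] := (dp_end dp lin).2 (k \oc t).
have [a0 | a0] := eqVneq a 0; first by rewrite kt a0 scale0r.
case: u0; rewrite -[u]compm1 -(scale1r (idm _)) -(mulVf a0) -scalerA -kt compZr compA.
by rewrite (ex_zero ku) comp0l scaler0.
Qed.

Lemma glued_heart_faithful s X : (s <= n)%N -> glued_heart e f s X ->
  (forall i, (i < s)%N -> is_trivial (hom (e i) X)) -> zero_object X.
Proof.
elim: s => [|s IHs] sn HX eX; first by apply: span_lt_zero (aisle_span HX.1).
apply: IHs => [||i si]; first exact: ltnW.
- by apply: glued_heart_killed => //; exact: eX.
- by apply: eX; exact: leqW.
Qed.

(** The intermediate extension of the recollement, that is the image of [e i -> f i]. Recording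
    kernel and cokernel together makes the notion self-dual. *)
Definition middle_image i (L : T) : Prop :=
  exists N Q (k : hom N (e i)) (a : hom (e i) L) (b : hom L (f i)) (q : hom (f i) Q),
    [/\ glued_heart e f i N, glued_heart e f i Q & glued_heart e f i.+1 L] /\
    [/\ ex k a, ex b q & b \oc a <> 0].

End SimpleObjects.

Lemma middle_image_op (K : fieldType) (T : dtri K) (e f : nat -> T) i L :
  middle_image e f i L -> @middle_image K (opposite T) f e i L.
Proof.
case=> N [Q [k [a [b [q [[NH QH LH] [ka bq ba]]]]]]]; exists Q, N, q, b, a, k.
have opE s X := @glued_heart_op K T e f s X.
by split; split=> //; exact: (proj2 (opE _ _)).
Qed.

Lemma middle_image_exists (K : fieldType) (T : dtri K) n (e f : nat -> T) i :
  dual_pair n e f -> (i < n)%N -> coaisle f n 0 (e i) -> aisle e n 0 (f i) ->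
  exists L, middle_image e f i L.
Proof.
move=> dp lin Ce Af; have [c [W [p [cp CW]]]] := dp_map dp lin.
have He : glued_heart e f i.+1 (e i).
  split; first exact: aisle_e.
  by apply: (coaisle_restrict dp) => //; exact: span_lt_e.
have Hf : glued_heart e f i.+1 (f i).
  split; last exact: coaisle_f.
  by apply: (aisle_restrict dp) => //; exact: (span_lt_f dp).
have [N [I [Q [k [u [m [q [[HN HI HQ] [ku mq mu]]]]]]]]] := glued_heart_image dp c lin He Hf.
have c0 := dual_map_neq0 dp lin cp CW.
have HI' := glued_heart_leq lin HI.
exists I, N, Q, k, u, m, q; split; split=> //; last by rewrite mu.
- apply: (glued_heart_kernel_e dp lin ku HN HI'.2).
  by move=> u0; apply: c0; rewrite -mu u0 comp0r.
(* The cokernel [Q] is the kernel of the dual map, so the previous argument applies in the opposite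
   category. *)
- have opE s X := @glued_heart_op K T e f s X.
  apply: (proj1 (opE i Q)).
  apply: (glued_heart_kernel_e (dual_pair_op dp) lin (k := q) (u := m) mq).
  + exact: (proj2 (opE _ _)).
  + exact: (proj2 (opE n I) HI').2.
  + by move=> m0; apply: c0; rewrite -mu m0 comp0l.
Qed.

Section SimpleHeart.

Variables (K : fieldType) (T : dtri K) (n : nat) (e f L : nat -> T).
Hypothesis dp : dual_pair n e f.
Hypothesis HL : forall i, (i < n)%N -> middle_image e f i (L i).
Implicit Types (X Y Z W : T) (i j s t : nat) (k l m : int).

Lemma simple_heart i : (i < n)%N -> glued_heart e f i.+1 (L i).
Proof. by move=> /HL[N [Q [k [a [b [q [[? ? ?] _]]]]]]]. Qed.

Lemma hom_span_simple i X s : (i < n)%N -> (s <= n)%N -> aisle e s 0 X ->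
  is_trivial (hom X (f i)) -> is_trivial (hom X (L i)).
Proof.
move=> lin sn AX Xf t; have [N [Q [k [a [b [q [[_ HQ _] [_ bq _]]]]]]]] := HL lin.
by apply: (heart_mono dp (ltnW lin) sn bq HQ.2 AX); exact: Xf.
Qed.

Lemma hom_e_simple i j : (i < n)%N -> (j < n)%N -> i != j -> is_trivial (hom (e i) (L j)).
Proof.
move=> lin ljn ij; apply: (hom_span_simple ljn lin (aisle_e e i)).
by apply: (dp_ef dp _ _ (l := 0)); rewrite // ij.
Qed.

(** The embedding of [L i] into [f i] sends both maps into the one-dimensional space
    [hom (e i) (f i)]. *)
Lemma simple_multiple i (a t : hom (e i) (L i)) : (i < n)%N -> a <> 0 ->
  exists x : K, t = x *: a.
Proof.
move=> lin a0; have [N [Q [k [_ [b [q [[_ HQ _] [_ bq _]]]]]]]] := HL lin.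
have binj (r : hom (e i) (L i)) : b \oc r = 0 -> r = 0.
  exact: (heart_mono dp (ltnW lin) lin bq HQ.2 (aisle_e e i)).
have [c [W [p [cp CW]]]] := dp_map dp lin.
have [x xE] := dual_map_spanning dp lin cp CW (b \oc a).
have [y yE] := dual_map_spanning dp lin cp CW (b \oc t).
have x0 : x != 0.
  by apply/eqP => x0; apply: a0; apply: binj; rewrite xE x0 scale0r.
exists (y / x); apply/subr0_eq/binj; rewrite compBr compZr xE yE scalerA mulfVK //.
exact: subrr.
Qed.

Lemma finite_length s X : (s <= n)%N -> glued_heart e f s X -> ecl (below L s) X.
Proof.
elim: s X => [|s IHs] X sn HX.
  by apply: ecl_zero; apply: span_lt_zero (aisle_span HX.1).
have Lsub Y : ecl (below L s) Y -> ecl (below L s.+1) Y.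
  by apply: ecl_sub => Z; exact: below_leq.
have spanX Y : glued_heart e f s.+1 Y -> gen (below e n) predT Y.
  by move=> HY; apply: span_lt_leq sn (aisle_span HY.1).
have [d] : fin_dim (hom (e s) X).
  by apply: (dp_fin dp); [exact: span_lt_e | exact: spanX].
rewrite -/(spanned _ d); elim: d X HX => [|d IHd] X HX spX.
  apply: Lsub; apply: IHs; first exact: ltnW.
  apply: (glued_heart_killed dp sn HX) => t; case: spX => v vP.
  by case: (vP t) => c ->; rewrite big_ord0.
have [eX | eX] := classic (is_trivial (hom (e s) X)).
  by apply: Lsub; apply: IHs; [exact: ltnW | exact: (glued_heart_killed dp sn HX)].
have [g g0] : exists g : hom (e s) X, g <> 0.
  by apply: NNPP => H; apply: eX => t; apply: NNPP => t0; apply: H; exists t.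
have [N [Q [nn [a [b [q [[HN HQ HLs] [na bq ba]]]]]]]] := HL sn.
have He : glued_heart e f s.+1 (e s).
  apply: (glued_heart_ext_closed _ _ _).2 na _ HLs; exact: glued_heart_leq HN.
have [M [I [C [k [u [m [c [[HM HI HC] [ku mc mu]]]]]]]]] := glued_heart_image dp g sn He HX.
have HI' := glued_heart_leq sn HI; have HX' := glued_heart_leq sn HX.
have u0 : u <> 0 by move=> u0; apply: g0; rewrite -mu u0 comp0r.
have {}HM := glued_heart_kernel_e dp sn ku HM HI'.2 u0.
have Ms := aisle_span HM.1.
have ak : a \oc k = 0.
  apply: (heart_mono dp (ltnW sn) (ltnW sn) bq HQ.2 HM.1).
  exact: (hom_span_f dp sn Ms).
have [w wu] := ex_liftr ku ak.
have [J [j jw]] := ex_cocone w.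
have na' : ex nn (w \oc u) by rewrite wu.
have [x [y [xy _ _]]] := ex_octa' ku na' jw.
have [z [yz _]] := ex_rot xy.
(* [J] is both the quotient of [N] by [M] and the kernel of [I -> L s]; each description gives one
   half of the claim. *)
have HJ : glued_heart e f s J.
  apply: (glued_heart_restrict dp (ltnW sn)); last first.
    apply: (gen_ext_closed _ _).2 yz (aisle_span HN.1) _.
    exact: (@gen_up _ _ _ predT).
  split.
    apply: (aisle_ext_closed _ _ _).2 yz _ _; first exact: aisle_leq (ltnW sn) _ HN.1.
    by apply: aisle_leq (ltnW sn) _ (aisle_up HM.1).
  have [r [rj _]] := ex_rot' jw; apply: (coaisle_ext_closed _ _ _).2 rj _ HI'.2.
  by apply: coaisle_leq sn _ (coaisle_dn HLs.2).
have EI : ecl (below L s.+1) I.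
  apply: (ecl_ext_closed _).2 jw (Lsub _ (IHs J (ltnW sn) HJ)) _.
  by apply: ecl_incl; exists s.
apply: ((ecl_ext_closed _).2 _ _ _ _ _ mc EI); apply: IHd HC _.
(* By right exactness [hom (e s) C] is a quotient of [hom (e s) X], and the nonzero [g] dies in
   it. *)
have [||d' [<-] //] := spanned_quotient (comp_linearr c) _ spX g0.
  move=> t; have [h [ch _]] := ex_rot mc.
  have [|r rE] := ex_liftl (t := t) ch; last by exists r.
  by apply: (hom_e_aisle dp) => //; have := aisle_up HI.1; rewrite add0r.
by rewrite -mu compA (ex_zero mc) comp0l.
Qed.

End SimpleHeart.

Section IrreducibleObjects.

Variables (K : fieldType) (T : dtri K) (n : nat) (e f L : nat -> T).
Hypothesis dp : dual_pair n e f.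
Hypothesis HL : forall i, (i < n)%N -> middle_image e f i (L i).
Variable Hp : T -> Prop.
Hypothesis HpE : forall X, Hp X <-> glued_heart e f n X.
Implicit Types (i j s t : nat) (k l m : int).

Local Notation HC := (@full_subcat K T Hp).

Lemma simple_epi i : (i < n)%N -> exists N (k : hom N (e i)) (a : hom (e i) (L i)),
  [/\ glued_heart e f i N, ex k a & a <> 0].
Proof.
move=> /HL[N [Q [k [a [b [q [[HN _ _] [ka _ ba]]]]]]]]; exists N, k, a; split=> //.
by move=> a0; apply: ba; rewrite a0 comp0r.
Qed.

Lemma glued_heart_e i : (i < n)%N -> glued_heart e f i.+1 (e i).
Proof.
move=> lin; have [N [k [a [HN ka _]]]] := simple_epi lin.
apply: ((glued_heart_ext_closed _ _ _).2 _ _ _ _ _ ka); last exact: (simple_heart HL).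
exact: glued_heart_leq HN.
Qed.

Lemma simple_nonzero i : (i < n)%N -> ~ zero_object (L i).
Proof.
move=> lin L0; have [N [k [a [_ _]]]] := simple_epi lin; apply.
by apply: zero_object_hom; right.
Qed.

Lemma irreducible_simple (X : HC) i : (i < n)%N -> sval X = L i -> irreducible_obj X.
Proof.
case: X => x hx lin /= xE; subst x; split.
  by move/heart_zeroE; exact: simple_nonzero.
move=> Y g gm; have [Z [h gh]] := heart_monoE dp HpE gm.
have [Y0 | Y0] := classic (zero_object Y); [by left | right].
have [j [lj [t t0]]] : exists j, (j < n)%N /\ exists t : hom (e j) (sval Y), t <> 0.
  apply: NNPP => H; apply: Y0; apply/heart_zeroE.
  apply: (glued_heart_faithful dp (leqnn n) (heart_objP HpE Y)) => j lj t.
  by apply: NNPP => t0; apply: H; exists j; split=> //; exists t.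
pose g' : @hom K T (sval Y) (L i) := g; pose h' : @hom K T (L i) (sval Z) := h.
have gt0 : g' \oc t <> 0.
  move=> gt0; apply: t0.
  apply: (heart_mono dp (leqnn n) (leqnn n) gh (heart_objP HpE Z).2 _ gt0).
  exact: aisle_leq lj (lexx _) (aisle_e e j).
have ij : j = i.
  by apply/eqP/negPn/negP => ji; apply: gt0; exact: (hom_e_simple dp HL lj lin ji).
subst j; have [N [k [a [HN ka a0]]]] := simple_epi lin.
have [x xE] := simple_multiple dp HL (a) lin gt0.
(* [a] is a multiple of [g' \oc t], so [h'] kills it; as [a] is an epimorphism, the cokernel of the
   subobject [Y] vanishes. *)
have h0 : h' = 0.
  apply: (heart_epi dp (ltnW lin) (leqnn n) ka HN.1 (heart_objP HpE Z).2).
  by rewrite xE compZr compA (ex_zero gh : h' \oc g' = 0) comp0l scaler0.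
apply/heart_isoE; apply: (ex_zeror gh); apply/zero_objectP.
apply: (heart_epi dp (leqnn n) (leqnn n) gh (heart_objP HpE Y).1 (heart_objP HpE Z).2).
by rewrite comp1m.
Qed.

(** The last factor attached in [ecl] is a quotient, and an epimorphism onto a nonzero object is
    nonzero. *)
Lemma simple_quotient s X : (s <= n)%N -> ecl (below L s) X -> ~ zero_object X ->
  exists2 j, (j < s)%N & exists g : hom X (L j), g <> 0.
Proof.
move=> sn [//|N M Z u v uv EN [j ljs jE] _]; subst Z; exists j => //; exists v => v0.
have ljn := leq_trans ljs sn; apply: (simple_nonzero ljn); apply/zero_objectP.
have AN : aisle e n 0 N.
  move: EN; apply: ecl_min; first exact: aisle_ext_closed.
  move=> Y [i lis <-]; have lin := leq_trans lis sn.
  by apply: aisle_leq lin _ (simple_heart HL lin).1.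
have CL : coaisle f n 0 (L j) by apply: coaisle_leq ljn _ (simple_heart HL ljn).2.
by apply: (heart_epi dp (leqnn n) (leqnn n) uv AN CL); rewrite comp1m.
Qed.

Lemma irreducible_isomorphic (X : HC) : irreducible_obj X ->
  exists2 i, (i < n)%N & isomorphic (sval X) (L i).
Proof.
move=> [X0 irrX]; have HX := heart_objP HpE X.
have [|i lin [g g0]] := simple_quotient (leqnn n) (finite_length dp HL (leqnn n) HX).
  by move/heart_zeroE.
exists i => //; have HLi := glued_heart_leq lin (simple_heart HL lin).
pose Y : HC := exist _ (L i) (proj2 (HpE _) HLi); pose g' : hom X Y := g.
have [N [I [Q [k [u [m [q [ku mq mu]]]]]]]] := heart_image dp HpE g'.
have m0 : ~ zero_object I.
  by move=> I0; apply: g0; rewrite -[g]/(g') -mu (zero_object_hom u) ?comp0r //; right.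
have u_iso : is_iso u.
  apply/heart_isoE; have [N0 | kI] := irrX _ k (heart_ex_monoP dp HpE ku).
    by apply: (ex_zerol ku); apply/heart_zeroE.
  case: m0; apply/zero_objectP; apply: (heart_ex_epi dp HpE ku); rewrite comp1m.
  case: kI => k' [_ kk'].
  by rewrite -[LHS]compm1 -kk' compA (ex_zero ku : u \oc k = 0) comp0l.
have [_ irrY] := @irreducible_simple Y i lin erefl.
have [I0 // | m_iso] := irrY _ m (heart_ex_monoP dp HpE mq).
by exists g; apply: (proj1 (heart_isoE g')); rewrite -mu; exact: is_iso_comp.
Qed.

Lemma simple_labels_inj i j : (i < n)%N -> (j < n)%N -> isomorphic (L i) (L j) -> i = j.
Proof.
move=> lin ljn ij; apply/eqP/negPn/negP => nij.
have [N [k [a [_ _ a0]]]] := simple_epi lin; apply: a0.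
exact: (is_trivial_isor (isomorphic_sym ij) (hom_e_simple dp HL lin ljn nij)).
Qed.

End IrreducibleObjects.

(** * Projective covers *)

Section ProjectiveCovers.

Variables (K : fieldType) (T : dtri K) (n : nat) (e f L : nat -> T).
Hypothesis dp : dual_pair n e f.
Hypothesis HL : forall i, (i < n)%N -> middle_image e f i (L i).
Implicit Types (X Y Z W P : T) (i j s t : nat) (k l m : int).

Definition ext_acyclic s P : Prop :=
  forall j l, (j < s)%N -> 0 < l -> is_trivial (hom P (dshift l (e j))).

Lemma ext_acyclic_aisle s P X : ext_acyclic s P -> aisle e s 1 X -> is_trivial (hom P X).
Proof.
move=> aP; apply: (@gen_min _ _ _ _ (fun X => is_trivial (hom P X))).
  split=> [Y Y0 t|A B C u v uv]; first by apply: zero_object_hom; right.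
  exact: trivial_exr uv.
by move=> Y l [j js <-] /= l1; apply: aP => //; rewrite -gtz0_ge1.
Qed.

Definition between i s X : Prop := exists2 j, (i < j < s)%N & e j = X.

(** The last two conditions say that [P] has top [L i]. They range over all labels below [n],
    including those not yet treated, so that the top never changes as [s] grows. *)
Definition cover_data i s P : Prop :=
  exists N (k : hom N P) (p : hom P (e i)),
    [/\ ex k p, ecl (between i s) N
      & (forall j, (j < n)%N -> j != i -> is_trivial (hom P (L j))) /\
        (forall (a : hom (e i) (L i)), a <> 0 ->
           forall t : hom P (L i), exists x : K, t = x *: (a \oc p))].

Lemma cover_data_init i : (i < n)%N -> cover_data i i.+1 (e i) /\ ext_acyclic i.+1 (e i).
Proof.
move=> lin; have acy : ext_acyclic i.+1 (e i).
  move=> j l ji l0; apply: (dp_ee dp) => //; first exact: leq_trans ji lin.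
  by move: ji; rewrite ltnS leq_eqVlt => /orP[/eqP -> | -> //]; rewrite eqxx (gt_eqF l0) orbT.
split=> //; have [O O0] := dtri_zero T.
exists O, 0, (idm (e i)); split=> //; first exact: ex_0id.
  exact: ecl_zero.
split=> [j ljn ji | a a0 t]; first by apply: (hom_e_simple dp HL); rewrite // eq_sym.
by have [x ->] := simple_multiple dp HL (t) lin a0; exists x; rewrite compm1.
Qed.

(* [P'] is the extension of [P] by [e s] with class [xi]. *)
Lemma cover_data_extend i s P (xi : hom P (up T (e s))) d : (i < s)%N -> (s < n)%N ->
  cover_data i s.+1 P -> ext_acyclic s P ->
  (forall l, 1 < l -> is_trivial (hom P (dshift l (e s)))) ->
  spanned (hom P (up T (e s))) d -> xi <> 0 ->
  exists P', [/\ cover_data i s.+1 P', ext_acyclic s P',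
    forall l, 1 < l -> is_trivial (hom P' (dshift l (e s)))
    & exists2 d', d = d'.+1 & spanned (hom P' (up T (e s))) d'].
Proof.
move=> ls sn [N [k [p [kp EN [PL PLi]]]]] aP aP' spP xi0.
have lin := ltn_trans ls sn.
have [P' [q qxi]] := ex_cocone xi; have [h [hq xih]] := ex_rot' qxi.
set E := dn T (up T (e s)) in h hq xih.
have iE : isomorphic (e s) E := isomorphic_sym (dnup (e s)).
have acyE j l : (j <= s)%N -> 0 < l -> is_trivial (hom E (dshift l (e j))).
  move=> js l0; apply: (is_trivial_isol iE); apply: (dp_ee dp) => //.
    exact: leq_ltn_trans js sn.
  by move: js; rewrite leq_eqVlt => /orP[/eqP -> | -> //]; rewrite eqxx (gt_eqF l0) orbT.
(* If [t] is nonzero on [E], it lifts through [t \oc h]; the lift is a retraction of [h], which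
   forces [xi = 0]. *)
have PLs : is_trivial (hom P' (L s)).
  move=> t; have PLs0 : is_trivial (hom P (L s)) by apply: PL => //; rewrite gtn_eqF.
  have [th0 | th0] := classic (t \oc h = 0).
    by have [u <-] := ex_liftr hq th0; rewrite (PLs0 u) comp0l.
  case: xi0; apply: dn_inj; have [N' [n' [a [HN' na a0]]]] := simple_epi HL sn.
  have [c [c' [c1 c2]]] := iE.
  have [x xE] := simple_multiple dp HL (t \oc h \oc c) sn a0.
  have x0 : x != 0.
    apply/eqP => x0; apply: th0; rewrite -[LHS]compm1 -c2 compA xE x0 scale0r.
    exact: comp0l.
  have nth : ex (c \oc n') (t \oc h).
    apply: (ex_iso (a := idm _) (b := c) (c := x *: idm _) _ _ _ _ _ na).
    - exact: is_iso_id.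
    - by exists c'.
    - by exists (x^-1 *: idm _); rewrite !compZl !compZr !scalerA mulVf // mulfV // scale1r comp1m.
    - by rewrite compm1.
    - by rewrite compZl comp1m xE.
  have [r [thr _]] := ex_rot nth; have [W [w tw]] := ex_cone t.
  have [u [v [_ uq _]]] := ex_octa hq thr tw.
  (* The obstruction to lifting maps [P] to the shift of [N'], the kernel of [e s -> L s]. It
     vanishes because [N'] is in the aisle of the first [s] objects, against which [P] is
     acyclic. *)
  have u0 : u = 0.
    apply: (ext_acyclic_aisle aP); have := aisle_up HN'.1; by rewrite add0r.
  have [y yE] : exists y, (t \oc h) \oc y = t.
    by apply: (ex_liftl thr); rewrite -uq u0 comp0l.
  have [z zE] := (scalar_end_iso iE (dp_end dp sn)).2 (y \oc h).
  (* [t \oc h] is nonzero and equal to its multiple by [z]. *)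
  have z1 : z = 1.
    apply/eqP; rewrite -subr_eq0; apply/negPn/negP => z1; apply: th0.
    rewrite -[LHS]scale1r -(mulVf z1) -scalerA scalerBl scale1r -{2}yE -(compA (t \oc h)) zE.
    by rewrite compZr compm1 subrr scaler0.
  by rewrite -[LHS]comp1m -(scale1r (idm E)) -z1 -zE -compA (ex_zero xih) comp0r.
have [N' [k' kpq]] := ex_cocone (p \oc q).
have [u [v [uv _ _]]] := ex_octa' hq kpq kp.
exists P'; split.
- exists N', k', (p \oc q); split=> //.
    apply: ((ecl_ext_closed _).2 _ _ _ _ _ uv _ EN).
    by apply: (ecl_iso iE); apply: ecl_incl; exists s; rewrite // ls leqnn.
  split=> [j ljn ji | a a0 t].
    have [-> // | js] := eqVneq j s.
    apply: (trivial_exl hq); last exact: PL.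
    apply: (is_trivial_isol iE); apply: (hom_e_simple dp HL) => //.
    by rewrite eq_sym.
  have [|r rE] := ex_liftr (t := t) hq.
    move: (t \oc h); apply: (is_trivial_isol iE); apply: (hom_e_simple dp HL) => //.
    by rewrite gtn_eqF.
  by have [x xE] := PLi a a0 r; exists x; rewrite compA -compZl -xE rE.
- move=> j l js l0; apply: (trivial_exl hq); last exact: aP.
  by apply: acyE => //; exact: ltnW.
- move=> l l1; apply: (trivial_exl hq); last exact: aP'.
  by apply: acyE => //; exact: lt_trans l1.
(* Precomposition with [q] is surjective since [E] has no map to [up (e s)], and it kills [xi]. *)
have [t||d' dE spd'] := spanned_quotient (comp_linearl (Z := up T (e s)) q) _ spP xi0.
- have [|r rE] := ex_liftr (t := t) hq; last by exists r.
  exact: (acyE s 1).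
- exact: ex_zero qxi.
- by exists d'.
Qed.

Lemma cover_data_complete i s P : (i < s)%N -> (s < n)%N ->
  cover_data i s.+1 P -> ext_acyclic s P ->
  (forall l, 1 < l -> is_trivial (hom P (dshift l (e s)))) ->
  fin_dim (hom P (up T (e s))) ->
  exists P', cover_data i s.+1 P' /\ ext_acyclic s.+1 P'.
Proof.
move=> ls sn cP aP aP' [d]; rewrite -/(spanned _ d).
elim/ltn_ind: d P cP aP aP' => d IHd P cP aP aP' spP.
have [P0 | P0] := classic (is_trivial (hom P (up T (e s)))).
  exists P; split=> // j l; rewrite ltnS leq_eqVlt => /orP[/eqP -> l0 | js l0]; last exact: aP.
  have [->//|l1] := eqVneq l 1; apply: aP'.
  by rewrite lt_neqAle eq_sym l1 -gtz0_ge1.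
have [xi xi0] : exists xi : hom P (up T (e s)), xi <> 0.
  by apply: NNPP => H; apply: P0 => t; apply: NNPP => t0; apply: H; exists t.
have [P' [cP' a1 a2 [d' dE spd']]] := cover_data_extend ls sn cP aP aP' spP xi0.
by apply: IHd cP' a1 a2 spd'; rewrite dE.
Qed.

Lemma cover_data_step i s P : (i < s)%N -> (s < n)%N ->
  coaisle f n 0 (e s) -> aisle e n 0 (f s) ->
  cover_data i s P -> ext_acyclic s P ->
  exists P', cover_data i s.+1 P' /\ ext_acyclic s.+1 P'.
Proof.
move=> ls sn Ce Af [N [k [p [kp EN PL]]]] aP.
have lin := ltn_trans ls sn.
have CP : span_lt e s P.
  apply: ((gen_ext_closed _ _).2 _ _ _ _ _ kp); last exact: span_lt_e.
  apply: ecl_min EN; first exact: gen_ext_closed.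
  by move=> Y [j /andP[_ js] <-]; exact: span_lt_e.
apply: (cover_data_complete (P := P) ls sn _ aP).
- exists N, k, p; split=> //; apply: ecl_sub EN => Y [j /andP[ij js] <-].
  by exists j; rewrite // ij ltnW.
(* [e s] is an extension of [f s] and [dn W]. No shift of [f s] receives a map from [P], and [dn W]
   shifted by [l > 1] lies in the aisle at level 1, because [W] is in the aisle when [f s] is. *)
- move=> l l1; have [c [W [w [cw CW]]]] := dp_map dp sn.
  have [w' [ww' _]] := ex_rot cw.
  have AW : aisle e s 0 W.
    apply: (aisle_restrict dp (ltnW sn)) => //.
    apply: ((aisle_ext_closed _ _ _).2 _ _ _ _ _ ww' Af).
    by apply: (aisle_leq sn _ (aisle_up (aisle_e e s))).
  have [h [hc _]] := ex_rot' cw; have [h' [c' hc']] := ex_dshift l hc.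
  apply: (trivial_exr hc').
    apply: (ext_acyclic_aisle aP); apply: gen_shift (aisle_dn AW) => j /= j0.
    by rewrite -[1]addr0 -(subrr 1) addrA lerD // -lezD1.
  apply: (gen_orthogonalP (e_orthogonal_f dp sn) CP).
  exact: (@gen_dshift _ _ _ predT).
- apply: (dp_fin dp); first exact: span_lt_leq (ltnW sn) CP.
  by apply: (@gen_up _ _ _ predT) => //; exact: span_lt_e.
Qed.

Lemma cover_data_exists i : (i < n)%N ->
  (forall j, (j < n)%N -> coaisle f n 0 (e j) /\ aisle e n 0 (f j)) ->
  exists P, cover_data i n P /\ ext_acyclic n P.
Proof.
move=> lin hef; suff H s : (i < s <= n)%N -> exists P, cover_data i s P /\ ext_acyclic s P.
  by apply: H; rewrite lin leqnn.
elim: s => [//|s IHs]; rewrite ltnS leq_eqVlt => /andP[/orP[/eqP <- _ | ls sn]].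
  by exists (e i); exact: cover_data_init.
have [|P [cP aP]] := IHs; first by rewrite ls ltnW.
by have [Ce Af] := hef s sn; exact: cover_data_step cP aP.
Qed.

End ProjectiveCovers.

(** * The highest weight structure, up to duality *)

Section HeartCovers.

Variables (K : fieldType) (T : dtri K) (n : nat) (e f L : nat -> T).
Hypothesis dp : dual_pair n e f.
Hypothesis HL : forall i, (i < n)%N -> middle_image e f i (L i).
Hypothesis hef : forall i, (i < n)%N -> coaisle f n 0 (e i) /\ aisle e n 0 (f i).
Variable Hp : T -> Prop.
Hypothesis HpE : forall X, Hp X <-> glued_heart e f n X.
Implicit Types (i j s t : nat) (k l m : int).

Local Notation HC := (@full_subcat K T Hp).

Lemma heart_standard i (X D : HC) : (i < n)%N -> sval X = L i -> sval D = e i ->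
  exists (N : HC) (k : hom N D) (p : hom D X), heart_ex k p /\ ecl (below L i) (sval N).
Proof.
case: X D => x hx [d hd] lin /= xE dE; subst x d.
have [N [k [a [HN ka _]]]] := simple_epi HL lin.
exists (exist _ N (proj2 (HpE N) (glued_heart_leq (ltnW lin) HN))), k, a; split=> //.
exact: (finite_length dp HL (ltnW lin) HN).
Qed.

Lemma acyclic_projective (P : HC) : ext_acyclic e n (sval P) -> projective_obj P.
Proof.
move=> aP X Y g ge h; have [N [k kg]] := heart_epiE dp HpE ge.
have [r [gr _]] := ex_rot (kg : @ex K T _ _ _ k g).
have [|u uE] := ex_liftl (t := (h : @hom K T (sval P) (sval Y))) gr; last by exists u.
apply: (ext_acyclic_aisle aP); have := aisle_up (heart_objP HpE N).1.
by rewrite add0r.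
Qed.

Lemma heart_projective_cover i (X D : HC) : (i < n)%N -> sval X = L i -> sval D = e i ->
  exists (P : HC) (c : hom P X) (N : HC) (k : hom N P) (p : hom P D),
    [/\ projective_cover c, heart_ex k p, ecl (between e i n) (sval N) & projective_obj P].
Proof.
case: X D => x hx [d hd] lin /= xE dE; subst x d.
have [P [[N [k [p [kp EN [PL PLi]]]]] aP]] := cover_data_exists dp HL lin hef.
have He j : (j < n)%N -> glued_heart e f n (e j).
  by move=> ljn; apply: (glued_heart_leq ljn); exact: (glued_heart_e HL ljn).
have HN : glued_heart e f n N.
  apply: ecl_min EN; first exact: glued_heart_ext_closed.
  by move=> Y [j /andP[_ ljn] <-]; exact: He.
have HP : glued_heart e f n P.
  by apply: ((glued_heart_ext_closed _ _ _).2 _ _ _ _ _ kp) => //; exact: He.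
have [M [r [a [HM ra a0]]]] := simple_epi HL lin.
pose P' : HC := exist _ P (proj2 (HpE P) HP).
pose N' : HC := exist _ N (proj2 (HpE N) HN).
pose M' : HC := exist _ M (proj2 (HpE M) (glued_heart_leq (ltnW lin) HM)).
pose X : HC := exist _ (L i) hx; pose D : HC := exist _ (e i) hd.
pose p' : hom P' D := p; pose a' : hom D X := a; pose k' : hom N' P' := k.
have pe : epi p' := heart_ex_epiP dp HpE (kp : heart_ex k' p').
have ae : epi a' := heart_ex_epiP dp HpE (ra : heart_ex (r : hom M' D) a').
have projP : projective_obj P' by exact: acyclic_projective.
exists P', (a' \oc p'), N', k', p'; split=> //; split=> //.
  by move=> W s t st; apply: ae; apply: pe; rewrite -!compA.
move=> Z u ue.
have [M2 [I [Q [k2 [u2 [m [q [ku mq mu]]]]]]]] := heart_image dp HpE u.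
have [Q0 | Q0] := classic (zero_object Q).
  have mI : is_iso m.
    by apply/heart_isoE; apply: (ex_zeror mq); apply/heart_zeroE.
  have u2e := heart_ex_epiP dp HpE ku.
  case: mI => m' [m1 m2] W s t; rewrite -mu !compA => /u2e sm.
  by rewrite -[s]compm1 -m2 compA sm -compA m2 compm1.
(* A nonzero cokernel of [u] would have a simple quotient. By the top conditions on [P] it is [L i],
   reached by a nonzero multiple of [a \oc p]; so [a \oc p] kills [u], although their composite is
   an epimorphism onto a nonzero object. *)
have [|j ljn [g g0]] := simple_quotient dp HL (leqnn n)
    (finite_length dp HL (leqnn n) (heart_objP HpE Q)).
  by move/heart_zeroE.
case: g0; pose q' : @hom K T P (sval Q) := q.
apply: (heart_epi dp (leqnn n) (leqnn n) mq (heart_objP HpE I).1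
  (glued_heart_leq ljn (simple_heart HL ljn)).2).
have [ji | ji] := eqVneq j i; last exact: (PL j ljn ji (g \oc q')).
subst j; have [x xE] := PLi a a0 (g \oc q').
have [x0 | x0] := eqVneq x 0; first by rewrite [LHS]xE x0 scale0r.
pose u' : @hom K T (sval Z) P := u.
have qu : q' \oc u' = 0.
  have : q \oc u = 0; last by [].
  by rewrite -mu compA (ex_zero mq : q \oc m = 0) comp0l.
have apu0 : a' \oc p' \oc u = 0.
  have : (a \oc p) \oc u' = 0; last by [].
  rewrite -[LHS]scale1r -(mulVf x0) -scalerA -compZl -xE -compA qu.
  by rewrite comp0r scaler0.
have X0 : idm X = 0.
  by apply: ue; rewrite apu0 !comp0r.
by case: (simple_nonzero HL lin); apply/zero_objectP.
Qed.

Lemma heart_generator : additive_cat T -> exists P : HC, projective_obj P /\ generator P.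
Proof.
move=> addT.
have cov (i : 'I_n) : exists Pp : {P : HC & @hom K T (sval P) (e i)},
    projective_obj (projT1 Pp) /\ exists N (k : hom N (sval (projT1 Pp))),
      glued_heart e f n N /\ ex k (projT2 Pp).
  have lin := ltn_ord i.
  have HX := proj2 (HpE _) (glued_heart_leq lin (simple_heart HL lin)).
  have HD := proj2 (HpE _) (glued_heart_leq lin (glued_heart_e HL lin)).
  have [P [c [N [k [p [_ kp _ projP]]]]]] :=
    heart_projective_cover (X := exist _ _ HX) (D := exist _ _ HD) lin erefl erefl.
  exists (existT _ P p); split=> //; exists (sval N), k; split=> //.
  exact: (heart_objP HpE).
pose Pp (i : 'I_n) := proj1_sig (constructive_indefinite_description _ (cov i)).
have PpP (i : 'I_n) : projective_obj (projT1 (Pp i)) /\ exists N (k : hom N (sval (projT1 (Pp i)))),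
      glued_heart e f n N /\ ex k (projT2 (Pp i)).
  by rewrite /Pp; case: constructive_indefinite_description.
have [H [inj [prj [pi1 _ sumE]]]] := heart_additive HpE addT (fun i : 'I_n => projT1 (Pp i)).
exists H; split.
  move=> X Y g ge h.
  have lift (i : 'I_n) : exists r : hom (projT1 (Pp i)) X, g \oc r = h \oc inj i.
    by have [projP _] := PpP i; exact: projP.
  pose r (i : 'I_n) := proj1_sig (constructive_indefinite_description _ (lift i)).
  have rE (i : 'I_n) : g \oc r i = h \oc inj i.
    by rewrite /r; case: constructive_indefinite_description.
  exists (\sum_i (r i \oc prj i)); rewrite comp_sumr -[RHS]compm1 -sumE comp_sumr.
  by apply: eq_bigr => i _; rewrite !compA rE.
move=> X Y g h gh; apply: NNPP => ghn; pose d := g - h.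
have dH (x : hom H X) : d \oc x = 0 by rewrite compBl gh subrr.
have d0 : d <> 0 by move/subr0_eq.
have [N [I [Q [k [u [m [q [ku mq mu]]]]]]]] := heart_image dp HpE d.
(* The nonzero image of [d] receives a nonzero map from some [e j]. Pulled back to the projective
   cover it lifts through [u] to [X], where [d] annihilates every map from [H]. *)
have [j [ljn [t t0]]] : exists j, (j < n)%N /\ exists t : hom (e j) (sval I), t <> 0.
  apply: NNPP => H0; apply: d0; rewrite -mu (zero_object_hom u) ?comp0r //; right.
  apply/heart_zeroE; apply: (glued_heart_faithful dp (leqnn n) (heart_objP HpE I)) => j lj t.
  by apply: NNPP => t0; apply: H0; exists j; split=> //; exists t.
have [projP [N' [k' [HN' kp]]]] := PpP (Ordinal ljn).
pose p := projT2 (Pp (Ordinal ljn)); pose P := projT1 (Pp (Ordinal ljn)).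
have tp0 : t \oc p <> 0.
  by move=> tp0; apply: t0; apply: (heart_epi dp (leqnn n) (leqnn n) kp HN'.1 (heart_objP HpE I).2).
have [s sE] := projP _ _ u (heart_ex_epiP dp HpE ku) (t \oc p : hom P I).
apply: tp0; apply: (heart_ex_mono dp HpE mq (t := (t \oc p : hom P I))).
rewrite -sE compA mu -[s]compm1 -(pi1 (Ordinal ljn)) compA.
by rewrite compA dH comp0l.
Qed.

End HeartCovers.

(** * Left mutations *)

Section ShiftMap.

Variables (K : fieldType) (D : tricat K).
Implicit Types (X Y Z : D) (l : int).

Lemma iter_fmap_linear (G : klinfun D D) k X Y : linear (@iter_fmap K D G k X Y).
Proof. by elim: k => //= k IHk a f g; rewrite IHk fmap_linear. Qed.

Lemma iter_fmap_comp (G : klinfun D D) k X Y Z (g : hom Y Z) (f : hom X Y) :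
  iter_fmap G k (g \oc f) = iter_fmap G k g \oc iter_fmap G k f.
Proof. by elim: k => //= k IHk; rewrite IHk fmap_comp. Qed.

Lemma iter_fmap_id (G : klinfun D D) k X : iter_fmap G k (idm X) = idm (iter k G X).
Proof. by elim: k => //= k ->; rewrite fmap_id. Qed.

Lemma shift_map_linear l X Y : linear (@shift_map K D l X Y).
Proof. by case: l => k; exact: iter_fmap_linear. Qed.

Lemma shift_map_comp l X Y Z (g : hom Y Z) (f : hom X Y) :
  shift_map l (g \oc f) = shift_map l g \oc shift_map l f.
Proof. by case: l => k; exact: iter_fmap_comp. Qed.

Lemma shift_map_id l X : shift_map l (idm X) = idm (shift l X).
Proof. by case: l => k; exact: iter_fmap_id. Qed.

Lemma shift_map0 l X Y : shift_map l (0 : hom X Y) = 0.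
Proof.
by have := @shift_map_linear l X Y (-1) 0 0; rewrite scaler0 addr0 scaleN1r addNr.
Qed.

Lemma shift_mapB l X Y (f g : hom X Y) : shift_map l (f - g) = shift_map l f - shift_map l g.
Proof. by rewrite addrC -scaleN1r shift_map_linear scaleN1r addrC. Qed.

Lemma shift_mapZ l X Y a (f : hom X Y) : shift_map l (a *: f) = a *: shift_map l f.
Proof. by have := @shift_map_linear l X Y a f 0; rewrite shift_map0 !addr0. Qed.

Lemma shift_map_sum l X Y (J : Type) (s : seq J) (f : J -> hom X Y) :
  shift_map l (\sum_(j <- s) f j) = \sum_(j <- s) shift_map l (f j).
Proof.
apply: (big_morph (fun g : hom X Y => shift_map l g)) => [g h|]; last exact: shift_map0.
by have := @shift_map_linear l X Y 1 g h; rewrite !scale1r.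
Qed.

Lemma shift_map_inj l X Y (f : hom X Y) : shift_map l f = 0 -> f = 0.
Proof.
have inj (G : klinfun D D) : (forall X Y (f : hom X Y), fmap G f = 0 -> f = 0) ->
    forall k, iter_fmap G k f = 0 -> f = 0.
  by move=> Ginj; elim=> //= k IHk /Ginj.
by case: l => k; apply: inj => ? ? ?; [exact: sh1_inj | exact: shm1_inj].
Qed.

Lemma shift_map_full l X Y (g : hom (shift l X) (shift l Y)) : exists f, g = shift_map l f.
Proof.
have full (G : klinfun D D) :
    (forall X Y (g : hom (G X) (G Y)), exists f, g = fmap G f) ->
    forall k (g : hom (iter k G X) (iter k G Y)), exists f, g = iter_fmap G k f.
  move=> Gf; elim=> [h|k IHk h] /=; first by exists h.
  by have [h' ->] := Gf _ _ h; have [f ->] := IHk h'; exists f.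
by case: l g => k; apply: full => ? ?; [exact: sh1_full | exact: shm1_full].
Qed.

End ShiftMap.

(** * Splitting of tensor objects, and orthogonality of the mutation *)

Section Tensor.

Variables (K : fieldType) (D : tricat K).
Local Notation T := (dtri_of D).

Variables (E M' H M : D) (i : forall l, Hombul E M' l -> Hombul E H l)
  (ev : hom H M') (g : hom M' M).
Arguments i : clear implicits.
Hypothesis sE : @scalar_end K T E.
Hypothesis oE : forall l : int, l != 0 -> is_trivial (hom E (shift l E)).
Hypothesis fdV : total_fin_dim (Hombul E M').
Hypothesis tH : is_tensor i.
Hypothesis evK : forall l v, shift_map l ev \oc i l v = v.
Hypothesis evg : exact_pair ev g.

Implicit Types (l : int) (a : nat).

Local Notation V := (Hombul E M').

(* A linear form on [V l] induces, by the universal property of [H], a morphism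
   from [H] to a shift of [E]; dual bases of the [V l] thus split [H]. *)
Lemma tensor_decomposition : exists (s : seq (int * nat))
    (A : forall j : int * nat, hom (shift (- j.1) E) H)
    (B : forall j : int * nat, hom H (shift (- j.1) E))
    (io : forall l, hom E (shift l (shift (- l) E))),
  [/\ uniq s, forall l, is_iso (io l) & forall j, exists v, shift_map j.1 (A j) \oc io j.1 = i j.1 v] /\
  [/\ forall j, j \in s -> B j \oc A j = idm _,
      forall j j', j \in s -> j' \in s -> j <> j' -> B j' \oc A j = 0
    & \sum_(j <- s) (A j \oc B j) = idm H].
Proof.
have [iL iU] := tH; have [fd [N0 trN0]] := fdV.
have i0 l : i l 0 = 0 by have := iL l (-1) 0 0; rewrite scaler0 addr0 scaleN1r addNr.
(* Bases are indexed by [nat], with value 0 beyond the dimension, so that one index type [int * nat]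
   serves all degrees. *)
have basis l : exists d : nat * (nat -> V l) * (nat -> V l -> K),
    [/\ forall a b u v, d.2 a (b *: u + v) = b * d.2 a u + d.2 a v,
      forall a a', (a < d.1.1)%N -> (a' < d.1.1)%N -> d.2 a (d.1.2 a') = (a == a')%:R
    & forall v, v = \sum_(a <- index_iota 0 d.1.1) d.2 a v *: d.1.2 a].
  have [N [b [x [xL xb vE]]]] := fin_dim_dual_basis (fd l).
  exists (N, fun a => if insub a is Some a' then b a' else 0,
          fun a => if insub a is Some a' then x a' else fun=> 0).
  split=> /= [a c u v | a a' aN a'N | v].
  - by case: insub => [a'|]; [exact: xL | rewrite mulr0 addr0].
  - by rewrite !insubT /= xb.
  - rewrite big_mkord [LHS]vE; apply: eq_bigr => a _.
    by rewrite valK.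
pose d l := proj1_sig (constructive_indefinite_description _ (basis l)).
have dP l : [/\ forall a b u v, (d l).2 a (b *: u + v) = b * (d l).2 a u + (d l).2 a v,
      forall a a', (a < (d l).1.1)%N -> (a' < (d l).1.1)%N -> (d l).2 a ((d l).1.2 a') = (a == a')%:R
    & forall v, v = \sum_(a <- index_iota 0 (d l).1.1) (d l).2 a v *: (d l).1.2 a].
  by rewrite /d; case: constructive_indefinite_description.
pose N l := (d l).1.1; pose b l := (d l).1.2; pose x l := (d l).2.
(* The universal property wants a family in all degrees, hence a map for each pair; off the diagonal
   it is later multiplied by 0 and its value is arbitrary. *)
have io_ex l l' : exists o : hom E (shift l (shift (- l') E)), l = l' -> is_iso o.
  have [-> | ll'] := eqVneq l l'; last by exists 0 => e; rewrite e eqxx in ll'.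
  have := @dshiftD K T l' (- l') E; rewrite subrr => /isomorphic_sym[o oI].
  by exists o.
pose io l l' := proj1_sig (constructive_indefinite_description _ (io_ex l l')).
have ioP l : is_iso (io l l).
  by rewrite /io; case: constructive_indefinite_description => o /= /(_ erefl).
have B_ex (j : int * nat) : exists u : hom H (shift (- j.1) E), forall l v,
    shift_map l u \oc i l v = ((l == j.1)%:R * x l j.2 v) *: io l j.1.
  have [|u [uE _]] := iU (shift (- j.1) E) (fun l v => ((l == j.1)%:R * x l j.2 v) *: io l j.1).
    move=> l c u v; have [xL _ _] := dP l; rewrite /x xL scalerA -scalerDl.
    by congr (_ *: _); rewrite mulrDr !mulrA (mulrC c).
  by exists u.
pose B j := proj1_sig (constructive_indefinite_description _ (B_ex j)).
have BP j l v : shift_map l (B j) \oc i l v = ((l == j.1)%:R * x l j.2 v) *: io l j.1.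
  by rewrite /B; case: constructive_indefinite_description.
have A_ex (j : int * nat) : exists u : hom (shift (- j.1) E) H,
    shift_map j.1 u \oc io j.1 j.1 = i j.1 (b j.1 j.2).
  have [o' [o1 o2]] := ioP j.1.
  have [u uE] := shift_map_full (i j.1 (b j.1 j.2) \oc o').
  by exists u; rewrite -uE -compA o1 compm1.
pose A j := proj1_sig (constructive_indefinite_description _ (A_ex j)).
have AP j : shift_map j.1 (A j) \oc io j.1 j.1 = i j.1 (b j.1 j.2).
  by rewrite /A; case: constructive_indefinite_description.
(* The degrees of absolute value at most [N0]; since [Negz k] is -(k+1), the negative list is one
   shorter. *)
pose ls := [seq Posz k | k <- iota 0 N0.+1] ++ [seq Negz k | k <- iota 0 N0].
have ls_uniq : uniq ls.
  rewrite cat_uniq !map_inj_uniq ?iota_uniq //=; try by move=> ? ? [].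
  by rewrite andbT; apply/hasPn => l /mapP[k _ ->]; apply/mapP => -[].
have ls_mem l : ~ is_trivial (V l) -> l \in ls.
  move=> Vl; have lN : (absz l <= N0)%N.
    by rewrite leqNgt; apply/negP => /trN0.
  rewrite mem_cat; case: l lN {Vl} => k kN; apply/orP; [left | right].
    by apply/mapP; exists k => //; rewrite mem_iota.
  by apply/mapP; exists k => //; rewrite mem_iota.
pose s := [seq (l, a) | l <- ls, a <- index_iota 0 (N l)].
have s_uniq : uniq s.
  apply: allpairs_uniq_dep => // [l _|]; first exact: iota_uniq.
  by move=> [l a] [l' a'] _ _ /= [-> ->].
have s_mem j : j \in s -> (j.2 < N j.1)%N.
  by case/allpairsPdep => l [a [_ + ->]]; rewrite mem_index_iota.
have BA j j' : j.1 = j'.1 -> (j.2 < N j.1)%N -> (j'.2 < N j.1)%N ->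
    shift_map j.1 (B j' \oc A j) \oc io j.1 j.1 = (j'.2 == j.2)%:R *: io j.1 j'.1.
  case: j j' => l a [l' a'] /= <- al a'l; have Al := AP (l, a); have Bl := BP (l, a') l (b l a).
  rewrite /= in Al Bl; rewrite shift_map_comp -compA Al; apply: (etrans Bl).
  by rewrite eqxx mul1r /x /b; have [_ -> //] := dP l.
exists s, A, B, (fun l => io l l); split; split=> //.
- by move=> j; exists (b j.1 j.2); exact: AP.
- move=> j js; have jN := s_mem j js; apply/subr0_eq/(@shift_map_inj _ _ j.1).
  have [o' [_ o2]] := ioP j.1; rewrite -[LHS]compm1 -o2 compA shift_mapB compBl BA //.
  by rewrite eqxx scale1r shift_map_id comp1m subrr comp0l.
- move=> j j' js j's jj'; have jN := s_mem j js; have j'N := s_mem j' j's.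
  have [e1 | n1] := eqVneq j.1 j'.1; last first.
    have : is_trivial (@hom K T (@dshift K T (- j.1) E) (@dshift K T (- j'.1) E)).
      by apply/trivial_dshift2; apply: oE; rewrite opprK addrC subr_eq0.
    exact.
  apply/(@shift_map_inj _ _ j.1); have [o' [_ o2]] := ioP j.1.
  rewrite -[LHS]compm1 -o2 compA BA // ?e1 // (_ : (j'.2 == j.2) = false) ?scale0r ?comp0l //.
  by apply/eqP => e2; apply: jj'; case: j j' e1 e2 {js j's jN j'N o' o2} => ? ? [? ?] /= -> ->.
(* By uniqueness in the universal property, the sum is the identity as soon as it fixes every
   [i l v]. *)
have [u [_ uU]] := iU H i iL; rewrite -(uU (\sum_(j <- s) _)); last first.
  move=> l v; rewrite shift_map_sum comp_suml big_allpairs_dep /=.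
  have term l' a : shift_map l (A (l', a) \oc B (l', a)) \oc i l v =
      ((l == l')%:R * x l a v) *: (shift_map l (A (l', a)) \oc io l l').
    by rewrite shift_map_comp -compA BP compZr.
  have [Vl | Vl] := classic (is_trivial (V l)).
    rewrite (Vl v) i0.
    by rewrite big1 // => ? _; rewrite big1 // => ? _; rewrite comp0r.
  rewrite (bigD1_seq l) ?ls_mem //= [X in _ + X]big1 ?addr0; last first.
    move=> l' l'l; rewrite big1 // => a _; rewrite term eq_sym (negPf l'l) mul0r.
    by rewrite scale0r.
  have [xL _ vE] := dP l; rewrite [in RHS](vE v).
  rewrite (big_morph (i l) (id1 := 0) (op1 := +%R)) //; last first.
    by move=> u1 u2; have := iL l 1 u1 u2; rewrite !scale1r.
  apply: eq_bigr => a _; rewrite term eqxx mul1r (AP (l, a)).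
  by have := iL l (x l a v) (b l a) 0; rewrite i0 !addr0.
by apply: uU => l v; rewrite shift_map_id comp1m.
Qed.

Lemma tensor_gen : @gen K T (eq E) predT H.
Proof.
have [s [A [B [io [[us _ _] [BA BA0 sumE]]]]]] := tensor_decomposition.
apply: (@retract_ext_closed K T _ _ s H _ A B (gen_ext_closed _ _) us _ BA BA0 sumE).
by move=> j _; exact: (@gen_dshift K T).
Qed.

(** Composition with [ev] is bijective on maps from every shift of [E], so the long exact sequence
    leaves nothing for the cone. *)
Lemma left_mutation_orth l : is_trivial (hom E (shift l M)).
Proof.
have [s [A [B [io [[us ioI AE] [BA BA0 sumE]]]]]] := tensor_decomposition.
have [iL _] := tH.
have evinj l' (y : hom (shift l' E) H) : ev \oc y = 0 -> y = 0.
  move: y; rewrite -[l']opprK; move: (- l') => {}l' y evy.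
  (* These maps are determined by their composite with [ev]. They form a subspace, which contains
     everything because the maps [A j] of the decomposition come from [i]. *)
  pose S (z : hom E (shift l' H)) := z = i l' (shift_map l' ev \oc z).
  have Slin c u v : S u -> S v -> S (c *: u + v).
    by move=> Su Sv; rewrite /S {1}Su {1}Sv compDr compZr iL.
  have S0 : S 0.
    by rewrite /S comp0r; have := iL l' (-1) 0 0; rewrite scaler0 addr0 scaleN1r addNr.
  have [o' [o1 o2]] := ioI l'.
  have Sy : S (shift_map l' y \oc io l').
    have -> : y = \sum_(j <- s) (A j \oc (B j \oc y)).
      by rewrite -[LHS]comp1m -sumE comp_suml; apply: eq_bigr => j _; rewrite compA.
    rewrite shift_map_sum comp_suml; elim: s {us BA BA0 sumE} => [|j s IHs]; first by rewrite big_nil.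
    rewrite big_cons -[X in X + _]scale1r; apply: (Slin) => //.
    have [lj | lj] := eqVneq l' j.1; last first.
      rewrite (_ : B j \oc y = 0) ?comp0r ?shift_map0 ?comp0l //.
      have : is_trivial (@hom K T (@dshift K T (- l') E) (@dshift K T (- j.1) E)).
        by apply/trivial_dshift2; apply: oE; rewrite opprK addrC subr_eq0.
      exact.
    have [v vE] := AE j; move: (A j) v vE (B j \oc y); rewrite -lj => Aj v vE By.
    have [_ /(_ By)[c ->]] := @scalar_end_dshift K T (- l') E sE.
    rewrite compZr compm1 shift_mapZ compZl -[_ *: _]addr0; apply: (Slin) => //.
    by rewrite [shift_map _ _ \oc _]vE /S evK.
  have z0 : shift_map l' ev \oc (shift_map l' y \oc io l') = 0.
    by rewrite compA -shift_map_comp evy shift_map0 comp0l.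
  rewrite /S comp0r in S0; rewrite /S z0 -S0 in Sy.
  by apply: (@shift_map_inj _ _ l'); rewrite -[LHS]compm1 -o2 compA Sy comp0l.
have evsurj l' (r : hom (shift l' E) M') : exists r', r = ev \oc r'.
  move: r; rewrite -[l']opprK; move: (- l') => {}l' r.
  have [o' [o1 o2]] := ioI l'.
  have [r' r'E] := shift_map_full (i l' (shift_map l' r \oc io l') \oc o').
  exists r'; apply/subr0_eq/(@shift_map_inj _ _ l').
  rewrite -[LHS]compm1 -o2 compA shift_mapB compBl shift_map_comp -r'E -!compA o1 compm1.
  by rewrite evK subrr comp0l.
apply: (proj1 (@trivial_dshift K T (- l) E (shift l M))).
apply: (is_trivial_isor (isomorphic_sym (@dshiftD K T (- l) l M))).
rewrite addNr => t; have [h [gh hev]] := @ex_rot K T _ _ _ _ _ evg.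
have ht0 : h \oc (t : hom (shift (- l) E) M) = 0.
  have [c [c' [c1 c2]]] := @updn K T (shift (- l) E).
  have [y yE] := sh1_full ((h \oc (t : hom (shift (- l) E) M)) \oc c).
  have [d [d' [d1 d2]]] := @dn_dshift K T (- l) E.
  have y0 : y \oc d' = 0.
    apply: (evinj (- l - 1)); rewrite compA (_ : ev \oc y = 0) ?comp0l //.
    apply: sh1_inj; rewrite fmap_comp -yE !compA (ex_zero hev : fmap (sh1 D) ev \oc h = 0).
    by rewrite !comp0l.
  rewrite -[LHS]compm1 -c2 compA yE -[y]compm1 -d1 compA y0.
  by rewrite comp0l fmap0 comp0l.
have [r <-] := @ex_liftl K T _ _ _ _ _ _ _ gh ht0.
have [r' ->] := evsurj _ r.
by rewrite compA (@ex_zero K T _ _ _ _ _ evg : g \oc ev = 0) comp0l.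
Qed.

End Tensor.

(** * Finite-dimensionality of morphism spaces on the span *)

Section FiniteDimension.

Variables (K : fieldType) (T : dtri K).
Implicit Types (X Y Z W : T) (k l : int).

Lemma fin_dim_trivial (V : lmodType K) : is_trivial V -> fin_dim V.
Proof. by move=> V0; exists 0%N, (fun _ => 0) => v; exists (fun _ => 0); rewrite big_ord0. Qed.

Lemma fin_dim_isor X Y Y' : isomorphic Y Y' -> fin_dim (hom X Y) -> fin_dim (hom X Y').
Proof.
case=> u [v [_ uv]]; apply: (fin_dim_image (f := fun t : hom X Y => u \oc t)).
  exact: comp_linearr.
by move=> w; exists (v \oc w); rewrite compA uv comp1m.
Qed.

Lemma fin_dim_dshift k X Y : fin_dim (hom X Y) -> fin_dim (hom (dshift k X) (dshift k Y)).
Proof.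
move=> fd; case: k => k; rewrite /dshift; last move: k.+1 => {}k; elim: k => //= k.
  apply: (fin_dim_image (f := @fmap K T T (up T) _ _)); first exact: fmap_linear.
  exact: up_full.
apply: (fin_dim_image (f := @fmap K T T (dn T) _ _)); first exact: fmap_linear.
exact: dn_full.
Qed.

Lemma fin_dim_exr W X Y Z (f : hom X Y) (g : hom Y Z) : ex f g ->
  fin_dim (hom W X) -> fin_dim (hom W Z) -> fin_dim (hom W Y).
Proof.
move=> fg; apply: fin_dim_exact (comp_linearr f) (comp_linearr g) _ => v gv.
by have [u <-] := ex_liftl fg gv; exists u.
Qed.

Lemma fin_dim_exl W X Y Z (f : hom X Y) (g : hom Y Z) : ex f g ->
  fin_dim (hom X W) -> fin_dim (hom Z W) -> fin_dim (hom Y W).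
Proof.
move=> fg fX fZ; apply: fin_dim_exact (comp_linearl g) (comp_linearl f) _ fZ fX => v vf.
by have [u <-] := ex_liftr fg vf; exists u.
Qed.

Definition graded_finite X Y : Prop := total_fin_dim (fun l => hom X (dshift l Y)).

Lemma graded_finite_ext_closed X : ext_closed (graded_finite X).
Proof.
split=> [Y Y0 | Y1 Y Y2 u v uv [f1 [N1 t1]] [f2 [N2 t2]]].
  have tr l : is_trivial (hom X (dshift l Y)).
    by move=> t; apply: zero_object_hom; right; exact: dshift_zero.
  by split=> [l|]; [exact: fin_dim_trivial | exists 0%N].
split=> [l|]; first by have [u' [v' uv']] := ex_dshift l uv; exact: fin_dim_exr uv' (f1 l) (f2 l).
exists (maxn N1 N2) => l; rewrite gtn_max => /andP[l1 l2].
have [u' [v' uv']] := ex_dshift l uv; exact: trivial_exr uv' (t1 l l1) (t2 l l2).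
Qed.

Lemma graded_finite_dshift X Y k : graded_finite X Y -> graded_finite X (dshift k Y).
Proof.
move=> [fd [N tr]]; split=> [l|].
  exact: fin_dim_isor (isomorphic_sym (dshiftD l k Y)) (fd (l + k)).
exists (N + absz k)%N => l lN; apply: is_trivial_isor (isomorphic_sym (dshiftD l k Y)) (tr _ _).
by lia.
Qed.

Lemma graded_finite_span n (e : nat -> T) :
  (forall i j, (i < n)%N -> (j < n)%N -> graded_finite (e i) (e j)) ->
  forall X Y, span_lt e n X -> span_lt e n Y -> fin_dim (hom X Y).
Proof.
move=> fe X Y CX; move: Y; apply: gen_min => [|Y l [j ljn <-] _].
  split=> [Y Y0|A B C u v uv]; last exact: fin_dim_exr uv.
  by apply: fin_dim_trivial => t; apply: zero_object_hom; right.
move: X CX; apply: gen_min => [|X k [i lin <-] _].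
  split=> [X X0|A B C u v uv]; last exact: fin_dim_exl uv.
  by apply: fin_dim_trivial => t; apply: zero_object_hom; left.
have := dshiftD k (l - k) (e j); rewrite addrCA subrr addr0 => ij.
apply: fin_dim_isor ij (fin_dim_dshift k _).
by have [fd _] := fe i j lin ljn.
Qed.

End FiniteDimension.

(** * An exceptional sequence and its left dual form a dual pair *)

Section LeftDual.

Variables (K : fieldType) (D : tricat K).
Local Notation T := (dtri_of D).
Variables (n : nat) (e f : nat -> T).
Implicit Types (i j : nat) (l : int).

Hypothesis se : forall i, (i < n)%N -> scalar_end (e i).
Hypothesis ee : forall i j l, (i < n)%N -> (j < n)%N -> (j < i)%N || (i == j) && (l != 0) ->
  is_trivial (hom (e i) (dshift l (e j))).
Hypothesis fe : forall i j, (i < n)%N -> (j < n)%N -> graded_finite (e i) (e j).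
Hypothesis ef : forall i, (i < n)%N -> exists M : nat -> D,
  [/\ M i = e i, forall j, (j < i)%N -> is_left_mutation (e j) (M j.+1) (M j) & M 0%N = f i].

Lemma mutation_triangle i (X Y : T) : (i < n)%N -> span_lt e n X ->
  @is_left_mutation K D (e i) X Y ->
  exists (H : T) (ev : hom H X) (g : hom X Y),
    [/\ ex ev g, gen (eq (e i)) predT H & forall l, is_trivial (hom (e i) (dshift l Y))].
Proof.
move=> lin CX [H [u [ev [g [h [tu evu tr]]]]]].
have evg : @exact_pair K D _ _ _ ev g by exists h.
have oe l : l != 0 -> is_trivial (hom (e i) (shift l (e i))).
  by move=> l0; apply: ee => //; rewrite eqxx l0 orbT.
have fX : total_fin_dim (@Hombul K D (e i) X).
  move: X CX {Y u ev g h tu evu tr evg}.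
  apply: (@gen_min _ _ _ _ (graded_finite (e i))); first exact: graded_finite_ext_closed.
  by move=> Y l [j ljn <-] _; apply: graded_finite_dshift; exact: fe.
exists H, ev, g; split=> //; first exact: tensor_gen oe fX tu.
by move=> l; exact: (left_mutation_orth (se lin) oe fX tu evu evg).
Qed.

(** Descending induction along the mutations from [e i] to [f i]: each stage keeps a map from [e i]
    with cone in the span of the earlier objects, and gains orthogonality to one more [e j]. *)
Lemma left_dual_map i : (i < n)%N ->
  (exists (c : hom (e i) (f i)) W (p : hom (f i) W), ex c p /\ span_lt e i W) /\
  forall k l, (k < i)%N -> is_trivial (hom (e k) (dshift l (f i))).
Proof.
move=> lin; have [M [Mi mut <-]] := ef lin.
suff H d j : (j + d = i)%N ->
    (exists (c : hom (e i) (M j : T)) W (p : hom (M j : T) W), ex c p /\ span_lt e i W) /\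
    forall k l, (j <= k < i)%N -> is_trivial (hom (e k) (dshift l (M j : T))).
  by have [] := H i 0%N erefl.
elim: d j => [|d IHd] j jd.
  rewrite addn0 in jd; subst j; split=> [|k l].
    rewrite Mi; have [O O0] := dtri_zero T; exists (idm _), O, 0.
    by split; [exact: ex_id0 | exact: gen_zero].
  by case/andP=> ik ki; have := leq_ltn_trans ik ki; rewrite ltnn.
have ji : (j < i)%N by rewrite -jd addnS ltnS leq_addr.
have ljn := ltn_trans ji lin.
have [|[c [W [p [cp CW]]]] trM] := IHd j.+1; first by rewrite addSnnS.
have CM : span_lt e n (M j.+1).
  apply: ((gen_ext_closed _ _).2 _ _ _ _ _ cp); first exact: span_lt_e.
  exact: span_lt_leq (ltnW lin) CW.
have [H [ev [g [evg EH trj]]]] := mutation_triangle ljn CM (mut j ji).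
have [h [gh _]] := ex_rot evg.
have EH' : gen (eq (e j)) predT (up T H) by exact: (@gen_up _ _ _ predT).
split.
  have [W' [p' cp']] := ex_cone (g \oc c).
  (* The cone of the composite is an extension of the old cone [W] by the shifted tensor object,
     itself generated by [e j]. *)
  have [u [v [uv _ _]]] := ex_octa cp cp' gh.
  exists (g \oc c), W', p'; split=> //.
  apply: ((gen_ext_closed _ _).2 _ _ _ _ _ uv) => //.
  by apply: gen_sub EH' => // Z <-; exists j.
move=> k l /andP[jk ki]; have [<- // | kj] := eqVneq j k.
have {}jk : (j < k)%N by rewrite ltn_neqAle kj.
have [g' [h' gh']] := ex_dshift l gh.
apply: (trivial_exr gh'); first by apply: trM; rewrite jk ki.
have lkn := ltn_trans ki lin.
apply: (@gen_orthogonalP _ _ (eq (e k)) predT (eq (e j)) predT).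
- by move=> X Y m <- <-; apply: ee; rewrite ?jk.
- exact: (@gen_obj _ _ _ predT).
- exact: gen_shift EH'.
Qed.

Lemma left_dual_pair : dual_pair n e f.
Proof.
split=> //.
- exact: graded_finite_span.
- move=> i j l lin ljn ij; have [lt | le] := ltnP i j; first by have [_] := left_dual_map ljn; apply.
  have [[c [W [p [cp CW]]]] _] := left_dual_map ljn.
  have [c' [p' cp']] := ex_dshift l cp; apply: (trivial_exr cp').
    apply: ee => //; rewrite ltn_neqAle le andbT (eq_sym j).
    by case: (i == j) ij.
  apply: (@gen_orthogonalP _ _ (eq (e i)) predT (below e j) predT).
  + move=> X Y m <- [k kj <-]; apply: ee => //; first exact: ltn_trans ljn.
    by rewrite (leq_trans kj le).
  + exact: (@gen_obj _ _ _ predT).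
  + exact: gen_shift CW.
- by move=> i lin; have [] := left_dual_map lin.
Qed.

End LeftDual.

(** * Restriction of the t-structure and gluing *)

Section TStructure.

Variables (K : fieldType) (D : tricat K).
Local Notation T := (dtri_of D).
Variables (le0 ge0 : D -> Prop).
Hypothesis ts : t_structure le0 ge0.
Implicit Types X Y Z : T.

Lemma t_le_orth X Y : le0 X -> ge0 (up T Y) -> is_trivial (hom X Y).
Proof. exact: (ts_orth ts). Qed.

Lemma t_ge_dn X : ge0 (up T X) -> ge0 X.
Proof.
move=> gX; exact: (ts_ge_iso ts (@dnup K T X) (ts_ge_shift ts gX)).
Qed.

Lemma t_up_orth X Y : le0 X -> ge0 Y -> is_trivial (hom (up T X) Y).
Proof.
move=> lX gY; apply: (is_trivial_isor (@updn K T Y)); apply/trivial_up.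
by apply: (ts_orth ts) => //; apply: (ts_ge_iso ts (isomorphic_sym (@updn K T Y)) gY).
Qed.

(** Described by orthogonality, each half is visibly closed under extensions. *)
Lemma t_le_orthE X : le0 X <-> forall Y, ge0 (up T Y) -> is_trivial (hom X Y).
Proof.
split=> [lX Y|oX]; first exact: t_le_orth.
have [A [B [f [g [h [_ lA gB tr]]]]]] := @ts_trunc _ _ _ _ _ ts X I.
have fg : @ex K T _ _ _ f g by exists h.
have B0 := ex_zero_right fg (oX B gB) (t_le_orth (ts_le_shift ts lA) gB).
by apply: (ts_le_iso ts _ lA); exists f; exact: (ex_zeror fg B0).
Qed.

Lemma t_ge_orthE Y : ge0 Y <-> forall X, le0 X -> is_trivial (hom (up T X) Y).
Proof.
split=> [gY X lX|oY]; first exact: t_up_orth.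
(* [dn Y] is truncated rather than [Y] because [ts_trunc] places the shifted quotient [up B] in
   [ge0]. *)
have [A [B [f [g [h [_ lA gB tr]]]]]] := @ts_trunc _ _ _ _ _ ts (dn T Y) I.
have fg : @ex K T _ _ _ f g by exists h.
have A0 : @zero_object K T A.
  apply: (ex_zero_left fg); first by apply/trivial_up; apply: (is_trivial_isor (isomorphic_sym (@updn K T Y))); exact: oY.
  apply: t_le_orth => //; apply: (ts_ge_iso ts (isomorphic_sym (@updn K T B))).
  exact: t_ge_dn.
apply: (ts_ge_iso ts _ gB); apply: isomorphic_trans (@updn K T Y).
apply: fmap_isomorphic; apply: isomorphic_sym; exists g; exact: (ex_zerol fg A0).
Qed.

Lemma t_le_ext_closed : @ext_closed K T le0.
Proof.
split=> [X X0|X Y Z f g fg lX lZ]; apply/t_le_orthE => W gW.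
  by move=> t; apply: zero_object_hom; left.
by apply: (trivial_exl fg); exact: t_le_orth.
Qed.

Lemma t_ge_ext_closed : @ext_closed K T ge0.
Proof.
split=> [X X0|X Y Z f g fg lX lZ]; apply/t_ge_orthE => W gW.
  by move=> t; apply: zero_object_hom; right.
by apply: (trivial_exr fg); exact: t_up_orth.
Qed.

Variables (n : nat) (e f : nat -> T).
Hypothesis dp : dual_pair n e f.
Hypothesis le_e : forall i, (i < n)%N -> le0 (e i).
Hypothesis ge_f : forall i, (i < n)%N -> ge0 (f i).

Lemma aisle_le0 X : aisle e n 0 X -> le0 X.
Proof.
apply: gen_min; first exact: t_le_ext_closed.
move=> Y [k|//] [i lin <-] _; elim: k => /= [|k IHk]; first exact: le_e.
exact: (ts_le_shift ts).
Qed.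

Lemma coaisle_ge0 X : coaisle f n 0 X -> ge0 X.
Proof.
apply: gen_min; first exact: t_ge_ext_closed.
move=> Y [[|//]|k] [i lin <-] _; first exact: ge_f.
by rewrite /dshift; elim: k.+1 => /= [|k' IHk]; [exact: ge_f | exact: (ts_ge_shift ts)].
Qed.

Lemma aisle_restrictionE X : span_lt e n X -> le0 X -> aisle e n 0 X.
Proof.
move=> CX lX; have [A [B [u [v [AA CB uv]]]]] := truncation dp 0 (leqnn n) CX.
have gB : ge0 (up T B) by apply: coaisle_ge0; have := coaisle_up CB; rewrite sub0r addNr.
apply: ((aisle_ext_closed _ _ _).2 _ _ _ _ _ uv AA); apply: gen_zero.
apply: (ex_zero_right uv); first exact: t_le_orth.
apply: t_le_orth gB; apply: (ts_le_shift ts); exact: aisle_le0.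
Qed.

Lemma coaisle_restrictionE X : span_lt e n X -> ge0 X -> coaisle f n 0 X.
Proof.
move=> CX gX; have [A [B [u [v [AA CB uv]]]]] := truncation dp 1 (leqnn n) CX.
rewrite subrr in CB.
apply: ((coaisle_ext_closed _ _ _).2 _ _ _ _ _ uv _ CB); apply: gen_zero.
apply: (ex_zero_left uv).
  apply: (is_trivial_isol (@updn K T A)); apply: t_up_orth => //; apply: aisle_le0.
  by have := aisle_dn AA; rewrite subrr.
by apply: (aisle_orth dp (leqnn n) (leqnn n) _ AA (coaisle_dn CB)).
Qed.

Lemma restricts_to_span (C : D -> Prop) : (forall X, C X <-> span_lt e n X) ->
  restricts_to C le0 ge0.
Proof.
move=> CE; split.
- by move=> X [].
- by move=> X [].
- move=> X Y XY [lX CX]; split; first exact: (ts_le_iso ts XY).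
  by apply/CE; exact: (@gen_iso K T _ _ X Y XY (proj1 (CE X) CX)).
- move=> X Y XY [gX CX]; split; first exact: (ts_ge_iso ts XY).
  by apply/CE; exact: (@gen_iso K T _ _ X Y XY (proj1 (CE X) CX)).
- move=> X [lX CX]; split; first exact: (ts_le_shift ts).
  by apply/CE; apply: (@gen_up _ T _ predT predT) => //; apply/CE.
- move=> X [gX CX]; split; first exact: (ts_ge_shift ts).
  by apply/CE; apply: (@gen_dn _ T _ predT predT) => //; apply/CE.
- by move=> X Y _ [lX _] [gY _]; exact: t_le_orth.
move=> X /CE CX; have [A [B [u [v [AA CB [h uv]]]]]] := truncation dp 0 (leqnn n) CX.
have CB' := coaisle_span dp (leqnn n) CB.
exists A, B, u, v, h; split=> //.
- exact/CE.
- by split; [exact: aisle_le0 | apply/CE; exact: aisle_span AA].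
split; last by apply/CE; exact: (@gen_up _ T _ predT predT).
by apply: coaisle_ge0; have := coaisle_up CB; rewrite sub0r addNr.
Qed.

End TStructure.

(** * Comparison with the glued t-structure *)

Section Glued.

Variables (K : fieldType) (D : tricat K).
Local Notation T := (dtri_of D).
Variables (n : nat) (E : 'I_n -> D) (e f : nat -> T).
Hypothesis dp : dual_pair n e f.
Hypothesis eE : forall i : 'I_n, e i = E i.
Implicit Types X Y Z : T.

(** [generated] closes under third vertices of triangles and [gen] under middle ones; rotation
    passes from one to the other. *)
Lemma exc_spanE s X : (s <= n)%N -> exc_span E s X <-> span_lt e s X.
Proof.
move=> sn; split=> [gX | CX].
  apply: gX => [|Y [i ls ->]]; last by rewrite -eE; exact: span_lt_e.
  split.
  - by move=> Y Y0; exact: gen_zero.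
  - exact: (@gen_iso _ T).
  - exact: (@gen_up _ T _ predT predT).
  - exact: (@gen_dn _ T _ predT predT).
  - move=> X' Y Z u v w tr CX' CY.
    have [h [vh _]] := @ex_rot _ T _ _ _ _ _ (ex_intro _ w tr : exact_pair u v).
    apply: ((gen_ext_closed _ _).2 _ _ _ _ _ vh) => //.
    exact: (@gen_up _ T _ predT predT).
move=> C tC CE; move: X CX; apply: gen_min => [|X l [i ls <-] _].
  split=> [X|X Y Z u v uv CX CZ]; first exact: (tri_subcat0 tC).
  have [h [[w hu] _]] := ex_rot' uv.
  by apply: (tri_subcat_cone tC hu) => //; exact: (tri_subcat_shm1 tC).
have Ce : C (e i).
  by apply: CE; have lin := leq_trans ls sn; exists (Ordinal lin); rewrite // -eE.
case: l => k; rewrite /dshift; last move: k.+1 => {}k; elim: k => //= k IHk.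
  exact: (tri_subcat_sh1 tC).
exact: (tri_subcat_shm1 tC).
Qed.

Lemma ex_reflection (C : D -> Prop) (H X A : T) (u : hom H X) (v : hom X A) : ex u v -> C A ->
  (forall B : T, C B -> is_trivial (hom H B) /\ is_trivial (hom (up T H) B)) ->
  @reflection K D C X A.
Proof.
move=> uv CA HB; split=> //; exists v => B CB t; have [H0 H1] := HB B CB.
have [|g gE] := ex_liftr (t := t) uv; first exact: H0.
exists g; split=> // g' g'E; apply/subr0_eq.
have [h [vh _]] := ex_rot uv.
have [|y <-] := ex_liftr (t := (g - g' : @hom K T A B)) vh.
  by have := compBl g g' (v : @hom K D X A); rewrite gE g'E subrr.
by rewrite (H1 y) comp0l.
Qed.

Lemma ex_coreflection (C : D -> Prop) (A X G : T) (u : hom A X) (v : hom X G) : ex u v -> C A ->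
  (forall B : T, C B -> is_trivial (hom B G) /\ is_trivial (hom B (dn T G))) ->
  @coreflection K D C X A.
Proof.
move=> uv CA HB; split=> //; exists u => B CB t; have [H0 H1] := HB B CB.
have [|g gE] := @ex_liftl K T A X G B u v t uv; first exact: H0.
exists g; split=> // g' g'E; apply/subr0_eq.
have [h [hu _]] := ex_rot' uv.
have [|y <-] := ex_liftl (t := (g - g' : @hom K T B A)) hu.
  by have := compBr (u : @hom K D A X) g g'; rewrite gE g'E subrr.
by rewrite (H1 y) comp0r.
Qed.

Lemma reflection_unique (C : D -> Prop) (X A A' : D) :
  reflection C X A -> reflection C X A' -> isomorphic A A'.
Proof.
case=> CA [u uP] [CA' [v vP]].
have [a [au _]] := uP A' CA' v; have [b [bv _]] := vP A CA u.
exists a, b; split.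
  have [w [_ wU]] := uP A CA u; rewrite -(wU (idm A)) ?comp1m // -(wU (b \oc a)) //.
  by rewrite -compA au bv.
have [w [_ wU]] := vP A' CA' v; rewrite -(wU (idm A')) ?comp1m // -(wU (a \oc b)) //.
by rewrite -compA bv au.
Qed.

Lemma coreflection_unique (C : D -> Prop) (X A A' : D) :
  coreflection C X A -> coreflection C X A' -> isomorphic A A'.
Proof.
case=> CA [u uP] [CA' [v vP]].
have [a [au _]] := vP A CA u; have [b [bv _]] := uP A' CA' v.
exists a, b; split.
  have [w [_ wU]] := uP A CA u; rewrite -(wU (idm A)) ?compm1 // -(wU (b \oc a)) //.
  by rewrite compA bv au.
have [w [_ wU]] := vP A' CA' v; rewrite -(wU (idm A')) ?compm1 // -(wU (a \oc b)) //.
by rewrite compA au bv.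
Qed.

Lemma hom_gen_eq (X : T) (a : int -> bool) Y Z (l : int) :
  (forall k, a k -> is_trivial (hom X (dshift (l + k) Y))) ->
  gen (eq Y) a Z -> is_trivial (hom X (dshift l Z)).
Proof.
move=> H; move: Z; apply: gen_min => [|Z k <- ak].
  split=> [Z Z0 t|A B C u v uv]; first by apply: zero_object_hom; right; exact: dshift_zero.
  by have [u' [v' uv']] := ex_dshift l uv; exact: trivial_exr uv'.
exact: is_trivial_isor (isomorphic_sym (dshiftD l k Y)) (H k ak).
Qed.

Lemma hom_gen_eq_l X Y a Z : gen (eq Y) a Z ->
  (forall l, is_trivial (hom Y (dshift l X))) -> is_trivial (hom Z X).
Proof.
move=> GZ YX; move: Z GZ; apply: gen_min => [|Z k <- _].
  split=> [Z Z0 t|A B C u v uv]; last exact: trivial_exl uv.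
  by apply: zero_object_hom; left.
by apply/(trivial_dshift2 k 0 Y X); exact: YX.
Qed.

(** In [H -> X -> A] with [H] built from [e s], the object [A] is the reflection, unique up to
    isomorphism. The open condition concerns [H] alone, since [e s] has no map to shifts of [A]. *)
Lemma glued_leE s X : (s <= n)%N -> @glued_le K D n E s X <-> aisle e s 0 X.
Proof.
elim: s X => [|s IHs] X sn.
  by split=> [X0 | AX]; [exact: gen_zero | exact: span_lt_zero (aisle_span AX)].
have {}IHs Y := IHs Y (ltnW sn).
have CsE Y := exc_spanE Y (ltnW sn).
have ee l : l != 0 -> is_trivial (hom (e s) (dshift l (e s))).
  by move=> l0; apply: (dp_ee dp); rewrite // eqxx l0 orbT.
have refl a H A (u : hom H X) (v : hom X A) : ex u v -> gen (eq (e s)) a H -> span_lt e s A ->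
    @reflection K D (exc_span E s) X A.
  move=> uv GH CA; apply: (ex_reflection uv); first exact/CsE.
  move=> B /CsE CB; split; first exact: (gen_orthogonalP (e_orthogonal_e dp sn) GH CB).
  apply: (gen_orthogonalP (a := predT) (e_orthogonal_e dp sn) _ CB).
  exact: (@gen_up _ _ _ a predT).
split=> [[/(exc_spanE X sn) CX [A rA /IHs AA] oX] | AX].
  have [H [A' [u [v [GH CA' uv]]]]] := e_star dp sn CX.
  have AA' : aisle e s 0 A' :=
    @gen_iso K T _ _ A A' (reflection_unique rA (refl _ _ _ _ _ uv GH CA')) AA.
  have eX l : 0 < l -> is_trivial (hom (e s) (dshift l X)).
    by move=> l0; have := oX (Ordinal sn) erefl l l0; rewrite /open_pullback /Hombul -eE.
  have [H1 [H2 [u1 [v1 [GH1 GH2 uv1]]]]] := exceptional_truncation 0 (dp_end dp sn) ee GH.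
  have H20 : zero_object H2.
    apply/zero_objectP; suff tr : is_trivial (hom H2 H2) by exact: tr.
    (* [H2] involves only negative shifts of [e s]. For [l <= 0] the degrees cannot match; for
       [l > 0] the vanishing is inherited from [X] through [H]. *)
    apply: (hom_gen_eq_l GH2) => l; have [l0 | l0] := lerP l 0.
      apply: hom_gen_eq GH2 => k k0; apply: ee; apply/eqP => lk; move: k0.
      by rewrite -lk; lia.
    have [w [vw _]] := ex_rot uv1; have [vl [wl vwl]] := ex_dshift l vw.
    apply: (trivial_exr vwl).
      have [x [xu _]] := ex_rot' uv; have [xl [ul xul]] := ex_dshift l xu.
      apply: (trivial_exr xul); last exact: eX.
      apply: (hom_e_span_dshift dp) => //; exact: (@gen_dn _ _ _ predT).
    have GH1' : gen (eq (e s)) (fun k => 1 <= k) (up T H1).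
      by apply: gen_up GH1 => k k0; rewrite lerDr.
    apply: hom_gen_eq GH1' => k k1; apply: ee; apply/eqP => lk; move: k1 l0; lia.
  apply: ((aisle_ext_closed _ _ _).2 _ _ _ _ _ uv).
    apply: ((aisle_ext_closed _ _ _).2 _ _ _ _ _ uv1); last exact: gen_zero.
    by apply: gen_sub GH1 => // Y <-; exists s.
  exact: aisle_leq (leqnSn s) _ AA'.
have [H [A [u [v [GH AA uv]]]]] := e_star dp sn AX; split.
- by apply/exc_spanE => //; exact: aisle_span AX.
- exists A; last exact/IHs.
  exact: refl uv GH (aisle_span AA).
move=> i iE l l0; rewrite /open_pullback /Hombul -eE iE.
apply: (hom_e_aisle dp) => //; apply: gen_shift AX => k k0; lia.
Qed.

(** Not the formal dual of the previous lemma: the open condition is still tested with [e s],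
    whereas the coaisle is built from [f s]. *)
Lemma glued_geE s X : (s <= n)%N -> @glued_ge K D n E s X <-> coaisle f s 0 X.
Proof.
elim: s X => [|s IHs] X sn.
  split=> [X0 | AX]; first exact: gen_zero.
  exact: span_lt_zero (coaisle_span dp (leq0n n) AX).
have {}IHs Y := IHs Y (ltnW sn).
have CsE Y := exc_spanE Y (ltnW sn).
have ff l : l != 0 -> is_trivial (hom (f s) (dshift l (f s))).
  by move=> l0; apply: (f_orthogonal_f dp); rewrite // eqxx l0 orbT.
have corefl a A G (u : hom A X) (v : hom X G) : ex u v -> gen (eq (f s)) a G -> span_lt e s A ->
    @coreflection K D (exc_span E s) X A.
  move=> uv GG CA; apply: (ex_coreflection uv); first exact/CsE.
  move=> B /CsE CB; split; first exact: (gen_orthogonalP (e_orthogonal_f dp sn) CB GG).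
  apply: (gen_orthogonalP (b := predT) (e_orthogonal_f dp sn) CB).
  exact: (@gen_dn _ _ _ a predT).
split=> [[/(exc_spanE X sn) CX [A rA /IHs AA] oX] | AX].
  have [A' [G [u [v [/(span_lt_fE dp _ (ltnW sn)) CA' GG uv]]]]] :=
    f_star dp sn (proj2 (span_lt_fE dp X sn) CX).
  have AA' : coaisle f s 0 A' :=
    @gen_iso K T _ _ A A' (coreflection_unique rA (corefl _ _ _ _ _ uv GG CA')) AA.
  have eX l : l < 0 -> is_trivial (hom (e s) (dshift l X)).
    by move=> l0; have := oX (Ordinal sn) erefl l l0; rewrite /open_pullback /Hombul -eE.
  have ef l : l != 0 -> is_trivial (hom (e s) (dshift l (f s))).
    by move=> l0; apply: (dp_ef dp); rewrite // l0 orbT.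
  have [G1 [G2 [u1 [v1 [GG1 GG2 uv1]]]]] := exceptional_truncation 1 (scalar_end_f dp sn) ff GG.
  (* [e s] has no map to any shift of [G1], so [G1] lies in the span of the first [s] objects, which
     has no map to shifts of [f s]; hence its identity is zero. *)
  have G10 : zero_object G1.
    have CG1 : span_lt e s.+1 G1.
      apply/(span_lt_fE dp _ sn); apply: gen_sub GG1 => // Y <-; by exists s.
    have eG1 l : is_trivial (hom (e s) (dshift l G1)).
      have [l0 | l0] := lerP 0 l.
        apply: hom_gen_eq GG1 => k k0; apply: ef; apply/eqP => lk; move: k0; lia.
      have [w [wu _]] := ex_rot' uv1; have [wl [ul wul]] := ex_dshift l wu.
      apply: (trivial_exr wul).
        have GG2' : gen (eq (f s)) (fun k => k < 0) (dn T G2).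
          by apply: gen_dn GG2 => k k0; lia.
        apply: hom_gen_eq GG2' => k k1; apply: ef; apply/eqP => lk; move: k1 l0; lia.
      have [x [vx _]] := ex_rot uv; have [vl [xl vxl]] := ex_dshift l vx.
      apply: (trivial_exr vxl); first exact: eX.
      apply: (hom_e_span_dshift dp) => //; exact: (@gen_up _ _ _ predT).
    have CsG1 := span_lt_of_orth dp sn CG1 eG1.
    apply/zero_objectP; suff tr : is_trivial (hom G1 G1) by exact: tr.
    exact: (gen_orthogonalP (e_orthogonal_f dp sn) CsG1 GG1).
  apply: ((coaisle_ext_closed _ _ _).2 _ _ _ _ _ uv).
    exact: coaisle_leq (leqnSn s) _ AA'.
  apply: ((coaisle_ext_closed _ _ _).2 _ _ _ _ _ uv1); first exact: gen_zero.
  by apply: gen_sub GG2 => [Y <-|k k1]; [exists s | lia].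
have [A [G [u [v [AA GG uv]]]]] := f_star dp sn AX; split.
- by apply/exc_spanE => //; exact: (coaisle_span dp sn AX).
- exists A; last exact/IHs.
  exact: corefl uv GG (coaisle_span dp (ltnW sn) AA).
move=> i iE l l0; rewrite /open_pullback /Hombul -eE iE.
have Cl : coaisle f s.+1 l (dshift l X) by apply: gen_shift AX => k k0; lia.
exact: (aisle_orth dp sn sn l0 (aisle_e e s) Cl).
Qed.

End Glued.

(** * Extensions in the heart *)

Section TriangleMaps.

Variables (K : fieldType) (D : tricat K).
Implicit Types X Y Z : D.

(** The middle term is the desuspended cone of [d]; two rotations are undone and their signs put
    into the maps. *)
Lemma triangle_of_third X Z (d : hom Z (sh1 D X)) :
  exists Y (f : hom X Y) (g : hom Y Z), triangle f g d.
Proof.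
have [Q [p [r t]]] := triangle_cone d; have [eps [epsI _]] := shm1K D.
have [e [e1 e2]] := epsI Q.
have [f fE] := sh1_full (eps Q \oc p); have [g gE] := sh1_full (r \oc e).
exists (shm1 D Q), (- f), (- g); do 2 apply: (proj2 (triangle_rot _ _ _)).
rewrite !fmapN !opprK -fE -gE.
apply: triangle_iso (is_iso_id _) (is_iso_id _) (epsI Q) _ _ _ t.
- by rewrite comp1m compm1.
- by rewrite compm1.
- by rewrite fmap_id comp1m -compA e1 compm1.
Qed.

Lemma triangle_fill_middle X Y Z X' Y' Z' (f : hom X Y) (g : hom Y Z) h
    (f' : hom X' Y') (g' : hom Y' Z') h' (a : hom X X') (c : hom Z Z') :
  triangle f g h -> triangle f' g' h' -> fmap (sh1 D) a \oc h = h' \oc c ->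
  exists b : hom Y Y', b \oc f = f' \oc a /\ g' \oc b = c \oc g.
Proof.
move=> /triangle_rot/triangle_rot t /triangle_rot/triangle_rot t' ac.
have [C [C1 C2]] := triangle_fill t t' ac; have [b bE] := sh1_full C.
exists b; split; apply: sh1_injB; rewrite !fmap_comp -bE.
  by apply: oppr_inj; rewrite -compNr C1 compNl.
by apply: oppr_inj; rewrite -compNl -C2 compNr.
Qed.

End TriangleMaps.

(** * Finiteness of Yoneda extensions *)

Section HeartExtensions.

Variables (K : fieldType) (D : tricat K).
Local Notation T := (dtri_of D).
Variables (n : nat) (e f : nat -> T).
Hypothesis dp : dual_pair n e f.
Variable Hp : D -> Prop.
Hypothesis HpE : forall X, Hp X <-> glued_heart e f n X.

Local Notation HC := (@full_subcat K D Hp).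
Implicit Types X Y Z : HC.

Lemma heart_triangle X Y (d : @hom K D (sval X) (sh1 D (sval Y))) :
  exists (M : HC) (g : hom Y M) (h : hom M X),
    @triangle K D (sval Y) (sval M) (sval X) g h d.
Proof.
have [M [g [h t]]] := triangle_of_third d.
have hM : Hp M.
  apply/HpE; apply: ((glued_heart_ext_closed e f n).2 _ _ _ _ _ (ex_intro _ d t : exact_pair g h)).
    exact: (@heart_objP K T n e f Hp HpE Y).
  exact: (@heart_objP K T n e f Hp HpE X).
by exists (exist _ M hM), g, h.
Qed.

(** Extensions are triangles with connecting map in [hom X (sh1 Y)], and Baer combinations match
    linear combinations of these maps. So a spanning family [b] of that space provides the
    extensions [xi]. *)
Lemma heart_ext1_fin_dim X Y : ext1_fin_dim X Y.
Proof.
have HX := @heart_objP K T n e f Hp HpE X; have HY := @heart_objP K T n e f Hp HpE Y.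
have [m [b bP]] : fin_dim (@hom K D (sval X) (sh1 D (sval Y))).
  apply: (dp_fin dp); first exact: aisle_span HX.1.
  exact: (@gen_up _ T _ predT predT _ _ (aisle_span HY.1)).
have xi_ex (a : 'I_m) : exists xi : extension X Y,
    @triangle K D (sval Y) (sval (ext_mid xi)) (sval X) (ext_in xi) (ext_out xi) (b a).
  have [M [g [h t]]] := heart_triangle (b a).
  have gh : short_exact g h.
    by apply/(@heart_short_exact K T n e f dp Hp HpE); exists (b a).
  by exists (Extension gh).
pose xi a := proj1_sig (constructive_indefinite_description _ (xi_ex a)).
have xiP a : @triangle K D (sval Y) (sval (ext_mid (xi a))) (sval X)
    (ext_in (xi a)) (ext_out (xi a)) (b a).
  by rewrite /xi; case: constructive_indefinite_description.
have inj (z : extension X Y) V (t : hom V Y) : ext_in z \oc t = 0 -> t = 0.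
  move: (proj1 (@heart_short_exact K T n e f dp Hp HpE _ _ _ _ _) (ext_exact z)) => ez.
  exact: (@heart_ex_mono K T n e f dp Hp HpE _ _ _ _ _ _ _ ez).
exists m, xi => z; have [dz tz] : exact_pair (ext_in z : @hom K D (sval Y) (sval (ext_mid z))) (ext_out z).
  exact: (proj1 (@heart_short_exact K T n e f dp Hp HpE _ _ _ _ _) (ext_exact z)).
have [c cE] := bP dz; exists c.
have [H0 [i0 [p0 HS]]] := @tcat_additive _ D m (fun _ => sval Y).
have hH : Hp H0 := @heart_direct_sum K T n e f Hp HpE m (fun _ => Y) H0 i0 p0 HS.
pose H : HC := exist _ H0 hH.
pose i a : hom Y H := i0 a; pose p a : hom H Y := p0 a.
have [pi1 pi0 sumE] : @is_direct_sum K HC m (fun _ => Y) H i p by exact: HS.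
(* The extension of [X] by [m] copies of [Y] whose class has components [b a]; it is the fibre
   product of the middle terms. *)
have [W [j [q tW]]] := heart_triangle (Y := H) (\sum_a (fmap (sh1 D) (i0 a) \oc b a)).
have pib a a' : p0 a \oc i0 a' = (a == a')%:R *: idm (sval Y).
  have [<-|aa'] := eqVneq a a'; first by rewrite scale1r; exact: (pi1 a).
  by rewrite scale0r; apply: pi0 => e1; rewrite e1 eqxx in aa'.
have pD a : fmap (sh1 D) (p0 a) \oc (\sum_a' (fmap (sh1 D) (i0 a') \oc b a')) = b a.
  rewrite comp_sumr (bigD1 a) //= big1 ?addr0 => [|a' aa'].
    by rewrite compA -fmap_comp pib eqxx scale1r fmap_id comp1m.
  by rewrite compA -fmap_comp pib eq_sym (negPf aa') scale0r fmap0 comp0l.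
have P_ex a : exists u : hom W (ext_mid (xi a)),
    u \oc j = ext_in (xi a) \oc p a /\ ext_out (xi a) \oc u = q.
  have [|u [u1 u2]] := triangle_fill_middle (a := p0 a) (c := idm _) tW (xiP a).
    by rewrite pD compm1.
  by exists u; split; [exact: u1 | apply: (etrans u2); exact: (comp1m q)].
pose P a := proj1_sig (constructive_indefinite_description _ (P_ex a)).
have PE a : P a \oc j = ext_in (xi a) \oc p a /\ ext_out (xi a) \oc P a = q.
  by rewrite /P; case: constructive_indefinite_description.
(* Pushing [W] out along [\sum_a c a *: p a] gives the class [\sum_a c a *: b a], which is that of
   [z]. *)
have [w [wj wq]] : exists w : hom W (ext_mid z),
    w \oc j = ext_in z \oc (\sum_a c a *: p a) /\ ext_out z \oc w = q.
  have [|u [u1 u2]] := triangle_fill_middle (a := \sum_a c a *: p0 a) (c := idm _) tW tz.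
    rewrite compm1 cE (big_morph (fun g => fmap (sh1 D) g) (id1 := 0) (op1 := +%R)).
    - by rewrite comp_suml; apply: eq_bigr => a _; rewrite fmapZ compZl pD.
    - exact: fmapD.
    - exact: fmap0.
  by exists u; split; [exact: u1 | apply: (etrans u2); exact: (comp1m q)].
have lift V (r : hom V W) : q \oc r = 0 -> exists s : hom V H, j \oc s = r.
  exact: (triangle_liftl tW).
have pinj V (s : hom V H) : (forall a, p a \oc s = 0) -> s = 0.
  move=> s0; rewrite -[s]comp1m -sumE comp_suml big1 // => a _.
  by rewrite -compA s0 comp0r.
exists W, P, q, w; split=> //.
- by move=> a; case: (PE a).
- move=> V t r tr.
  (* [r] lifts to each middle term, so every [b a] kills it and it lifts to [W]. The lift misses the
     [t a] by maps [y a] into [Y], which are then subtracted. *)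
  have [u0 u0E] : exists u0 : hom V W, q \oc u0 = r.
    apply: (triangle_liftl (proj1 (triangle_rot _ _ _) tW)).
    rewrite comp_suml big1 // => a _; rewrite -compA.
    have := triangle_comp0 (proj1 (triangle_rot _ _ _) (xiP a)) => bo.
    have rE : (r : @hom K D (sval V) (sval X)) =
        (ext_out (xi a) : @hom K D (sval (ext_mid (xi a))) (sval X)) \oc t a := esym (tr a).
    by rewrite rE (compA (b a)) bo comp0l comp0r.
  have y_ex a : exists y : hom V Y, ext_in (xi a) \oc y = (P a \oc u0) - t a.
    apply: (triangle_liftl (xiP a)).
    have : ext_out (xi a) \oc ((P a \oc u0) - t a) = 0; last by [].
    by rewrite compBr compA (proj2 (PE a)) u0E tr subrr.
  pose y a := proj1_sig (constructive_indefinite_description _ (y_ex a)).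
  have yE a : ext_in (xi a) \oc y a = (P a \oc u0) - t a.
    by rewrite /y; case: constructive_indefinite_description.
  have qj : q \oc j = 0 := triangle_comp0 tW.
  pose s : hom V H := \sum_a (i a \oc y a).
  have ps a : p a \oc s = y a.
    rewrite /s comp_sumr (bigD1 a) //= big1 ?addr0 => [|a' aa'].
      rewrite compA.
      by apply: (etrans (congr1 (fun g : hom Y Y => g \oc y a) (pi1 a))); exact: comp1m.
    rewrite compA; apply: (etrans (congr1 (fun g : hom Y Y => g \oc y a') (pi0 a' a _))).
      by move=> e1; rewrite e1 eqxx in aa'.
    exact: comp0l.
  exists (u0 - (j \oc s)); split=> [|v [v1 v2]].
    split=> [a|]; last by rewrite compBr compA qj comp0l subr0.
    by rewrite compBr compA (proj1 (PE a)) -compA ps yE subKr.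
  apply/esym/subr0_eq.
  have [|d dE] := lift V (v - (u0 - (j \oc s))).
    by rewrite compBr v2 compBr compA qj comp0l subr0 u0E subrr.
  rewrite -dE (pinj _ d) ?comp0r // => a; apply: (inj (xi a)).
  rewrite compA -(proj1 (PE a)) -compA dE compBr v1 compBr compA (proj1 (PE a)) -compA ps yE.
  by rewrite subKr subrr.
move=> V y u uy qu; have [d dE] := lift V u qu.
rewrite -dE compA wj -compA; congr (_ \oc _); rewrite comp_suml; apply: eq_bigr => a _.
rewrite compZl; congr (_ *: _); apply/subr0_eq/(inj (xi a)).
by rewrite compBr compA -(proj1 (PE a)) -compA dE uy subrr.
Qed.

End HeartExtensions.

(** * Assembly of the highest weight structure *)

Section HighestWeightHeart.

Variables (K : fieldType) (D : tricat K).
Local Notation T := (dtri_of D).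
Variables (n : nat) (e f S : nat -> T).
Hypothesis dp : dual_pair n e f.
Hypothesis HS : forall i, (i < n)%N -> middle_image e f i (S i).
Hypothesis hef : forall i, (i < n)%N -> coaisle f n 0 (e i) /\ aisle e n 0 (f i).
Variable Hp : D -> Prop.
Hypothesis HpE : forall X, Hp X <-> glued_heart e f n X.

Local Notation HC := (@full_subcat K D Hp).
Local Notation To := (opposite T).

Variables L Delta Nabla : 'I_n -> HC.
Hypothesis LE : forall i, sval (L i) = S i.
Hypothesis DeltaE : forall i, sval (Delta i) = e i.
Hypothesis NablaE : forall i, sval (Nabla i) = f i.

Lemma filtered_by_family (g : nat -> T) (G : 'I_n -> HC) (P : nat -> Prop) (R : 'I_n -> Prop)
    (N : HC) : (forall i, sval (G i) = g i) -> (forall i : 'I_n, P i -> R i) ->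
  (forall k, P k -> (k < n)%N) ->
  @ecl K T (fun Z => exists2 k, P k & g k = Z) (sval N) ->
  filtered_by (fun Z => exists2 j, R j & Z = G j) N.
Proof.
move=> GE PR Pn EN; apply: (@filtered_by_of_ecl K T n e f dp Hp HpE _ (sval N)) => //.
apply: ecl_sub EN => Z [k Pk <-]; exists (G (Ordinal (Pn k Pk))); last exact: GE.
by exists (Ordinal (Pn k Pk)) => //; exact: PR.
Qed.

Lemma dual_heartE X : Hp X <-> @glued_heart K To f e n X.
Proof. exact: iff_trans (HpE X) (iff_sym (@glued_heart_op K T e f n X)). Qed.

Lemma dual_heart_objects i : (i < n)%N ->
  @coaisle K To e n 0 (f i) /\ @aisle K To f n 0 (e i).
Proof.
move=> lin; have [Ce Af] := hef lin.
by split; [apply: (proj2 (coaisle_op _ _ _ _)) | apply: (proj2 (aisle_op _ _ _ _))]; rewrite oppr0.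
Qed.

Lemma irreducible_L i : irreducible_obj (L i).
Proof. exact: (@irreducible_simple K T n e f S dp HS Hp HpE (L i) i (ltn_ord i) (LE i)). Qed.

Lemma heart_deligne_finite : deligne_finite HC.
Proof.
have addT := tcat_additive (t := D); split.
- exact: (@heart_abelian K T n e f dp Hp HpE addT).
- move=> X Y; apply: (dp_fin dp).
    exact: aisle_span (@heart_objP K T n e f Hp HpE X).1.
  exact: aisle_span (@heart_objP K T n e f Hp HpE Y).1.
- exact: (heart_ext1_fin_dim dp HpE).
- exists n, L => X irrX.
  have [i lin iX] := irreducible_isomorphic dp HS HpE irrX.
  by exists (Ordinal lin); rewrite -[i]/(val (Ordinal lin)) -LE in iX.
- move=> X; have EX := finite_length dp HS (leqnn n) (@heart_objP K T n e f Hp HpE X).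
  apply: (@filtered_by_of_ecl K T n e f dp Hp HpE _ (sval X)) => //.
  apply: ecl_sub EX => Z [j ljn <-]; exists (L (Ordinal ljn)); last exact: LE.
  exact: irreducible_L.
- exact: (@heart_generator K T n e f S dp HS hef Hp HpE addT).
Qed.

Lemma heart_highest_weight : highest_weight (fun i j : 'I_n => (i <= j)%N) L Delta Nabla.
Proof.
have sltE (i j : 'I_n) : (i < j)%N -> slt (fun i j : 'I_n => (i <= j)%N) i j.
  by move=> ij; split; [exact: ltnW | move=> e1; rewrite e1 ltnn in ij].
have dpo := dual_pair_op dp.
have HSo i : (i < n)%N -> @middle_image K To f e i (S i).
  by move=> lin; exact: (@middle_image_op K T e f i (S i) (HS lin)).
have short (X Y Z : HC) (u : hom X Y) (v : hom Y Z) :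
    @exact_pair K D (sval X) (sval Y) (sval Z) u v -> short_exact u v.
  exact: (proj2 (@heart_short_exact K T n e f dp Hp HpE X Y Z u v)).
split.
- exact: heart_deligne_finite.
- split=> [i | i j ij | X irrX]; first exact: irreducible_L.
    apply: val_inj; apply: (@simple_labels_inj K T n e f S dp HS); rewrite ?ltn_ord //=.
    by have : @isomorphic K D (sval (L i)) (sval (L j)) := ij; rewrite !LE.
  have [i lin iX] := irreducible_isomorphic dp HS HpE irrX.
  by exists (Ordinal lin); rewrite -[i]/(val (Ordinal lin)) -LE in iX.
- split; first exact: leqnn.
    by move=> i j ij; apply: val_inj; apply/eqP; rewrite eqn_leq.
  by move=> j i k; exact: leq_trans.
(* The order is total, so there are no incomparable labels. *)
- by move=> M i1 i2 _ _; case/orP: (leq_total i1 i2) => ->.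
- move=> i; have [N [k [p [kp EN]]]] :=
    @heart_standard K T n e f S dp HS Hp HpE i (L i) (Delta i) (ltn_ord i) (LE i) (DeltaE i).
  exists N, k, p; split; first exact: short.
  apply: (filtered_by_family LE _ _ EN) => [j|j ji]; first exact: sltE.
  exact: ltn_trans (ltn_ord i).
- move=> i; have [P [c [N [k [p [cP kp EN _]]]]]] :=
    @heart_projective_cover K T n e f S dp HS hef Hp HpE i (L i) (Delta i)
      (ltn_ord i) (LE i) (DeltaE i).
  exists P, c, N, k, p; split=> //; first exact: short.
  by apply: (filtered_by_family DeltaE _ _ EN) => [j|j] /andP[ij jn] //; exact: sltE.
(* The costandard clauses are the standard ones for the pair [(f, e)] in the opposite category,
   whose heart is the same class [Hp]. *)
- move=> i; have [N [k [p [kp EN]]]] :=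
    @heart_standard K To n f e S dpo HSo Hp dual_heartE i (L i) (Nabla i)
      (ltn_ord i) (LE i) (NablaE i).
  exists N, p, k; split; first exact: short.
  apply: (filtered_by_family LE _ _ (proj1 (ecl_op _ _) EN)) => [j|j ji]; first exact: sltE.
  exact: ltn_trans (ltn_ord i).
- move=> i; have [P [c [N [k [p [cP kp EN _]]]]]] :=
    @heart_projective_cover K To n f e S dpo HSo dual_heart_objects Hp dual_heartE i (L i)
      (Nabla i) (ltn_ord i) (LE i) (NablaE i).
  exists P, c, N, p, k; split.
  + case: cP => projP ce cE; split.
    * by move=> X Y g gm h; exact: (projP Y X g gm h).
    * exact: ce.
    * by move=> Z u; exact: (cE Z u).
  + exact: short.
  by apply: (filtered_by_family NablaE _ _ (proj1 (ecl_op _ _) EN)) => [j|j] /andP[ij jn] //;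
    exact: sltE.
Qed.

End HighestWeightHeart.

Theorem theorem1p3 (K : closedFieldType) (D : tricat K)
    (le0 ge0 : D -> Prop) (n : nat) (E F : 'I_n -> D) :
  t_structure le0 ge0 -> exceptional E -> left_dual E F ->
  let C := exc_span E n in
  ((forall i, le0 (E i)) -> (forall i, ge0 (F i)) ->
     restricts_to C le0 ge0 /\
     (forall X, meet_class le0 C X <-> glued_le E n X) /\
     (forall X, meet_class ge0 C X <-> glued_ge E n X) /\
     (forall X, heart (glued_le E n) (glued_ge E n) X <->
                meet_class (heart le0 ge0) C X)) /\
  ((forall i, heart le0 ge0 (E i)) -> (forall i, heart le0 ge0 (F i)) ->
     exists L Delta Nabla :
         'I_n -> full_subcat (meet_class (heart le0 ge0) C),
       (forall i, sval (Delta i) = E i) /\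
       (forall i, sval (Nabla i) = F i) /\
       highest_weight (fun i j : 'I_n => (i <= j)%N) L Delta Nabla).
Proof.
move=> ts excE ld C; have [Z _] := exists_zero_object D.
(* Families on ['I_n] are extended to [nat] with an arbitrary default value. *)
pose fam (G : 'I_n -> D) (k : nat) : dtri_of D := if insub k is Some i then G i else Z.
have famE G (i : 'I_n) : fam G i = G i by rewrite /fam valK.
have famO G k (lk : (k < n)%N) : fam G k = G (Ordinal lk).
  by rewrite -(famE G (Ordinal lk)).
pose e := fam E; pose f := fam F.
have dp : dual_pair n e f.
  apply: left_dual_pair.
  - by move=> i lin; rewrite /e (famO _ _ lin); exact: (exc_end excE).
  - move=> i j l lin ljn; rewrite /e (famO _ _ lin) (famO _ _ ljn).
    case/orP=> [ji | /andP[ij l0]]; first exact: (@exc_orth _ _ _ _ excE (Ordinal ljn) (Ordinal lin) ji l).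
    have -> : Ordinal ljn = Ordinal lin by apply/val_inj/esym/eqP.
    by apply: (exc_self excE); apply/eqP.
  - move=> i j lin ljn; rewrite /e (famO _ _ lin) (famO _ _ ljn).
    exact: (exc_fin excE).
  move=> i lin; have [M [Mi mut M0]] := ld (Ordinal lin); exists M; split.
  - by rewrite /e (famO _ _ lin).
  - move=> j ji; have ljn := ltn_trans ji lin.
    by rewrite /e (famO _ _ ljn); exact: (mut (Ordinal ljn)).
  - by rewrite M0 /f (famO _ _ lin).
have CE X : C X <-> span_lt e n X by apply: (exc_spanE (famE E)).
have part1 (leE : forall i, le0 (E i)) (geF : forall i, ge0 (F i)) :
    (forall X, meet_class le0 C X <-> aisle e n 0 X) /\
    (forall X, meet_class ge0 C X <-> coaisle f n 0 X) /\ restricts_to C le0 ge0.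
  have le_e i : (i < n)%N -> le0 (e i).
    by move=> lin; rewrite /e (famO _ _ lin).
  have ge_f i : (i < n)%N -> ge0 (f i).
    by move=> lin; rewrite /f (famO _ _ lin).
  split=> [X|].
    split=> [[lX CX] | AX]; first by apply: (aisle_restrictionE ts dp le_e ge_f) => //; exact/CE.
    by split; [exact: (aisle_le0 ts le_e) | apply/CE; exact: aisle_span AX].
  split=> [X|]; last exact: (restricts_to_span ts dp le_e ge_f).
  split=> [[gX CX] | AX]; first by apply: (coaisle_restrictionE ts dp le_e) => //; exact/CE.
  by split; [exact: (coaisle_ge0 ts ge_f) | apply/CE; exact: (coaisle_span dp (leqnn n) AX)].
split=> [leE geF | hE hF].
  have [le_aisle [ge_coaisle res]] := part1 leE geF.
  have gle X : meet_class le0 C X <-> glued_le E n X.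
    exact: iff_trans (le_aisle X) (iff_sym (glued_leE dp (famE E) X (leqnn n))).
  have gge X : meet_class ge0 C X <-> glued_ge E n X.
    exact: iff_trans (ge_coaisle X) (iff_sym (glued_geE dp (famE E) X (leqnn n))).
  do 3 split=> //; move=> X; split=> [[/gle[lX CX] /gge[gX _]] | [[lX gX] CX]]; first by [].
  by split; [apply/gle | apply/gge].
have [le_aisle [ge_coaisle _]] := part1 (fun i => (hE i).1) (fun i => (hF i).2).
have HpE X : meet_class (heart le0 ge0) C X <-> glued_heart e f n X.
  split=> [[[lX gX] CX] | [/le_aisle[lX CX] /ge_coaisle[gX _]]]; last by [].
  by split; [apply/le_aisle | apply/ge_coaisle].
have Ce i : (i < n)%N -> span_lt e n (e i) by exact: span_lt_e.
have Cf i : (i < n)%N -> span_lt e n (f i) by move=> lin; exact: (span_lt_f dp).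
have hef i : (i < n)%N -> coaisle f n 0 (e i) /\ aisle e n 0 (f i).
  move=> lin; split.
    apply/ge_coaisle; split; last by apply/CE; exact: Ce.
    by rewrite /e (famO _ _ lin); exact: (hE _).2.
  apply/le_aisle; split; last by apply/CE; exact: Cf.
  by rewrite /f (famO _ _ lin); exact: (hF _).1.
(* The bound sits under the existential so that choice yields a family on all of [nat]. *)
have S_ex i : exists S, (i < n)%N -> middle_image e f i S.
  have [lin | _] := boolP (i < n)%N; last by exists Z.
  by have [S SP] := middle_image_exists dp lin (hef i lin).1 (hef i lin).2; exists S.
pose S i := proj1_sig (constructive_indefinite_description _ (S_ex i)).
have HS i : (i < n)%N -> middle_image e f i (S i).
  by rewrite /S; case: constructive_indefinite_description.
have hS (i : 'I_n) : meet_class (heart le0 ge0) C (S i).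
  by apply/HpE; exact: glued_heart_leq (ltn_ord i) (simple_heart HS (ltn_ord i)).
have hE' (i : 'I_n) : meet_class (heart le0 ge0) C (E i).
  by split; [exact: hE | apply/CE; rewrite -(famE E); exact: Ce].
have hF' (i : 'I_n) : meet_class (heart le0 ge0) C (F i).
  by split; [exact: hF | apply/CE; rewrite -(famE F); exact: Cf].
exists (fun i : 'I_n => exist _ (S i : D) (hS i)), (fun i => exist _ (E i) (hE' i)),
  (fun i => exist _ (F i) (hF' i)).
split=> //; split=> //.
by apply: (heart_highest_weight dp HS hef HpE) => i //=; exact: esym (famE _ i).
Qed.
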